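(* Let $\mathcal{A}$ be a semi-abelian category, $\mathcal{E}$ a class of extensions in $\mathcal{A}$, and $\mathcal{B}$ a strongly $\mathcal{E}$-Birkhoff subcategory of $\mathcal{A}$, and suppose that $\mathcal{A}_{\mathcal{E}}$ has enough $\mathcal{E}$-projective objects. Let $n\geq 1$ and let $A\in\mathcal{E}^-$. Then for any two $n$-fold presentations $P$ and $Q$ of $A$ there is an isomorphism $\Delta_n P\cong \Delta_n Q$.
   Context: Semi-abelian means pointed, finitely complete and cocomplete, Barr-exact and Bourn-protomodular. $K[f]$ denotes the kernel (object) of $f$. For a class $\mathcal{E}$ of morphisms in $\mathcal{A}$, $\mathcal{E}^-$ is the class of objects that are the domain or the codomain of at least one arrow in $\mathcal{E}$, and $\mathcal{A}_{\mathcal{E}}$ is the full subcategory of $\mathcal{A}$ on $\mathcal{E}^-$. Class of extensions. A class $\mathcal{E}$ of regular epimorphisms in $\mathcal{A}$ with $0\in\mathcal{E}^-$ is a class of extensions (its members are called ($\mathcal{E}$-)extensions) if: (1) $\mathcal{E}$ contains all split epimorphisms $f\colon A\to B$ with $A,B\in\mathcal{E}^-$; (2) for composable $f\colon A\to B$, $g\colon B\to C$: if $f,g\in\mathcal{E}$ then $g\circ f\in\mathcal{E}$, and if $g\circ f\in\mathcal{E}$ and $B\in\mathcal{E}^-$ then $g\in\mathcal{E}$; (3) for $f\colon A\to B$ in $\mathcal{E}$ and $g\colon C\to B$ in $\mathcal{A}$ with $C\in\mathcal{E}^-$, the pullback $g^*f\colon C\times_B A\to C$ is in $\mathcal{E}$;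 (4) if $0\to K\to A\xrightarrow{f} B\to 0$ is short exact with $A\in\mathcal{E}^-$ and $K\in\mathcal{E}^-$, then $f\in\mathcal{E}$; (5) for every morphism of short exact sequences from $0\to K\to A\xrightarrow{f}B\to 0$ to $0\to L\to C\xrightarrow{g}B\to 0$ with components $k\colon K\to L$, $a\colon A\to C$, $1_B$: if $f,k\in\mathcal{E}$ and $C\in\mathcal{E}^-$, then $a\in\mathcal{E}$. Double extensions. $\mathsf{Arr}\,\mathcal{A}$ is the category of arrows of $\mathcal{A}$, with commutative squares as morphisms. A morphism $(f_1,f_0)\colon a\to b$ from $a\colon A_1\to A_0$ to $b\colon B_1\to B_0$ (with $f_1\colon A_1\to B_1$, $f_0\colon A_0\to B_0$) is a double $\mathcal{E}$-extension if $a,b,f_0,f_1$, the two projections of the pullback $A_0\times_{B_0}B_1$, and the induced arrow $A_1\to A_0\times_{B_0}B_1$ are all in $\mathcal{E}$. $\mathcal{E}^1$ is the class of double $\mathcal{E}$-extensions; it is a class of extensions in $\mathsf{Arr}\,\mathcal{A}$. Higher extensions. Put $0=\varnothing$, $n=\{0,\dots,n-1\}$. An $n$-fold arrow in $\mathcal{A}$ is a functor $A\colon\mathcal{P}(n)^{\mathrm{op}}\to\mathcal{A}$ ($\mathcal{P}(n)$ the powerset ordered by inclusion); $\mathsf{Arr}^n\mathcal{A}$ is the (semi-abelian) category of $n$-fold arrows and natural transformations. Write $A_S=A(S)$, $a_S^T\colon A_T\to A_S$ for $S\subseteq T$, and $a_i=a^n_{n\setminus\{i\}}\colon A_n\to A_{n\setminus\{i\}}$.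 The isomorphism $\delta_{n-1}\colon \mathsf{Arr}^n\mathcal{A}\to\mathsf{Arr}(\mathsf{Arr}^{n-1}\mathcal{A})$ sends $A$ to $(a_S^{S\cup\{n-1\}})_{S\subseteq n-1}\colon (A_{S\cup\{n-1\}})_{S\subseteq n-1}\to(A_S)_{S\subseteq n-1}$. Put $\mathcal{E}^0=\mathcal{E}$ and, inductively for $n\geq1$, let $\mathcal{E}^n$ be the class of arrows $f\colon A\to B$ in $\mathsf{Arr}^n\mathcal{A}$ whose induced square $\delta_{n-1}A\to\delta_{n-1}B$ in $\mathsf{Arr}^{n-1}\mathcal{A}$ is a double $\mathcal{E}^{n-1}$-extension; $\mathcal{E}^n$ is a class of extensions in $\mathsf{Arr}^n\mathcal{A}$. For $n\geq 1$ an $n$-fold ($\mathcal{E}$-)extension is an $n$-fold arrow $A$ with $\delta_{n-1}A\in\mathcal{E}^{n-1}$; a $0$-fold extension is an object of $\mathcal{E}^-$. $\mathsf{Ext}^n\mathcal{A}=(\mathsf{Arr}^n\mathcal{A})_{\mathcal{E}^n}$ is the full subcategory of $\mathsf{Arr}^n\mathcal{A}$ on the $n$-fold extensions. Birkhoff subcategories and central extensions. A full replete reflective subcategory $\mathcal{B}$ of $\mathcal{A}_{\mathcal{E}}$, with reflector $I$ and unit $\eta$, is strongly $\mathcal{E}$-Birkhoff in $\mathcal{A}$ if for every extension $f\colon A\to B$ the naturality square with sides $\eta_A,\ f,\ If,\ \eta_B$ is a double $\mathcal{E}$-extension. An extension $f\colon A\to B$ is trivial (w.r.t. $\mathcal{B}$)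 if this square is a pullback, and central if there is an extension $g\colon C\to B$ such that $g^*f$ is trivial. The full subcategory $\mathsf{CExt}_{\mathcal{B}}\mathcal{A}$ of $\mathsf{Ext}^1\mathcal{A}$ on the central extensions is strongly $\mathcal{E}^1$-Birkhoff in $\mathsf{Arr}\,\mathcal{A}$. Put $\mathcal{B}_0=\mathcal{B}$; inductively, for $n\ge1$, an $n$-fold extension $A$ is an $n$-fold central extension if $\delta_{n-1}A$ is central with respect to $\mathcal{B}_{n-1}$ (in $\mathsf{Arr}^{n-1}\mathcal{A}$, with class of extensions $\mathcal{E}^{n-1}$), and $\mathcal{B}_n$ is the full subcategory of $\mathsf{Ext}^n\mathcal{A}$ on these. It is strongly $\mathcal{E}^n$-Birkhoff in $\mathsf{Arr}^n\mathcal{A}$; let $I_n\colon\mathsf{Ext}^n\mathcal{A}\to\mathcal{B}_n$ be the reflector with unit $\eta^n$. The functors $[\cdot]_n$. Write $[A]=K[\eta_A]$ for $A\in\mathcal{E}^-$. For every $n$-fold extension $A$, the kernel of $\eta^n_A$ has all its components equal to $0$ except the one indexed by the full set $n$; this component is denoted $[A]_n$, and it is a normal subobject of $A_n$. Projectives and Hopf formulae. An object $P$ of $\mathcal{A}$ is $\mathcal{E}$-projective if for every arrow $p\colon P\to B$ and every extension $f\colon A\to B$ there is $p'\colon P\to A$ with $f\circ p'=p$. $\mathcal{A}_{\mathcal{E}}$ has enough $\mathcal{E}$-projective objects if for every $A\in\mathcal{E}^-$ there is an extension $P\to A$ with $P$ $\mathcal{E}$-projective. For $n\geq1$, an $n$-fold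 presentation of $A\in\mathcal{E}^-$ is an $n$-fold extension $P$ with $P_0=P_{\varnothing}=A$ and $P_S$ $\mathcal{E}$-projective for every $\varnothing\neq S\subseteq n$. For such $P$ (with $p_i\colon P_n\to P_{n\setminus\{i\}}$), $$\Delta_nP=\frac{[P_n]\cap\bigcap_{i=0}^{n-1}K[p_i]}{[P]_n}.$$ *)

(* Defs.v *)
From Stdlib Require Import FunctionalExtensionality ProofIrrelevance.
From Stdlib Require List.
From mathcomp Require Import all_boot.

Set Implicit Arguments.
Unset Strict Implicit.
Unset Printing Implicit Defensive.

Declare Scope cat_scope.
Delimit Scope cat_scope with cat.
Local Open Scope cat_scope.

Record Category := {
  ob :> Type;
  hom : ob -> ob -> Type;
  idc : forall X, hom X X;
  cmp : forall X Y Z, hom Y Z -> hom X Y -> hom X Z;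
  cmp_idl : forall X Y (f : hom X Y), cmp (idc Y) f = f;
  cmp_idr : forall X Y (f : hom X Y), cmp f (idc X) = f;
  cmp_assoc : forall X Y Z W (h : hom Z W) (g : hom Y Z) (f : hom X Y),
    cmp h (cmp g f) = cmp (cmp h g) f
}.

Arguments hom {c} _ _.
Arguments idc {c} _.
Arguments cmp {c X Y Z} _ _.
Notation "g ∘ f" := (cmp g f) (at level 40, left associativity) : cat_scope.

Definition op (C : Category) : Category := {|
  ob := C;
  hom := fun X Y => @hom C Y X;
  idc := fun X => @idc C X;
  cmp := fun X Y Z g f => @cmp C Z Y X f g;
  cmp_idl := fun X Y f => @cmp_idr C Y X f;
  cmp_idr := fun X Y f => @cmp_idl C Y X f;
  cmp_assoc := fun X Y Z W h g f => esym (@cmp_assoc C W Z Y X f g h)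
|}.

Record Functor (C D : Category) := {
  fob :> C -> D;
  fmap : forall X Y, @hom C X Y -> @hom D (fob X) (fob Y);
  fmap_id : forall X, fmap (idc X) = idc (fob X);
  fmap_cmp : forall X Y Z (g : @hom C Y Z) (f : @hom C X Y),
    fmap (g ∘ f) = fmap g ∘ fmap f
}.
Arguments fmap {C D} _ {X Y} _.

Record NatTrans (C D : Category) (F G : Functor C D) := {
  component :> forall X : C, @hom D (F X) (G X);
  naturality : forall X Y (f : @hom C X Y),
    component Y ∘ fmap F f = fmap G f ∘ component X
}.

Lemma nat_trans_eq (C D : Category) (F G : Functor C D) (s t : NatTrans F G) :
  (forall X, s X = t X) -> s = t.
Proof.
case: s t => [s hs] [t ht] /= e.
have e' : s = t by apply: functional_extensionality_dep.
by move: {e} hs ht; subst t => hs ht; rewrite (proof_irrelevance _ hs ht).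
Qed.

Definition nat_id (C D : Category) (F : Functor C D) : NatTrans F F.
Proof.
by exists (fun X => idc (F X)) => X Y f; rewrite cmp_idl cmp_idr.
Defined.

Definition nat_cmp (C D : Category) (F G H : Functor C D)
  (t : NatTrans G H) (s : NatTrans F G) : NatTrans F H.
Proof.
exists (fun X => t X ∘ s X) => X Y f.
by rewrite -cmp_assoc naturality cmp_assoc naturality cmp_assoc.
Defined.

Definition FunCat (C D : Category) : Category.
Proof.
refine {| ob := Functor C D; hom := @NatTrans C D;
          idc := @nat_id C D; cmp := @nat_cmp C D |}.
- by move=> F G s; apply: nat_trans_eq => X /=; rewrite cmp_idl.
- by move=> F G s; apply: nat_trans_eq => X /=; rewrite cmp_idr.
- by move=> F G H K u t s; apply: nat_trans_eq => X /=; rewrite cmp_assoc.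
Defined.

Record ArrowOb (C : Category) := {
  adom : C;
  acod : C;
  arr : hom adom acod
}.

(* A morphism (f1, f0) from a to b is a commutative square. *)
Record ArrowHom (C : Category) (a b : ArrowOb C) := {
  ahom1 : hom (adom a) (adom b);
  ahom0 : hom (acod a) (acod b);
  ahom_comm : arr b ∘ ahom1 = ahom0 ∘ arr a
}.

Lemma arrow_hom_eq (C : Category) (a b : ArrowOb C) (s t : ArrowHom a b) :
  ahom1 s = ahom1 t -> ahom0 s = ahom0 t -> s = t.
Proof.
case: s t => [s1 s0 hs] [t1 t0 ht] /= e1 e0.
by subst t1 t0; rewrite (proof_irrelevance _ hs ht).
Qed.

Definition arrow_id (C : Category) (a : ArrowOb C) : ArrowHom a a.
Proof. by exists (idc _) (idc _); rewrite cmp_idl cmp_idr. Defined.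

Definition arrow_cmp (C : Category) (a b c : ArrowOb C)
  (t : ArrowHom b c) (s : ArrowHom a b) : ArrowHom a c.
Proof.
exists (ahom1 t ∘ ahom1 s) (ahom0 t ∘ ahom0 s).
by rewrite cmp_assoc ahom_comm -cmp_assoc ahom_comm cmp_assoc.
Defined.

Definition Arr (C : Category) : Category.
Proof.
refine {| ob := ArrowOb C; hom := @ArrowHom C;
          idc := @arrow_id C; cmp := @arrow_cmp C |}.
- by move=> a b s; apply: arrow_hom_eq => /=; rewrite cmp_idl.
- by move=> a b s; apply: arrow_hom_eq => /=; rewrite cmp_idr.
- by move=> a b c d u t s; apply: arrow_hom_eq => /=; rewrite cmp_assoc.
Defined.

Section Notions.
Variable C : Category.

Definition IsIso (X Y : C) (f : hom X Y) : Prop :=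
  exists g : hom Y X, g ∘ f = idc X /\ f ∘ g = idc Y.

Definition Isomorphic (X Y : C) : Prop := exists f : hom X Y, IsIso f.

Definition IsCone (J : Category) (F : Functor J C) (L : C)
  (l : forall j, hom L (F j)) : Prop :=
  forall i j (u : @hom J i j), fmap F u ∘ l i = l j.

Definition IsLimit (J : Category) (F : Functor J C) (L : C)
  (l : forall j, hom L (F j)) : Prop :=
  IsCone l /\
  forall (T : C) (t : forall j, hom T (F j)), IsCone t ->
    exists! u : hom T L, forall j, l j ∘ u = t j.

Definition IsPullback (X Y Z : C) (f : hom X Z) (g : hom Y Z)
  (P : C) (p : hom P X) (q : hom P Y) : Prop :=
  f ∘ p = g ∘ q /\
  forall (T : C) (x : hom T X) (y : hom T Y), f ∘ x = g ∘ y ->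
    exists! u : hom T P, p ∘ u = x /\ q ∘ u = y.

Definition IsKernelPair (X Y : C) (f : hom X Y) (R : C) (r0 r1 : hom R X) : Prop :=
  IsPullback f f r0 r1.

Definition IsCoequalizer (X Y : C) (u v : hom X Y) (Q : C) (q : hom Y Q) : Prop :=
  q ∘ u = q ∘ v /\
  forall (T : C) (t : hom Y T), t ∘ u = t ∘ v -> exists! w : hom Q T, w ∘ q = t.

Definition RegularEpi (X Y : C) (f : hom X Y) : Prop :=
  exists (W : C) (u v : hom W X), IsCoequalizer u v f.

Definition SplitEpi (X Y : C) (f : hom X Y) : Prop :=
  exists s : hom Y X, f ∘ s = idc Y.

Definition IsZeroOb (Z : C) : Prop :=
  forall X : C, (exists! f : hom X Z, True) /\ (exists! f : hom Z X, True).

Definition IsZeroMor (X Y : C) (f : hom X Y) : Prop :=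
  exists (Z : C) (a : hom X Z) (b : hom Z Y), IsZeroOb Z /\ f = b ∘ a.

Definition IsKernel (X Y : C) (f : hom X Y) (K : C) (k : hom K X) : Prop :=
  IsZeroMor (f ∘ k) /\
  forall (T : C) (t : hom T X), IsZeroMor (f ∘ t) -> exists! u : hom T K, k ∘ u = t.

Definition IsCokernel (X Y : C) (f : hom X Y) (Q : C) (q : hom Y Q) : Prop :=
  IsZeroMor (q ∘ f) /\
  forall (T : C) (t : hom Y T), IsZeroMor (t ∘ f) -> exists! u : hom Q T, u ∘ q = t.

Definition ShortExact (K X Y : C) (k : hom K X) (f : hom X Y) : Prop :=
  IsKernel f k /\ IsCokernel k f.

Definition IsIntersection (I : Type) (X : C) (K : I -> C) (k : forall i, hom (K i) X)
  (M : C) (m : hom M X) : Prop :=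
  (forall i, exists u : hom M (K i), k i ∘ u = m) /\
  forall (T : C) (t : hom T X), (forall i, exists u : hom T (K i), k i ∘ u = t) ->
    exists! w : hom T M, m ∘ w = t.

Record InternalEquivalenceRelation (X R : C) (r0 r1 : hom R X) : Prop := {
  ier_mono : forall (T : C) (u v : hom T R),
    r0 ∘ u = r0 ∘ v -> r1 ∘ u = r1 ∘ v -> u = v;
  ier_refl : exists e : hom X R, r0 ∘ e = idc X /\ r1 ∘ e = idc X;
  ier_sym : exists s : hom R R, r0 ∘ s = r1 /\ r1 ∘ s = r0;
  ier_trans : forall (P : C) (p q : hom P R), IsPullback r1 r0 p q ->
    exists t : hom P R, r0 ∘ t = r0 ∘ p /\ r1 ∘ t = r1 ∘ q
}.

End Notions.

Definition FiniteType (T : Type) : Prop := exists l : list T, forall x, List.In x l.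

Definition FiniteCategory (J : Category) : Prop :=
  FiniteType J /\ forall i j : J, FiniteType (hom i j).

Definition FinitelyComplete (C : Category) : Prop :=
  forall J : Category, FiniteCategory J -> forall F : Functor J C,
    exists (L : C) (l : forall j, hom L (F j)), IsLimit l.

(* Colimits of a functor J -> C^op are limits in C^op, and the opposite of a finite
   category is finite. *)
Definition FinitelyCocomplete (C : Category) : Prop := FinitelyComplete (op C).

Definition Pointed (C : Category) : Prop := exists Z : C, IsZeroOb Z.

Record RegularCategory (C : Category) : Prop := {
  reg_lim : FinitelyComplete C;
  reg_coeq : forall (X Y R : C) (f : hom X Y) (r0 r1 : hom R X),
    IsKernelPair f r0 r1 -> exists (Q : C) (q : hom X Q), IsCoequalizer r0 r1 q;
  reg_stable : forall (X Y Z P : C) (f : hom X Z) (g : hom Y Z)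
    (p : hom P X) (q : hom P Y),
    IsPullback f g p q -> RegularEpi f -> RegularEpi q
}.

Record BarrExact (C : Category) : Prop := {
  exact_reg : RegularCategory C;
  exact_eff : forall (X R : C) (r0 r1 : hom R X), InternalEquivalenceRelation r0 r1 ->
    exists (Y : C) (f : hom X Y), IsKernelPair f r0 r1
}.

(* For every v : X -> Y the change-of-base functor v^* : Pt(Y) -> Pt(X) reflects
   isomorphisms; h is a morphism of points (A, p, s) -> (A', p', s') over Y and
   k : W -> W' is its image under v^*. *)
Definition Protomodular (C : Category) : Prop :=
  forall (X Y : C) (v : hom X Y)
    (A A' : C) (p : hom A Y) (s : hom Y A) (p' : hom A' Y) (s' : hom Y A')
    (h : hom A A')
    (W W' : C) (x : hom W X) (a : hom W A) (x' : hom W' X) (a' : hom W' A')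
    (k : hom W W'),
    p ∘ s = idc Y -> p' ∘ s' = idc Y -> p' ∘ h = p -> h ∘ s = s' ->
    IsPullback v p x a -> IsPullback v p' x' a' ->
    x' ∘ k = x -> a' ∘ k = h ∘ a ->
    IsIso k -> IsIso h.

Record SemiAbelian (C : Category) : Prop := {
  sa_pointed : Pointed C;
  sa_complete : FinitelyComplete C;
  sa_cocomplete : FinitelyCocomplete C;
  sa_exact : BarrExact C;
  sa_proto : Protomodular C
}.

Definition ArrowClass (C : Category) := forall X Y : C, hom X Y -> Prop.

(* The class of objects written E^-. *)
Definition Eob (C : Category) (E : ArrowClass C) (X : C) : Prop :=
  exists (Y Z : C) (f : hom Y Z), E Y Z f /\ (X = Y \/ X = Z).

Record ClassOfExtensions (C : Category) (E : ArrowClass C) : Prop := {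
  ext_regular : forall (X Y : C) (f : hom X Y), E X Y f -> RegularEpi f;
  ext_zero : exists Z : C, IsZeroOb Z /\ Eob E Z;
  ext_split : forall (X Y : C) (f : hom X Y), Eob E X -> Eob E Y -> SplitEpi f -> E X Y f;
  ext_cmp : forall (X Y Z : C) (f : hom X Y) (g : hom Y Z),
    E X Y f -> E Y Z g -> E X Z (g ∘ f);
  ext_cancel : forall (X Y Z : C) (f : hom X Y) (g : hom Y Z),
    E X Z (g ∘ f) -> Eob E Y -> E Y Z g;
  ext_pullback : forall (A B D P : C) (f : hom A B) (g : hom D B)
    (p : hom P D) (q : hom P A),
    E A B f -> Eob E D -> IsPullback g f p q -> E P D p;
  ext_exact : forall (K A B : C) (k : hom K A) (f : hom A B),
    ShortExact k f -> Eob E A -> Eob E K -> E A B f;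
  ext_five : forall (K A B L D : C) (i : hom K A) (f : hom A B)
    (j : hom L D) (g : hom D B) (k : hom K L) (a : hom A D),
    ShortExact i f -> ShortExact j g -> a ∘ i = j ∘ k -> g ∘ a = f ->
    E A B f -> E K L k -> Eob E D -> E A D a
}.

(* The square
       A1 --f1--> B1
        |a         |b
       A0 --f0--> B0
   seen as a morphism (f1, f0) : a -> b of Arr C. *)
Definition IsDoubleExtension (C : Category) (E : ArrowClass C) (A1 A0 B1 B0 : C)
  (a : hom A1 A0) (b : hom B1 B0) (f1 : hom A1 B1) (f0 : hom A0 B0) : Prop :=
  [/\ E _ _ a, E _ _ b, E _ _ f1, E _ _ f0 &
      b ∘ f1 = f0 ∘ a /\
      exists (P : C) (p : hom P A0) (q : hom P B1) (u : hom A1 P),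
        [/\ IsPullback f0 b p q, E _ _ p, E _ _ q, p ∘ u = a /\ q ∘ u = f1 & E _ _ u]].

Definition DoubleExt (C : Category) (E : ArrowClass C) : ArrowClass (Arr C) :=
  fun (a b : ArrowOb C) (f : ArrowHom a b) =>
    IsDoubleExtension E (arr a) (arr b) (ahom1 f) (ahom0 f).

(* A full subcategory is given by its class B of objects; eta : X -> R is the
   universal arrow from X to B, i.e. R = I X and eta is the unit. *)
Definition IsReflection (C : Category) (B : C -> Prop) (X R : C) (eta : hom X R) : Prop :=
  B R /\ forall (Y : C) (f : hom X Y), B Y -> exists! g : hom R Y, g ∘ eta = f.

Record StronglyBirkhoff (C : Category) (E : ArrowClass C) (B : C -> Prop) : Prop := {
  birk_sub : forall X : C, B X -> Eob E X;
  birk_replete : forall X Y : C, B X -> Eob E Y -> Isomorphic X Y -> B Y;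
  birk_reflective : forall X : C, Eob E X ->
    exists (R : C) (eta : hom X R), IsReflection B eta;
  birk_square : forall (X Y : C) (f : hom X Y) (IX IY : C)
    (etaX : hom X IX) (etaY : hom Y IY) (If : hom IX IY),
    E X Y f -> IsReflection B etaX -> IsReflection B etaY ->
    If ∘ etaX = etaY ∘ f -> IsDoubleExtension E etaX etaY f If
}.

Definition TrivialExt (C : Category) (E : ArrowClass C) (B : C -> Prop)
  (X Y : C) (f : hom X Y) : Prop :=
  E X Y f /\
  exists (IX IY : C) (etaX : hom X IX) (etaY : hom Y IY) (If : hom IX IY),
    [/\ IsReflection B etaX, IsReflection B etaY & IsPullback etaY If f etaX].

Definition CentralExt (C : Category) (E : ArrowClass C) (B : C -> Prop)
  (X Y : C) (f : hom X Y) : Prop :=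
  E X Y f /\
  exists (Z : C) (g : hom Z Y), E Z Y g /\
  exists (P : C) (p : hom P Z) (q : hom P X),
    IsPullback g f p q /\ TrivialExt E B p.

Definition Pow (n : nat) : Category := {|
  ob := {set 'I_n};
  hom := fun S T => S \subset T;
  idc := fun S => subxx S;
  cmp := fun S T U (hTU : T \subset U) (hST : S \subset T) => subset_trans hST hTU;
  cmp_idl := fun S T f => bool_irrelevance _ _;
  cmp_idr := fun S T f => bool_irrelevance _ _;
  cmp_assoc := fun S T U V h g f => bool_irrelevance _ _
|}.

Definition NArr (C : Category) (n : nat) : Category := FunCat (op (Pow n)) C.

(* The arrow a_S^T : A_T -> A_S for S included in T. *)
Definition face (C : Category) (n : nat) (A : NArr C n) (S T : {set 'I_n})
  (h : S \subset T) : hom (fob A T) (fob A S) :=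
  @fmap (op (Pow n)) C A T S h.

(* A subset S of n = {0, ..., n-1}, seen as a subset of n + 1, and S u {n}. *)
Definition wid (n : nat) (S : {set 'I_n}) : {set 'I_n.+1} := widen_ord (leqnSn n) @: S.
Definition widU (n : nat) (S : {set 'I_n}) : {set 'I_n.+1} := ord_max |: wid S.

Lemma wid_sub (n : nat) (S T : {set 'I_n}) : S \subset T -> wid S \subset wid T.
Proof. exact: imsetS. Qed.

Lemma widU_sub (n : nat) (S T : {set 'I_n}) : S \subset T -> widU S \subset widU T.
Proof. by move=> h; apply/setUS/wid_sub. Qed.

Lemma wid_widU (n : nat) (S : {set 'I_n}) : wid S \subset widU S.
Proof. exact: subsetUr. Qed.

Definition restrict (C : Category) (m n : nat) (w : {set 'I_n} -> {set 'I_m})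
  (hw : forall S T : {set 'I_n}, S \subset T -> w S \subset w T)
  (A : NArr C m) : NArr C n.
Proof.
refine (@Build_Functor (op (Pow n)) C (fun S => fob A (w S))
          (fun T S (h : S \subset T) => face A (hw S T h)) _ _).
- move=> S; rewrite -(fmap_id A); congr (fmap A _); exact: bool_irrelevance.
- move=> X Y Z g f; rewrite /face -(fmap_cmp A); congr (fmap A _); exact: bool_irrelevance.
Defined.

Definition restrict_map (C : Category) (m n : nat) (w : {set 'I_n} -> {set 'I_m})
  (hw : forall S T : {set 'I_n}, S \subset T -> w S \subset w T)
  (A B : NArr C m) (f : hom A B) : hom (restrict hw A) (restrict hw B).
Proof.
exists (fun S : op (Pow n) => component f (w S)) => T S h.
exact: (naturality f (hw S T h : @hom (op (Pow m)) (w T) (w S))).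
Defined.

Definition delta_arr (C : Category) (n : nat) (A : NArr C n.+1) :
  @hom (NArr C n) (restrict (@widU_sub n) A) (restrict (@wid_sub n) A).
Proof.
exists (fun S : op (Pow n) => face A (wid_widU S)) => T S h.
rewrite /= /face -!(fmap_cmp A); congr (fmap A _); exact: bool_irrelevance.
Defined.

(* delta C n is the functor written delta_n, from Arr^{n+1} to Arr (Arr^n). *)
Definition delta (C : Category) (n : nat) : Functor (NArr C n.+1) (Arr (NArr C n)).
Proof.
refine (@Build_Functor (NArr C n.+1) (Arr (NArr C n))
  (fun A => Build_ArrowOb (delta_arr A))
  (fun A B f => @Build_ArrowHom (NArr C n)
     (Build_ArrowOb (delta_arr A)) (Build_ArrowOb (delta_arr B))
     (restrict_map (@widU_sub n) f) (restrict_map (@wid_sub n) f) _) _ _).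
- by move=> A; apply: arrow_hom_eq; apply: nat_trans_eq.
- by move=> X Y Z g f; apply: arrow_hom_eq; apply: nat_trans_eq.
Unshelve.
apply: nat_trans_eq => S /=; apply: esym.
exact: (naturality f (wid_widU S : @hom (op (Pow n.+1)) (widU S) (wid S))).
Defined.

(* The class E^n; Arr^0 C is identified with C through evaluation at the empty set. *)
Fixpoint Epow (C : Category) (E : ArrowClass C) (n : nat) : ArrowClass (NArr C n) :=
  match n return ArrowClass (NArr C n) with
  | 0 => fun A B f => E _ _ (component f set0)
  | m.+1 => fun A B f => @DoubleExt (NArr C m) (@Epow C E m) _ _ (fmap (delta C m) f)
  end.
Arguments Epow {C} E n _ _ _.

Definition NExtension (C : Category) (E : ArrowClass C) (n : nat) : NArr C n -> Prop :=
  match n return NArr C n -> Prop with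
  | 0 => fun A => Eob E (fob A set0)
  | m.+1 => fun A => Epow E m _ _ (arr (delta C m A))
  end.

Fixpoint Bpow (C : Category) (E : ArrowClass C) (B : C -> Prop) (n : nat) :
  NArr C n -> Prop :=
  match n return NArr C n -> Prop with
  | 0 => fun A => B (fob A set0)
  | m.+1 => fun A => @CentralExt (NArr C m) (Epow E m) (@Bpow C E B m) _ _
                       (arr (delta C m A))
  end.
Arguments Bpow {C} E B n _.

Definition Projective (C : Category) (E : ArrowClass C) (P : C) : Prop :=
  forall (A B : C) (p : hom P B) (f : hom A B), E A B f ->
    exists p' : hom P A, f ∘ p' = p.

Definition EnoughProjectives (C : Category) (E : ArrowClass C) : Prop :=
  forall A : C, Eob E A -> exists (P : C) (f : hom P A), E P A f /\ Projective E P.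

Definition IsPresentation (C : Category) (E : ArrowClass C) (n : nat) (A : C)
  (P : NArr C n) : Prop :=
  [/\ NExtension E P, fob P set0 = A &
      forall S : {set 'I_n}, S != set0 -> Projective E (fob P S)].

(* k : K -> X is the kernel [X] of the unit at X of the reflection to B. *)
Definition IsBracket (C : Category) (B : C -> Prop) (X K : C) (k : hom K X) : Prop :=
  exists (R : C) (eta : hom X R), IsReflection B eta /\ IsKernel eta k.

(* D is the quotient Delta_n P.  Here v is [P_n] -> P_n, k i is the kernel of p_i,
   l is the intersection of the k i, M is the intersection of v and l, N is the
   kernel of the unit of P in Arr^n, whose component at the full set is [P]_n,
   and j is the inclusion of [P]_n in M. *)
Definition IsDelta (C : Category) (E : ArrowClass C) (B : C -> Prop) (n : nat)
  (P : NArr C n) (D : C) : Prop :=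
  exists (V : C) (v : hom V (fob P setT))
         (K : 'I_n -> C) (k : forall i, hom (K i) (fob P setT))
         (L : C) (l : hom L (fob P setT))
         (M : C) (mv : hom M V) (ml : hom M L)
         (N : NArr C n) (kappa : hom N P)
         (j : hom (fob N setT) M) (q : hom M D),
    [/\ IsBracket B v,
        forall i, IsKernel (face P (subsetT [set~ i])) (k i),
        IsIntersection k l /\ IsPullback v l mv ml,
        @IsBracket (NArr C n) (Bpow E B n) P N kappa &
        v ∘ (mv ∘ j) = component kappa setT /\ IsCokernel j q].

(* Main.v *)
Require Import Defs.
From Stdlib Require Import ClassicalEpsilon.
From mathcomp Require Import all_boot.

(** The two presentations are compared through lifts.  A presentation is a cube of
    projectives except at its terminal vertex [A], so the identity of [A] extends to maps of
    cubes [P -> Q] and [Q -> P] (lemma [cube_lift]), and these induce maps between the two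
    quotients (lemma [delta_functorial]).  The composite on [P] need not be the identity of
    [P], but it fixes [A]; hence everything rests on theorem [agreement]: two maps from [P]
    to an [n]-fold central extension [X] that coincide at the terminal vertex coincide on
    the numerator of the Hopf formula.  Applied to the unit [P -> X] of the reflection it
    gives the identity on the quotient, which embeds into the initial vertex of [X].

    Central extensions enter through a criterion in terms of elements (lemma [centralP]):
    an extension [f : X -> Y] is central if and only if any two maps [u, v : T -> X] with
    [f u = f v] agree on the bracket [[T]].  For [n = 1] this is the agreement theorem.  The
    criterion also produces the reflection: [[f]_1] consists of the [x] such that [(0, x)]
    lies in the bracket of the kernel pair of [f], and it is normal because it is the zero
    class of a reflexive relation, which is effective (lemma [centralization_ex]).  Double
    extensions are governed by the kernels of their edges (lemmas [double_of_ker] and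
    [ker_of_double]).  From these facts central extensions form again a strongly Birkhoff
    subcategory of the arrow category (lemma [arrow_data]), so that a statement about
    [n]-fold arrows in all Birkhoff situations can be proved by induction on [n], an
    [n + 1]-fold arrow being an [n]-fold arrow of arrows.

    For the induction step of the agreement theorem, first suppose that the two maps
    coincide on the edge in the first direction at the terminal vertex.  Then they are maps
    of [n]-fold arrows of arrows that coincide at the terminal vertex, and the numerators
    are the same: the arrow at the initial vertex has a projective codomain, hence splits,
    and the bracket of a split extension is the intersection of its kernel with the bracket
    of its domain (lemma [split_bracket]).  In general one interpolates by a third map that
    agrees with the first map on the edge in direction 0 and with the second one on the edge
    in direction 1.  The second comparison reduces to the first by exchanging the directions
    0 and 1, which is legitimate because double central extensions are symmetric (lemma
    [transpose_data]): centrality of a square says that a two-by-two matrix of elements of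
    the initial vertex, lying in the bracket and having three zero entries, vanishes.

    Higher extensions are defined by splitting off the last direction, while the induction
    splits off the first one; lemmas [delta_data], [peel_data] and [swap_data] relate these
    points of view, as equivalences that preserve and reflect extensions and central
    extensions. *)

Set Implicit Arguments.
Unset Strict Implicit.
Unset Printing Implicit Defensive.
Local Open Scope cat_scope.

(** * Categories with zero morphisms and pullbacks *)

Lemma post (C : Category) (X Y Z : C) (g : hom Y Z) (f : hom X Y) (h : hom X Z) :
  g ∘ f = h -> forall (W : C) (x : hom W X), g ∘ (f ∘ x) = h ∘ x.
Proof. by move=> <- W x; rewrite cmp_assoc. Qed.

Ltac nf := rewrite -?cmp_assoc ?cmp_idl ?cmp_idr.
Tactic Notation "crw" constr(e) := first [rewrite e | rewrite (post e)]; nf.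

Section Basics.
Variable C : Category.
Implicit Types X Y Z T K L P : C.

Definition Mono X Y (m : hom X Y) : Prop :=
  forall T (u v : hom T X), m ∘ u = m ∘ v -> u = v.

Definition Epi X Y (e : hom X Y) : Prop :=
  forall T (u v : hom Y T), u ∘ e = v ∘ e -> u = v.

Lemma regular_epi_epi X Y (f : hom X Y) : RegularEpi f -> Epi f.
Proof.
case=> W [u [v [e h]]] T a b ab.
have c : (b ∘ f) ∘ u = (b ∘ f) ∘ v by nf; rewrite e.
have [w [_ uw]] := h _ _ c.
by rewrite -(uw a ab) -(uw b erefl).
Qed.

Lemma epi_cmp X Y Z (f : hom X Y) (g : hom Y Z) : Epi f -> Epi g -> Epi (g ∘ f).
Proof. by move=> hf hg T u v; rewrite !cmp_assoc => /hf /hg. Qed.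

Lemma iso_id X : IsIso (idc X).
Proof. by exists (idc X); rewrite cmp_idl. Qed.

Lemma iso_cmp X Y Z (f : hom X Y) (g : hom Y Z) : IsIso f -> IsIso g -> IsIso (g ∘ f).
Proof.
case=> f' [a b] [g' [c d]]; exists (f' ∘ g'); nf.
by rewrite (post c) cmp_idl (post b) cmp_idl.
Qed.

Lemma iso_epi X Y (f : hom X Y) : IsIso f -> Epi f.
Proof.
case=> g [_ fg] T u v e.
by rewrite -(cmp_idr u) -(cmp_idr v) -fg !cmp_assoc e.
Qed.

Lemma iso_mono X Y (f : hom X Y) : IsIso f -> Mono f.
Proof.
case=> g [gf _] T u v e.
by rewrite -(cmp_idl u) -(cmp_idl v) -gf -!cmp_assoc e.
Qed.

Lemma regular_epi_iso_cmp X Y Z (f : hom X Y) (u : hom Y Z) :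
  RegularEpi f -> IsIso u -> RegularEpi (u ∘ f).
Proof.
move=> [W [a [b [e h]]]] iu; have [v [vu uv]] := iu.
exists W, a, b; split; first by rewrite -!cmp_assoc e.
move=> T t /h[g [hg ug]]; exists (g ∘ v); split.
  by rewrite -!cmp_assoc (cmp_assoc v) vu cmp_idl.
move=> w hw; apply: (iso_epi iu); rewrite -cmp_assoc vu cmp_idr.
by apply: ug; rewrite -cmp_assoc.
Qed.

Lemma pb_lift X Y Z (f : hom X Z) (g : hom Y Z) P (p : hom P X) (q : hom P Y) :
  IsPullback f g p q -> forall T (x : hom T X) (y : hom T Y), f ∘ x = g ∘ y ->
  exists u : hom T P, p ∘ u = x /\ q ∘ u = y.
Proof. by case=> _ h T x y /h[u [hu _]]; exists u. Qed.

Lemma pb_mono X Y Z (f : hom X Z) (g : hom Y Z) P (p : hom P X) (q : hom P Y) :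
  IsPullback f g p q -> forall T (u v : hom T P), p ∘ u = p ∘ v -> q ∘ u = q ∘ v -> u = v.
Proof.
case=> e h T u v a b.
have c : f ∘ (p ∘ u) = g ∘ (q ∘ u) by rewrite !cmp_assoc e.
have [w [_ uw]] := h _ _ _ c.
by rewrite -(uw u) // (uw v).
Qed.

Lemma mk_pb X Y Z (f : hom X Z) (g : hom Y Z) P (p : hom P X) (q : hom P Y) :
  f ∘ p = g ∘ q ->
  (forall T (u v : hom T P), p ∘ u = p ∘ v -> q ∘ u = q ∘ v -> u = v) ->
  (forall T (x : hom T X) (y : hom T Y), f ∘ x = g ∘ y ->
     exists u : hom T P, p ∘ u = x /\ q ∘ u = y) ->
  IsPullback f g p q.
Proof.
move=> e m h; split=> // T x y /h[u [a b]]; exists u; split=> // v [c d].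
by apply: m; rewrite ?a ?b ?c ?d.
Qed.

Lemma pb_sym X Y Z (f : hom X Z) (g : hom Y Z) P (p : hom P X) (q : hom P Y) :
  IsPullback f g p q -> IsPullback g f q p.
Proof.
move=> h; apply: mk_pb; first by rewrite (proj1 h).
- by move=> T u v a b; apply: (pb_mono h).
- by move=> T x y /esym /(pb_lift h)[u [a b]]; exists u.
Qed.

Lemma pb_id X Y (f : hom X Y) : IsPullback f (idc Y) (idc X) f.
Proof.
apply: mk_pb; first by nf.
- by move=> T u v; rewrite !cmp_idl.
- by move=> T x y; nf => e; exists x; nf.
Qed.

Lemma pb_uniq X Y Z (f : hom X Z) (g : hom Y Z) P (p : hom P X) (q : hom P Y)
  P' (p' : hom P' X) (q' : hom P' Y) :
  IsPullback f g p q -> IsPullback f g p' q' ->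
  exists u : hom P P', [/\ IsIso u, p' ∘ u = p & q' ∘ u = q].
Proof.
move=> h h'.
have [u [a b]] := pb_lift h' (proj1 h).
have [v [c d]] := pb_lift h (proj1 h').
exists u; split=> //; exists v; split.
- by apply: (pb_mono h); nf; rewrite cmp_assoc ?c ?d.
- by apply: (pb_mono h'); nf; rewrite cmp_assoc ?a ?b.
Qed.

Lemma zero_uniq X Y (f g : hom X Y) : IsZeroMor f -> IsZeroMor g -> f = g.
Proof.
case=> Z [a [b [hZ ->]]] [Z' [a' [b' [hZ' ->]]]].
have [[w _] _] := hZ' Z.
have [_ [b0 [_ ub]]] := hZ Y.
have [[a0 [_ ua]] _] := hZ' X.
rewrite -(ub b I) (ub (b' ∘ w) I) -(ua a' I) (ua (w ∘ a) I).
by nf.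
Qed.

Section Zero.
Hypothesis hP : Pointed C.

Lemma zero_ex X Y : exists f : hom X Y, IsZeroMor f.
Proof.
case: hP => Z hZ; have [[a _] _] := hZ X; have [_ [b _]] := hZ Y.
by exists (b ∘ a), Z, a, b.
Qed.

Definition zm X Y : hom X Y := proj1_sig (constructive_indefinite_description _ (zero_ex X Y)).

Lemma zm_zero X Y : IsZeroMor (zm X Y).
Proof. by rewrite /zm; case: constructive_indefinite_description. Qed.

Lemma zmP X Y (f : hom X Y) : IsZeroMor f <-> f = zm X Y.
Proof. by split=> [h | ->]; [apply: zero_uniq => // |]; apply: zm_zero. Qed.

Lemma zm_l X Y Z (g : hom Y Z) : g ∘ zm X Y = zm X Z.
Proof.
have [O [a [b [hO ->]]]] := zm_zero X Y.
by apply/zmP; exists O, a, (g ∘ b); nf.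
Qed.

Lemma zm_r X Y Z (f : hom X Y) : zm Y Z ∘ f = zm X Z.
Proof.
have [O [a [b [hO ->]]]] := zm_zero Y Z.
by apply/zmP; exists O, (a ∘ f), b; nf.
Qed.

Lemma to_zero Z : IsZeroOb Z -> forall T (u v : hom T Z), u = v.
Proof. by move=> h T u v; have [[w [_ uw]] _] := h T; rewrite -(uw u I) (uw v I). Qed.

Lemma from_zero Z : IsZeroOb Z -> forall T (u v : hom Z T), u = v.
Proof. by move=> h T u v; have [_ [w [_ uw]]] := h T; rewrite -(uw u I) (uw v I). Qed.

Lemma zero_obP Z : idc Z = zm Z Z -> IsZeroOb Z.
Proof.
move=> e X; split.
- by exists (zm X Z); split=> // f _; rewrite -(cmp_idl f) e zm_r.
- by exists (zm Z X); split=> // f _; rewrite -(cmp_idr f) e zm_l.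
Qed.

Lemma ker0 X Y (f : hom X Y) K (k : hom K X) : IsKernel f k -> f ∘ k = zm K Y.
Proof. by case=> /zmP. Qed.

Lemma ker_lift X Y (f : hom X Y) K (k : hom K X) : IsKernel f k ->
  forall T (t : hom T X), f ∘ t = zm T Y -> exists u, k ∘ u = t.
Proof. by case=> _ h T t /zmP/h[u [hu _]]; exists u. Qed.

Lemma ker_mono X Y (f : hom X Y) K (k : hom K X) : IsKernel f k -> Mono k.
Proof.
move=> hk T u v e; have [_ h] := hk.
have z : IsZeroMor (f ∘ (k ∘ u)) by apply/zmP; rewrite cmp_assoc (ker0 hk) zm_r.
have [w [_ uw]] := h _ _ z.
by rewrite -(uw u) // (uw v).
Qed.

Lemma mk_ker X Y (f : hom X Y) K (k : hom K X) : f ∘ k = zm K Y -> Mono k ->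
  (forall T (t : hom T X), f ∘ t = zm T Y -> exists u, k ∘ u = t) -> IsKernel f k.
Proof.
move=> e m h; split; first by apply/zmP.
move=> T t /zmP/h[u hu]; exists u; split=> // v hv.
by apply: m; rewrite hu hv.
Qed.

Lemma coker_lift X Y (f : hom X Y) Q (q : hom Y Q) : IsCokernel f q ->
  forall T (t : hom Y T), t ∘ f = zm X T -> exists u, u ∘ q = t.
Proof. by case=> _ h T t /zmP/h[u [hu _]]; exists u. Qed.

Lemma coker0 X Y (f : hom X Y) Q (q : hom Y Q) : IsCokernel f q -> q ∘ f = zm X Q.
Proof. by case=> /zmP. Qed.

Lemma coker_epi X Y (f : hom X Y) Q (q : hom Y Q) : IsCokernel f q -> Epi q.
Proof.
move=> hk T u v e; have [_ h] := hk.
have z : IsZeroMor ((u ∘ q) ∘ f) by apply/zmP; nf; rewrite (coker0 hk) zm_l.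
have [w [_ uw]] := h _ _ z.
by rewrite -(uw u) // (uw v).
Qed.

Lemma mk_coker X Y (f : hom X Y) Q (q : hom Y Q) : q ∘ f = zm X Q -> Epi q ->
  (forall T (t : hom Y T), t ∘ f = zm X T -> exists u, u ∘ q = t) -> IsCokernel f q.
Proof.
move=> e m h; split; first by apply/zmP.
move=> T t /zmP/h[u hu]; exists u; split=> // v hv.
by apply: m; rewrite hu hv.
Qed.

Lemma coker_regular X Y (f : hom X Y) Q (q : hom Y Q) : IsCokernel f q -> RegularEpi q.
Proof.
move=> h; exists X, f, (zm X Y); split; first by rewrite (coker0 h) zm_l.
by move=> T t; rewrite zm_l => /zmP; apply: (proj2 h).
Qed.

Lemma ker_of_pb X Y Z (f : hom X Z) (g : hom Y Z) P (p : hom P X) (q : hom P Y)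
  K (k : hom K P) : IsPullback f g p q -> IsKernel p k -> IsKernel g (q ∘ k).
Proof.
move=> h hk; apply: mk_ker.
- by rewrite cmp_assoc -(proj1 h); nf; rewrite (ker0 hk) zm_l.
- move=> T u v; nf => e; apply: (ker_mono hk); apply: (pb_mono h) => //.
  by rewrite !cmp_assoc (ker0 hk) !zm_r.
- move=> T t e.
  have [u [a b]] : exists u, p ∘ u = zm T X /\ q ∘ u = t by apply: (pb_lift h); rewrite zm_l.
  by have [w hw] := ker_lift hk a; exists w; nf; rewrite hw.
Qed.

Lemma zero_mono_ker X Y (f : hom X Y) Z : IsZeroOb Z ->
  (forall T (t : hom T X), f ∘ t = zm T Y -> t = zm T X) -> IsKernel f (zm Z X).
Proof.
move=> hZ h; apply: mk_ker; first by rewrite zm_l.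
- by move=> T u v _; apply: to_zero.
- by move=> T t /h->; exists (zm T Z); rewrite zm_l.
Qed.

Lemma ker_pb X Y (f : hom X Y) K (k : hom K X) Z (z : hom Z Y) (w : hom K Z) : IsZeroOb Z ->
  IsKernel f k -> IsPullback z f w k.
Proof.
move=> hZ h; have -> : z = zm Z Y by apply: from_zero.
have -> : w = zm K Z by apply: to_zero.
apply: mk_pb; first by rewrite zm_r (ker0 h).
- by move=> T u v _; apply: (ker_mono h).
- move=> T x y; rewrite zm_r => /esym /(ker_lift h)[u hu]; exists u; split=> //.
  exact: to_zero.
Qed.

Lemma pb_ker X Y (f : hom X Y) K (k : hom K X) Z (z : hom Z Y) (w : hom K Z) : IsZeroOb Z ->
  IsPullback z f w k -> IsKernel f k.
Proof.
move=> hZ h.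
have ez : z = zm Z Y by apply: from_zero.
apply: mk_ker.
- by rewrite -(proj1 h) ez zm_r.
- by move=> T u v; apply: (pb_mono h); apply: to_zero.
- move=> T t e.
  have [|u [_ b]] := @pb_lift _ _ _ _ _ _ _ _ h T (zm T Z) t; last by exists u.
  by rewrite e zm_l.
Qed.

End Zero.

(** The fragment of semi-abelianness on which the theory of extensions rests.  It passes
    to arrow categories, where pullbacks and quotients are pointwise, and along
    equivalences. *)
Record NormalExact : Prop := {
  ne_pointed : Pointed C;
  ne_pb : forall X Y Z (f : hom X Z) (g : hom Y Z),
    exists P (p : hom P X) (q : hom P Y), IsPullback f g p q;
  ne_coker : forall X Y (f : hom X Y) K (k : hom K X),
    RegularEpi f -> IsKernel f k -> IsCokernel k f;
  ne_refl : forall X R (r0 r1 : hom R X),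
    (forall T (u v : hom T R), r0 ∘ u = r0 ∘ v -> r1 ∘ u = r1 ∘ v -> u = v) ->
    (exists e : hom X R, r0 ∘ e = idc X /\ r1 ∘ e = idc X) ->
    exists Y (f : hom X Y), RegularEpi f /\ IsKernelPair f r0 r1
}.

Section FromPullbacks.
Hypothesis hP : Pointed C.
Hypothesis hpb : forall X Y Z (f : hom X Z) (g : hom Y Z),
    exists P (p : hom P X) (q : hom P Y), IsPullback f g p q.
Notation "0" := (zm hP _ _).

Lemma ker_ex X Y (f : hom X Y) : exists K (k : hom K X), IsKernel f k.
Proof.
have [Z hZ] := hP.
have [K [w [k h]]] := hpb (zm hP Z Y) f.
by exists K, k; apply: (pb_ker hP hZ h).
Qed.

Lemma prod_ex X Y : exists P (p : hom P X) (q : hom P Y),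
  (forall T (u v : hom T P), p ∘ u = p ∘ v -> q ∘ u = q ∘ v -> u = v) /\
  forall T (x : hom T X) (y : hom T Y), exists u, p ∘ u = x /\ q ∘ u = y.
Proof.
have [Z hZ] := hP.
have [P [p [q h]]] := hpb (zm hP X Z) (zm hP Y Z).
exists P, p, q; split; first exact: (pb_mono h).
by move=> T x y; apply: (pb_lift h); apply: to_zero.
Qed.

Lemma eq_ex X Y (f g : hom X Y) : exists M (m : hom M X),
  [/\ Mono m, f ∘ m = g ∘ m &
      forall T (t : hom T X), f ∘ t = g ∘ t -> exists u, m ∘ u = t].
Proof.
have [P [p [q [jm lift]]]] := prod_ex X Y.
have [a [a1 a2]] := lift _ (idc X) f; have [b [b1 b2]] := lift _ (idc X) g.
have [M [m [m' h]]] := hpb a b.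
have e1 : m = m' by move: (congr1 (cmp p) (proj1 h)); rewrite !cmp_assoc a1 b1 !cmp_idl.
subst m'; exists M, m; split.
- by move=> T u v e; apply: (pb_mono h).
- by move: (congr1 (cmp q) (proj1 h)); rewrite !cmp_assoc a2 b2.
- move=> T t e.
  have [|u [hu _]] := @pb_lift _ _ _ _ _ _ _ _ h T t t; last by exists u.
  by apply: jm; rewrite !cmp_assoc ?a1 ?b1 ?a2 ?b2.
Qed.

End FromPullbacks.

(** A regular epimorphism without kernel is the cokernel of a zero map. *)
Lemma regular_epi_iso (h : NormalExact) X Y (f : hom X Y) : RegularEpi f ->
  (forall T (t : hom T X), f ∘ t = zm (ne_pointed h) T Y -> t = zm (ne_pointed h) T X) ->
  IsIso f.
Proof.
move=> hf inj; set hP := ne_pointed h in inj.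
have [Z hZ] := hP.
have hk := zero_mono_ker hZ inj.
have hc := ne_coker h hf hk.
have [|g hg] := @coker_lift hP _ _ _ _ _ hc X (idc X); first by rewrite zm_l.
exists g; split=> //; apply: (coker_epi hP hc).
by nf; rewrite hg cmp_idr.
Qed.

End Basics.

(** * Semi-abelian categories *)

Inductive cospan := CL | CR | CM.

Definition Cospan : Category.
Proof.
refine (@Build_Category cospan
  (fun i j => match i, j with
     | CL, CL | CR, CR | CM, CM | CL, CM | CR, CM => unit | _, _ => Empty_set end)
  (fun i => match i with CL | CR | CM => tt end)
  (fun i j k => match i, j, k with
     | CL, CL, CL | CL, CL, CM | CL, CM, CM | CR, CR, CR | CR, CR, CM | CR, CM, CM
     | CM, CM, CM => fun _ _ => tt
     | _, _, _ => _ end) _ _ _).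
Unshelve. all: try by [].
- by case; case=> //; case.
- by case; case=> //; case.
- by case; case=> //; case=> //; case.
Defined.

Lemma cospan_finite : FiniteCategory Cospan.
Proof.
split; first by exists [:: CL; CR; CM]; case; rewrite /=; auto.
by case; case; first [exists [:: tt]; case; left | exists nil; case].
Qed.

Definition cospan_functor (C : Category) (X Y Z : C) (f : hom X Z) (g : hom Y Z) :
  Functor Cospan C.
Proof.
refine (@Build_Functor Cospan C
  (fun i => match i with CL => X | CR => Y | CM => Z end)
  (fun i j => match i, j with
     | CL, CL => fun _ => idc X | CR, CR => fun _ => idc Y | CM, CM => fun _ => idc Z
     | CL, CM => fun _ => f | CR, CM => fun _ => g | _, _ => _ end) _ _).
Unshelve. all: try by [].
- by case.
- by case; case=> //; case=> //= *; rewrite ?cmp_idl ?cmp_idr.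
Defined.

Lemma complete_pb (C : Category) : FinitelyComplete C ->
  forall (X Y Z : C) (f : hom X Z) (g : hom Y Z),
    exists (P : C) (p : hom P X) (q : hom P Y), IsPullback f g p q.
Proof.
move=> h X Y Z f g.
have [L [l [cone univ]]] := h Cospan cospan_finite (cospan_functor f g).
exists L, (l CL), (l CR); split.
  by rewrite (cone CL CM tt) (cone CR CM tt).
move=> T x y e.
pose t j : hom T (cospan_functor f g j) :=
  match j with CL => x | CR => y | CM => f ∘ x end.
have ct : IsCone t by case; case=> //= u; rewrite ?cmp_idl.
have [u [hu uu]] := univ T t ct.
exists u; split; first by split; [apply: (hu CL) | apply: (hu CR)].
move=> v [a b]; apply: uu; case=> //=.
by rewrite -(cone CL CM tt) /= -cmp_assoc a.
Qed.

Section SemiAbelian.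
Variable C : Category.
Hypothesis hC : SemiAbelian C.
Implicit Types X Y Z T K L P : C.
Let hP : Pointed C := sa_pointed hC.
Let hpb := complete_pb (sa_complete hC).
Notation "0" := (zm hP _ _).

(** Protomodularity in the form: a section and a fibre of a split epimorphism are
    jointly strongly epic. *)
Lemma protomodular_strong X Y A (p : hom A Y) (s : hom Y A) (v : hom X Y)
  W (x : hom W X) (a : hom W A) A' (m : hom A' A) (s1 : hom Y A') (a1 : hom W A') :
  p ∘ s = idc Y -> IsPullback v p x a -> Mono m -> m ∘ s1 = s -> m ∘ a1 = a -> IsIso m.
Proof.
move=> ps pb hm e1 e2.
apply: (@sa_proto _ hC X Y v A' A (p ∘ m) s1 p s m W W x a1 x a (idc W)) => //.
- by nf; rewrite e1.
- apply: mk_pb; first by nf; rewrite e2 (proj1 pb).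
  + move=> T u w b c; apply: (pb_mono pb b).
    by rewrite -e2; nf; rewrite c.
  + move=> T t1 t2; nf => e; have [u [b c]] := pb_lift pb e.
    by exists u; split=> //; apply: hm; rewrite cmp_assoc e2.
- by nf.
- by nf.
- exact: iso_id.
Qed.

(** The equalizer of [u] and [v] contains the section and the kernel. *)
Lemma kernel_section_epic A Y (p : hom A Y) (s : hom Y A) K (k : hom K A) T (u v : hom A T) :
  p ∘ s = idc Y -> IsKernel p k -> u ∘ s = v ∘ s -> u ∘ k = v ∘ k -> u = v.
Proof.
move=> ps hk es ek.
have [M [m [hm e univ]]] := eq_ex hP hpb u v.
have [s1 h1] := univ _ _ es; have [k1 h2] := univ _ _ ek.
have [Z hZ] := hP.
have iso := protomodular_strong ps (ker_pb hP (zm hP Z Y) (zm hP K Z) hZ hk) hm h1 h2.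
exact: (iso_epi iso).
Qed.

(** A map killing the kernel of [f] coequalizes the kernel pair of [f]: the latter is
    generated by the diagonal and the elements [(0, k)]. *)
Lemma semiabelian_coker X Y (f : hom X Y) K (k : hom K X) :
  RegularEpi f -> IsKernel f k -> IsCokernel k f.
Proof.
move=> hf hk; apply: (mk_coker (ker0 hP hk) (regular_epi_epi hf)) => T t tk.
have [R [r0 [r1 pb]]] := hpb f f.
have [e [e0 e1]] := pb_lift pb (erefl (f ∘ idc X)).
have [L [l hl]] := ker_ex hP hpb r0.
have hl' := ker_of_pb hP pb hl.
have tr : t ∘ r0 = t ∘ r1.
  apply: (kernel_section_epic e0 hl); first by nf; rewrite e0 e1.
  nf; rewrite (ker0 hP hl) zm_l.
  by have [w <-] := ker_lift hk (ker0 hP hl'); rewrite cmp_assoc tk zm_r.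
case: hf => W [u [v [huv univ]]].
have [w [w0 w1]] := pb_lift pb huv.
have [|g [hg _]] := univ _ t; last by exists g.
by rewrite -w0 -w1 !cmp_assoc tr.
Qed.

(** Relations are difunctional: the zigzags [x S y, z S y, z S w] form a pullback of split
    epimorphisms, in which those with [x S w] contain the section and a fibre. *)
Lemma difunctional X S (r0 r1 : hom S X) :
  (forall T (u v : hom T S), r0 ∘ u = r0 ∘ v -> r1 ∘ u = r1 ∘ v -> u = v) ->
  forall T (a b c : hom T S), r1 ∘ a = r1 ∘ b -> r0 ∘ b = r0 ∘ c ->
  exists d : hom T S, r0 ∘ d = r0 ∘ a /\ r1 ∘ d = r1 ∘ c.
Proof.
move=> jm T a b c ab bc.
have [T1 [al [be pb1]]] := hpb r1 r1.
have [T2 [be' [ga pb2]]] := hpb r0 r0.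
have [W [p [p' pbW]]] := hpb be be'.
have [XX [x0 [x1 [jmX liftX]]]] := prod_ex hP hpb X X.
have [r [hr0 hr1]] := liftX _ r0 r1.
have [w [hw0 hw1]] := liftX _ (r0 ∘ al ∘ p) (r1 ∘ ga ∘ p').
have [W' [m [n pbm]]] := hpb w r.
have hm : Mono m.
  move=> U u v e; apply: (pb_mono pbm) => //.
  have e' : r ∘ (n ∘ u) = r ∘ (n ∘ v) by rewrite !cmp_assoc -(proj1 pbm); nf; rewrite e.
  by apply: jm; [move: (congr1 (cmp x0) e') | move: (congr1 (cmp x1) e')];
     rewrite !cmp_assoc ?hr0 ?hr1; nf.
have [d1 [d1a d1b]] := pb_lift pb1 (erefl (r1 ∘ idc S)).
have [d2 [d2a d2b]] := pb_lift pb2 (erefl (r0 ∘ idc S)).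
have [s [sa sb]] : exists s : hom T1 W, p ∘ s = idc T1 /\ p' ∘ s = d2 ∘ be.
  by apply: (pb_lift pbW); rewrite cmp_assoc d2a; nf.
have [z [za zb]] : exists z : hom T2 W, p ∘ z = d1 ∘ be' /\ p' ∘ z = idc T2.
  by apply: (pb_lift pbW); rewrite cmp_assoc d1b; nf.
have [s1 [s1a s1b]] : exists s1, m ∘ s1 = s /\ n ∘ s1 = al.
  apply: (pb_lift pbm); apply: jmX.
  - by rewrite !cmp_assoc hw0 hr0; nf; rewrite sa; nf.
  - by rewrite !cmp_assoc hw1 hr1; nf; crw sb; crw d2b; rewrite (proj1 pb1).
have [z1 [z1a z1b]] : exists z1, m ∘ z1 = z /\ n ∘ z1 = ga.
  apply: (pb_lift pbm); apply: jmX.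
  - by rewrite !cmp_assoc hw0 hr0; nf; crw za; crw d1a; rewrite (proj1 pb2).
  - by rewrite !cmp_assoc hw1 hr1; nf; rewrite zb; nf.
have pbz : IsPullback d1 p be' z.
  apply: mk_pb => //.
  - move=> U u v _ e; have := congr1 (cmp p') e.
    by rewrite !cmp_assoc zb !cmp_idl.
  - move=> U u v e.
    have e1 : be ∘ (p ∘ v) = u by rewrite -e cmp_assoc d1b cmp_idl.
    have e2 : be' ∘ (p' ∘ v) = u by rewrite -e1 !cmp_assoc (proj1 pbW).
    exists (p' ∘ v); split=> //; apply: (pb_mono pbW).
      by rewrite cmp_assoc za; nf; rewrite e2.
    by rewrite cmp_assoc zb cmp_idl.
have iso := protomodular_strong sa pbz hm s1a z1a.
have [i [_ mi]] := iso.
have [t1 [t1a t1b]] := pb_lift pb1 ab.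
have [t2 [t2a t2b]] := pb_lift pb2 bc.
have [t [ta tb]] : exists t, p ∘ t = t1 /\ p' ∘ t = t2 by apply: (pb_lift pbW); rewrite t1b t2a.
have key : r ∘ (n ∘ (i ∘ t)) = w ∘ t.
  by rewrite cmp_assoc -(proj1 pbm); nf; rewrite (post mi) cmp_idl.
exists (n ∘ (i ∘ t)); split.
- move: (congr1 (cmp x0) key); rewrite !cmp_assoc hr0 hw0; nf.
  by rewrite ta t1a.
- move: (congr1 (cmp x1) key); rewrite !cmp_assoc hr1 hw1; nf.
  by rewrite tb t2b.
Qed.

(** Difunctionality turns a reflexive relation into an equivalence relation, and these are
    effective. *)
Lemma semiabelian_refl X R (r0 r1 : hom R X) :
  (forall T (u v : hom T R), r0 ∘ u = r0 ∘ v -> r1 ∘ u = r1 ∘ v -> u = v) ->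
  (exists e : hom X R, r0 ∘ e = idc X /\ r1 ∘ e = idc X) ->
  exists Y (f : hom X Y), RegularEpi f /\ IsKernelPair f r0 r1.
Proof.
move=> jm [e [e0 e1]].
have eqv : InternalEquivalenceRelation r0 r1.
  split=> //; first by exists e.
  - have [||d [d0 d1]] := @difunctional _ _ r0 r1 jm R (e ∘ r1) (idc R) (e ∘ r0).
    + by rewrite cmp_assoc e1; nf.
    + by rewrite cmp_assoc e0; nf.
    by exists d; rewrite d0 d1 !cmp_assoc e0 e1 !cmp_idl.
  - move=> P p q pb.
    have [||d [d0 d1]] := @difunctional _ _ r0 r1 jm P p (e ∘ r1 ∘ p) q.
    + by rewrite !cmp_assoc e1; nf.
    + by rewrite !cmp_assoc e0 -(proj1 pb); nf.
    by exists d.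
have [Y [f pbf]] := exact_eff (sa_exact hC) eqv.
have [Q [q cq]] := reg_coeq (exact_reg (sa_exact hC)) pbf.
exists Q, q; split; first by exists R, r0, r1.
have [w [hw _]] := proj2 cq _ f (proj1 pbf).
apply: mk_pb; first exact: (proj1 cq).
  exact: jm.
move=> T x y exy; apply: (pb_lift pbf).
by rewrite -hw -!cmp_assoc exy.
Qed.

Lemma semiabelian_normal_exact : NormalExact C.
Proof. split; [exact: hP | exact: hpb | exact: semiabelian_coker | exact: semiabelian_refl]. Qed.

(** The quotient of [X] by the kernel pair of [f] is normal, hence the cokernel of the
    kernel of [f]; the induced map is monic because regular epimorphisms are stable. *)
Lemma image_factorization X Y (f : hom X Y) K (k : hom K X) : IsKernel f k ->
  exists Q (q : hom X Q) (m : hom Q Y), [/\ IsCokernel k q, m ∘ q = f & Mono m].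
Proof.
move=> hk.
have [R [r0 [r1 pb]]] := hpb f f.
have reg := exact_reg (sa_exact hC).
have [Q [q cq]] := reg_coeq reg pb.
have [m [hm _]] := proj2 cq _ f (proj1 pb).
have rq : RegularEpi q by exists R, r0, r1.
exists Q, q, m; split=> //.
- apply: semiabelian_coker => //; apply: (@mk_ker _ hP).
  + have [|w [w0 w1]] := @pb_lift _ _ _ _ _ _ _ _ _ pb K (zm hP K X) k.
      by rewrite (ker0 hP hk) zm_l.
    by rewrite -w1 cmp_assoc -(proj1 cq); nf; rewrite w0 zm_l.
  + exact: (ker_mono hP hk).
  + move=> T t e; apply: (ker_lift hk).
    by rewrite -hm -cmp_assoc e zm_l.
- move=> T u v e.
  have [T1 [y1 [e1 pb1]]] := hpb q u.
  have [T2 [y2 [e2 pb2]]] := hpb q (v ∘ e1).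
  have re1 := reg_stable reg pb1 rq.
  have re2 := reg_stable reg pb2 rq.
  apply: (epi_cmp (regular_epi_epi re2) (regular_epi_epi re1)).
  have [|w [w0 w1]] := @pb_lift _ _ _ _ _ _ _ _ _ pb T2 (y1 ∘ e2) y2.
    rewrite -hm; nf; rewrite (post (proj1 pb1)) (proj1 pb2); nf.
    by rewrite !cmp_assoc e.
  rewrite !cmp_assoc -(proj1 pb1) -(proj1 pb2) -cmp_assoc -w0 -w1 !cmp_assoc.
  by rewrite (proj1 cq).
Qed.

End SemiAbelian.

(** * Extensions and double extensions *)

Section Extensions.
Variables (C : Category) (E : ArrowClass C).
Hypotheses (hN : NormalExact C) (hE : ClassOfExtensions E).
Implicit Types X Y Z T K L P : C.
Let hP : Pointed C := ne_pointed hN.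
Let hpb := ne_pb hN.
Notation "0" := (zm hP _ _).

Lemma E_dom X Y (f : hom X Y) : E f -> Eob E X.
Proof. by move=> h; exists X, Y, f; split=> //; left. Qed.

Lemma E_cod X Y (f : hom X Y) : E f -> Eob E Y.
Proof. by move=> h; exists X, Y, f; split=> //; right. Qed.

Lemma E_epi X Y (f : hom X Y) : E f -> Epi f.
Proof. by move/(ext_regular hE)/regular_epi_epi. Qed.

Lemma E_id X : Eob E X -> E (idc X).
Proof. by move=> h; apply: (ext_split hE) => //; exists (idc X); nf. Qed.

(** [Y] is a pullback of [X -> 0] along the identity of [0]. *)
Lemma Eob_iso X Y (f : hom X Y) : IsIso f -> Eob E X -> Eob E Y.
Proof.
case=> g [gf fg] hX.
have [Z [hZ eZ]] := ext_zero hE.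
have h : E (zm hP X Z).
  by apply: (ext_split hE) => //; exists (zm hP Z X); apply: to_zero.
suff: E (zm hP Y Z) by apply: E_dom.
apply: (ext_pullback hE (g := idc Z) (q := g) h eZ); apply: mk_pb.
- exact: to_zero.
- move=> T u v _ e; rewrite -(cmp_idl u) -(cmp_idl v) -fg -!cmp_assoc e //.
- move=> T x y _; exists (f ∘ y); split; first exact: to_zero.
  by rewrite cmp_assoc gf cmp_idl.
Qed.

Lemma E_iso X Y (f : hom X Y) : IsIso f -> Eob E X -> E f.
Proof.
move=> hf hX; apply: (ext_split hE) => //; first exact: Eob_iso hf hX.
by case: hf => g [_ fg]; exists g.
Qed.

Lemma iso_inv X Y (f : hom X Y) : IsIso f -> exists2 g : hom Y X, IsIso g & g ∘ f = idc X.
Proof. by case=> g [gf fg]; exists g => //; exists f. Qed.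

Lemma Eob_zero Z : IsZeroOb Z -> Eob E Z.
Proof.
move=> hZ; have [Z' [hZ' e]] := ext_zero hE.
apply: (@Eob_iso _ _ (zm hP Z' Z) _ e).
by exists (zm hP Z Z'); split; apply: to_zero.
Qed.

Lemma E_to_zero X Z (f : hom X Z) : Eob E X -> IsZeroOb Z -> E f.
Proof.
move=> hX hZ; apply: (ext_split hE) => //; first exact: Eob_zero.
by exists (zm hP Z X); apply: to_zero.
Qed.

Lemma E_arrow_iso X Y X' Y' (f : hom X Y) (f' : hom X' Y') (u : hom X X') (v : hom Y Y') :
  IsIso u -> IsIso v -> v ∘ f = f' ∘ u -> E f -> E f'.
Proof.
move=> hu hv e h.
have [w hw uw] := iso_inv hu.
have uw' : u ∘ w = idc X' by apply: (iso_mono hw); rewrite cmp_assoc uw; nf.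
have -> : f' = v ∘ f ∘ w by rewrite e; nf; rewrite uw'; nf.
apply: (ext_cmp hE _ (ext_cmp hE h (E_iso hv (E_cod h)))).
by apply: (E_iso hw); apply: (Eob_iso hu (E_dom h)).
Qed.

Lemma Eob_ker X Y (f : hom X Y) K (k : hom K X) : E f -> IsKernel f k -> Eob E K.
Proof.
move=> h hk; have [Z hZ] := hP.
exact: E_dom (ext_pullback hE h (Eob_zero hZ) (ker_pb hP (zm hP Z Y) (zm hP K Z) hZ hk)).
Qed.

Lemma E_short_exact X Y (f : hom X Y) K (k : hom K X) : E f -> IsKernel f k -> ShortExact k f.
Proof. by move=> h hk; split=> //; apply: (ne_coker hN (ext_regular hE h)). Qed.

Lemma E_pb X Y Z (f : hom X Z) (g : hom Y Z) P (p : hom P X) (q : hom P Y) :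
  IsPullback f g p q -> E g -> Eob E X -> E p.
Proof. by move=> h hg hX; apply: (ext_pullback hE hg hX h). Qed.

Lemma E_pb' X Y Z (f : hom X Z) (g : hom Y Z) P (p : hom P X) (q : hom P Y) :
  IsPullback f g p q -> E f -> Eob E Y -> E q.
Proof. by move/pb_sym; apply: E_pb. Qed.

Section Square.
Variables (A1 A0 B1 B0 : C) (a : hom A1 A0) (b : hom B1 B0) (f1 : hom A1 B1) (f0 : hom A0 B0).
Hypothesis sq : b ∘ f1 = f0 ∘ a.

Lemma ker_square K1 K0 (k1 : hom K1 A1) (k0 : hom K0 A0) :
  IsKernel f1 k1 -> IsKernel f0 k0 -> exists c : hom K1 K0, k0 ∘ c = a ∘ k1.
Proof.
move=> h1 h0; apply: (ker_lift (hP := hP) h0).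
by rewrite cmp_assoc -sq -cmp_assoc (ker0 hP h1) zm_l.
Qed.

(** The comparison to the pullback is a morphism of short exact sequences over [B1] whose
    restriction to the kernels is [c]. *)
Lemma comparison_of_ker P (p : hom P A0) (q : hom P B1) (u : hom A1 P)
  K1 K0 (k1 : hom K1 A1) (k0 : hom K0 A0) (c : hom K1 K0) :
  E f0 -> E f1 -> IsPullback f0 b p q -> p ∘ u = a -> q ∘ u = f1 ->
  IsKernel f1 k1 -> IsKernel f0 k0 -> k0 ∘ c = a ∘ k1 -> E c -> E u.
Proof.
move=> h0 h1 pb pu qu hk1 hk0 hc ec.
have hB1 := E_cod h1.
have hq := E_pb' pb h0 hB1.
have [j [ja jb]] : exists j, p ∘ j = k0 /\ q ∘ j = zm hP K0 B1.
  by apply: (pb_lift pb); rewrite (ker0 hP hk0) zm_l.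
have hj : IsKernel q j.
  apply: (mk_ker jb).
  - move=> T x y e; apply: (ker_mono hP hk0).
    by rewrite -ja -!cmp_assoc e.
  - move=> T t e.
    have [|w hw] := @ker_lift _ hP _ _ _ _ _ hk0 T (p ∘ t).
      by rewrite cmp_assoc (proj1 pb) -cmp_assoc e zm_l.
    exists w; apply: (pb_mono pb); first by rewrite cmp_assoc ja.
    by rewrite cmp_assoc jb zm_r.
apply: (ext_five hE (E_short_exact h1 hk1) (E_short_exact hq hj) _ qu h1 ec (E_dom hq)).
apply: (pb_mono pb); first by rewrite !cmp_assoc pu ja -hc.
by rewrite !cmp_assoc qu jb (ker0 hP hk1) zm_r.
Qed.

Lemma double_of_ker K1 K0 (k1 : hom K1 A1) (k0 : hom K0 A0) (c : hom K1 K0) :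
  E a -> E b -> E f1 -> E f0 ->
  IsKernel f1 k1 -> IsKernel f0 k0 -> k0 ∘ c = a ∘ k1 -> E c ->
  IsDoubleExtension E a b f1 f0.
Proof.
move=> ha hb h1 h0 hk1 hk0 hc ec; split=> //; split=> //.
have [P [p [q pb]]] := hpb f0 b.
have [u [pu qu]] := pb_lift pb (esym sq).
exists P, p, q, u; split=> //.
- exact: E_pb pb hb (E_cod ha).
- exact: E_pb' pb h0 (E_cod h1).
- exact: comparison_of_ker pb pu qu hk1 hk0 hc ec.
Qed.

(** The map of kernels is a pullback of the comparison to the pullback. *)
Lemma ker_of_double K1 K0 (k1 : hom K1 A1) (k0 : hom K0 A0) (c : hom K1 K0) :
  IsDoubleExtension E a b f1 f0 ->
  IsKernel f1 k1 -> IsKernel f0 k0 -> k0 ∘ c = a ∘ k1 -> E c.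
Proof.
case=> ha hb h1 h0 [_ [P [p [q [u [pb hp hq [pu qu] hu]]]]]] hk1 hk0 hc.
have [j [ja jb]] : exists j, p ∘ j = k0 /\ q ∘ j = zm hP K0 B1.
  by apply: (pb_lift pb); rewrite (ker0 hP hk0) zm_l.
apply: (@E_pb _ _ _ j u _ c k1) => //; last exact: Eob_ker h0 hk0.
apply: mk_pb.
- apply: (pb_mono pb); first by rewrite !cmp_assoc ja pu.
  by rewrite !cmp_assoc jb qu (ker0 hP hk1) zm_r.
- by move=> T x y _; apply: (ker_mono hP hk1).
- move=> T x y e.
  have [|w hw] := @ker_lift _ hP _ _ _ _ _ hk1 T y.
    by rewrite -qu -cmp_assoc -e cmp_assoc jb zm_r.
  exists w; split=> //; apply: (ker_mono hP hk0).
  by rewrite cmp_assoc hc -cmp_assoc hw -pu -cmp_assoc -e cmp_assoc ja.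
Qed.

(** [a] is the comparison, an extension by the kernel criterion, followed by a pullback of
    [b]. *)
Lemma E_of_square K1 K0 (k1 : hom K1 A1) (k0 : hom K0 A0) (c : hom K1 K0) :
  E b -> E f1 -> E f0 ->
  IsKernel f1 k1 -> IsKernel f0 k0 -> k0 ∘ c = a ∘ k1 -> E c -> E a.
Proof.
move=> hb h1 h0 hk1 hk0 hc ec.
have [P [p [q pb]]] := hpb f0 b.
have [u [pu qu]] := pb_lift pb (esym sq).
rewrite -pu; apply: (ext_cmp hE).
- exact: comparison_of_ker pb pu qu hk1 hk0 hc ec.
- exact: E_pb pb hb (E_dom h0).
Qed.

End Square.

Lemma double_sym A1 A0 B1 B0 (a : hom A1 A0) (b : hom B1 B0) (f1 : hom A1 B1) (f0 : hom A0 B0) :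
  IsDoubleExtension E a b f1 f0 -> IsDoubleExtension E f1 f0 a b.
Proof.
case=> ha hb h1 h0 [e [P [p [q [u [pb hp hq [pu qu] hu]]]]]]; split=> //; split=> //.
by exists P, q, p, u; split=> //; apply: pb_sym.
Qed.

Lemma double_any A1 A0 B1 B0 (a : hom A1 A0) (b : hom B1 B0) (f1 : hom A1 B1) (f0 : hom A0 B0)
  P (p : hom P A0) (q : hom P B1) (u : hom A1 P) :
  IsDoubleExtension E a b f1 f0 -> IsPullback f0 b p q -> p ∘ u = a -> q ∘ u = f1 -> E u.
Proof.
case=> ha hb h1 h0 [e [P' [p' [q' [u' [pb hp hq [pu qu] hu]]]]]] pb' pu' qu'.
have [w [iw w1 w2]] := pb_uniq pb pb'.
have -> : u = w ∘ u'.
  by apply: (pb_mono pb'); rewrite cmp_assoc ?w1 ?w2 ?pu ?qu ?pu' ?qu'.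
by apply: (ext_cmp hE) => //; apply: E_iso iw (E_cod hu).
Qed.

(** Compatible splittings restrict to a splitting of the map of kernels, which is therefore
    an extension. *)
Lemma double_of_split A1 A0 B1 B0 (a : hom A1 A0) (b : hom B1 B0)
  (f1 : hom A1 B1) (f0 : hom A0 B0) (sa : hom A0 A1) (sb : hom B0 B1) :
  b ∘ f1 = f0 ∘ a -> E a -> E b -> E f1 -> E f0 ->
  a ∘ sa = idc A0 -> b ∘ sb = idc B0 -> f1 ∘ sa = sb ∘ f0 -> IsDoubleExtension E a b f1 f0.
Proof.
move=> sq ha hb h1 h0 ea eb es.
have [K1 [k1 hk1]] := ker_ex hP hpb f1; have [K0 [k0 hk0]] := ker_ex hP hpb f0.
have [c hc] := ker_square sq hk1 hk0.
apply: (double_of_ker sq ha hb h1 h0 hk1 hk0 hc).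
apply: (ext_split hE); [exact: Eob_ker h1 hk1 | exact: Eob_ker h0 hk0 |].
have [s hs] := ker_square (esym es) hk0 hk1.
exists s; apply: (ker_mono hP hk0).
by rewrite cmp_assoc hc -cmp_assoc hs cmp_assoc ea; nf.
Qed.

End Extensions.

(** * Brackets and central extensions *)

Section Birkhoff.
Variables (C : Category) (E : ArrowClass C) (B : C -> Prop).
Hypotheses (hN : NormalExact C) (hE : ClassOfExtensions E) (hB : StronglyBirkhoff E B).
Implicit Types X Y Z T K L P V : C.
Let hP : Pointed C := ne_pointed hN.
Let hpb := ne_pb hN.
Notation "0" := (zm hP _ _).

Lemma reflection_iso X R R' (eta : hom X R) (eta' : hom X R') :
  IsReflection B eta -> IsReflection B eta' -> exists2 u : hom R R', IsIso u & u ∘ eta = eta'.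
Proof.
move=> [b h] [b' h'].
have [u [hu _]] := h _ eta' b'; have [v [hv _]] := h' _ eta b.
exists u => //; exists v; split.
- have [w [_ uw]] := h _ eta b.
  rewrite -(uw (idc R)) ?cmp_idl // -(uw (v ∘ u)) //.
  by rewrite -cmp_assoc hu.
- have [w [_ uw]] := h' _ eta' b'.
  rewrite -(uw (idc R')) ?cmp_idl // -(uw (u ∘ v)) //.
  by rewrite -cmp_assoc hv.
Qed.

Lemma bracket_ex X : Eob E X -> exists V (k : hom V X), IsBracket B k.
Proof.
move=> hX; have [R [eta h]] := birk_reflective hB hX.
have [V [k hk]] := ker_ex hP hpb eta.
by exists V, k, R, eta.
Qed.

Lemma bracket_mono X V (k : hom V X) : IsBracket B k -> Mono k.
Proof. by case=> R [eta [_]] /(ker_mono hP). Qed.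

Lemma bracket_map X Y (f : hom X Y) V W (k : hom V X) (l : hom W Y) :
  IsBracket B k -> IsBracket B l -> exists g : hom V W, l ∘ g = f ∘ k.
Proof.
move=> [R [eta [he hk]]] [S [th [ht hl]]].
apply: (ker_lift (hP := hP) hl).
have [g [hg _]] := proj2 he _ (th ∘ f) (proj1 ht).
by rewrite cmp_assoc -hg -cmp_assoc (ker0 hP hk) zm_l.
Qed.

(** Strong Birkhoffness makes the bracket preserve extensions: [g] is the restriction of a
    double extension to kernels. *)
Lemma bracket_E X Y (f : hom X Y) V W (k : hom V X) (l : hom W Y) (g : hom V W) :
  E f -> IsBracket B k -> IsBracket B l -> l ∘ g = f ∘ k -> E g.
Proof.
move=> hf [R [eta [he hk]]] [S [th [ht hl]]] hg.
have [h [hh _]] := proj2 he _ (th ∘ f) (proj1 ht).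
have d := birk_square hB hf he ht hh.
exact: (ker_of_double hN hE (double_sym d) hk hl hg).
Qed.

(** Centrality tested on generalised elements. *)
Definition CentralCond X Y (f : hom X Y) : Prop :=
  forall T V (k : hom V T) (u v : hom T X), Eob E T -> IsBracket B k ->
    f ∘ u = f ∘ v -> u ∘ k = v ∘ k.

(** An extension that becomes trivial along [g] identifies maps on brackets after pulling
    back along [g], and brackets of extensions are epimorphisms.  Conversely [f] itself
    trivialises [f]: its kernel pair meets the bracket trivially. *)
Lemma centralP X Y (f : hom X Y) : CentralExt E B f <-> E f /\ CentralCond f.
Proof.
split.
- case=> hf [Z [g [hg [P [p [q [pb [hp [IP [IZ [etP [etZ [If [rP rZ tpb]]]]]]]]]]]]]].
  split=> // T V k u v hT hk e.
  have [T' [z [e1 pbT]]] := hpb g (f ∘ u).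
  have he1 : E e1 by apply: (E_pb' hE pbT).
  have hT' := E_dom he1.
  have [V' [k' hk']] := bracket_ex hT'.
  have [[u' [u1 u2]] [v' [v1 v2]]] : (exists u', p ∘ u' = z /\ q ∘ u' = u ∘ e1) /\
                                     (exists v', p ∘ v' = z /\ q ∘ v' = v ∘ e1).
    by split; apply: (pb_lift pb); rewrite (proj1 pbT); nf => //; rewrite cmp_assoc e; nf.
  have [c hc] := bracket_map e1 hk' hk.
  have ec := bracket_E he1 hk' hk hc.
  apply: (E_epi hE ec); nf; rewrite hc !cmp_assoc -u2 -v2 -!cmp_assoc.
  congr (q ∘ _); apply: (pb_mono tpb); first by rewrite !cmp_assoc u1 v1.
  have [R [eta [he hk0]]] := hk'.
  have kill (w : hom T' P) : etP ∘ (w ∘ k') = zm hP _ _.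
    have [h [hh _]] := proj2 he _ (etP ∘ w) (proj1 rP).
    by rewrite cmp_assoc -hh -cmp_assoc (ker0 hP hk0) zm_l.
  by rewrite !kill.
- case=> hf cc; split=> //; exists X, f; split=> //.
  have [R [p0 [p1 pb]]] := hpb f f.
  have hX := E_dom hf.
  have h0 : E p0 by apply: (E_pb hE pb).
  exists R, p0, p1; split=> //; split=> //.
  have [IR [etR rR]] := birk_reflective hB (E_dom h0).
  have [IX [etX rX]] := birk_reflective hB hX.
  have [If [hIf _]] := proj2 rR _ (etX ∘ p0) (proj1 rX).
  exists IR, IX, etR, etX, If; split=> //.
  have [_ _ _ _ [_ [P [p [q [u [pbP hp hq [pu qu] hu]]]]]]] :=
    birk_square hB h0 rR rX hIf.
  have iu : IsIso u.
    apply: (regular_epi_iso (h := hN)); first exact: (ext_regular hE).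
    move=> T t ht.
    have e1 : etR ∘ t = zm hP _ _ by rewrite -pu -cmp_assoc ht zm_l.
    have e2 : p0 ∘ t = zm hP _ _ by rewrite -qu -cmp_assoc ht zm_l.
    have [V [k hk]] := ker_ex hP hpb etR.
    have [t' ht'] := ker_lift hk e1.
    have hb : IsBracket B k by exists IR, etR.
    apply: (pb_mono pb); first by rewrite e2 zm_l.
    rewrite zm_l -ht' cmp_assoc -(cc _ _ k p0 p1 (E_dom h0) hb (proj1 pb)) -cmp_assoc ht'.
    by rewrite e2.
  have [v [vu uv]] := iu.
  apply: mk_pb; first by rewrite hIf.
  + move=> T x y e1 e2; apply: (iso_mono iu); apply: (pb_mono pbP).
      by rewrite !cmp_assoc pu.
    by rewrite !cmp_assoc qu.
  + move=> T x y e.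
    have [w [w1 w2]] := pb_lift pbP (esym e).
    exists (v ∘ w); rewrite -pu -qu -!cmp_assoc (post uv).
    by rewrite cmp_idl.
Qed.

Section Centralization.
Variables (X Y R : C) (f : hom X Y) (p0 p1 : hom R X) (V : C) (k : hom V R).
Hypotheses (hf : E f) (pb : IsKernelPair f p0 p1) (hk : IsBracket B k).

Lemma kernel_pair_E : E p0 /\ E p1.
Proof.
have hX := E_dom hf.
by split; [apply: (E_pb hE pb) | apply: (E_pb' hE pb)].
Qed.

(** The centralisation of [f] is [X / [f]_1], where [[f]_1] consists of the [x] with
    [(0, x)] in the bracket of the kernel pair.  It is the zero class of the relation
    identifying [x] and [y] when [(x, y)] and [(x, x)] have the same image under the unit;
    that relation is reflexive, so it is effective.  The last clause presents [[f]_1] as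
    the kernel of a split extension of brackets, which makes it functorial in double
    extensions and shows that it belongs to the class of objects [E^-]. *)
Lemma centralization_ex : exists (Q : C) (q : hom X Q) (g : hom Q Y) N (m : hom N X),
  [/\ E q, g ∘ q = f, CentralExt E B g, IsKernel q m &
    (forall T (t : hom T X), q ∘ t = zm hP T Q <->
       exists t', p0 ∘ k ∘ t' = zm hP T X /\ p1 ∘ k ∘ t' = t) /\
    forall VX (kX : hom VX X) (p : hom V VX), IsBracket B kX -> kX ∘ p = p0 ∘ k ->
      exists2 n : hom N V, IsKernel p n & m = p1 ∘ k ∘ n].
Proof.
have [h0 h1] := kernel_pair_E.
have hX := E_dom hf; have hR := E_dom h0.
have [d [d0 d1]] := pb_lift pb (erefl (f ∘ idc X)).
have [IR [eta [he hke]]] := hk.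
have [M [th [hth eth uth]]] := eq_ex hP hpb eta (eta ∘ d ∘ p0).
have [e [e1]] : exists e, th ∘ e = d by apply: uth; rewrite -!cmp_assoc d0; nf.
have [Q [q [rq pbq]]] : exists Q (q : hom X Q), RegularEpi q /\ IsKernelPair q (p0 ∘ th) (p1 ∘ th).
  apply: (ne_refl hN).
  - move=> T u v; rewrite -!cmp_assoc => a b; apply: hth.
    exact: (pb_mono pb).
  - by exists e; rewrite -!cmp_assoc e1.
have kill T (t : hom T X) : q ∘ t = zm hP T Q <->
    exists t', p0 ∘ k ∘ t' = zm hP T X /\ p1 ∘ k ∘ t' = t.
  split.
  - move=> qt; have [|w [w0 w1]] := @pb_lift _ _ _ _ _ _ _ _ _ pbq T (zm hP T X) t.
      by rewrite qt zm_l.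
    have [|t' ht'] := @ker_lift _ hP _ _ _ _ _ hke T (th ∘ w).
      by rewrite cmp_assoc eth -!cmp_assoc (cmp_assoc p0) w0 !zm_l.
    by exists t'; rewrite -!cmp_assoc ht' !cmp_assoc.
  - case=> t' [a b].
    have [|w hw] := uth _ (k ∘ t').
      rewrite -!cmp_assoc (cmp_assoc p0) a !zm_l.
      by rewrite cmp_assoc (ker0 hP hke) zm_r.
    have -> : q ∘ t = q ∘ (p0 ∘ th) ∘ w by rewrite (proj1 pbq) -b -!cmp_assoc hw.
    by rewrite -!cmp_assoc hw (cmp_assoc p0) a zm_l.
have same : q ∘ p0 ∘ k = q ∘ p1 ∘ k.
  have [|w hw] := uth _ k.
    have [g hg] := bracket_map (d ∘ p0) hk hk.
    rewrite -!cmp_assoc (cmp_assoc d) -hg !cmp_assoc (ker0 hP hke).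
    by rewrite !zm_r.
  have e2 := congr1 (fun z => z ∘ w) (proj1 pbq).
  by move: e2; rewrite -!cmp_assoc hw.
have [VX [kX hkX]] := bracket_ex hX.
have [p hp] := bracket_map p0 hk hkX.
have [N [n hn]] := ker_ex hP hpb p.
pose m := p1 ∘ k ∘ n.
have p0n : p0 ∘ k ∘ n = zm hP _ _ by rewrite -hp -cmp_assoc (ker0 hP hn) zm_l.
have hm : IsKernel q m.
  apply: (@mk_ker _ hP).
  - by apply/kill; exists n.
  - move=> T u v; rewrite /m -!cmp_assoc => eq.
    apply: (ker_mono hP hn); apply: (bracket_mono hk); apply: (pb_mono pb).
      by rewrite !cmp_assoc p0n !zm_r.
    exact: eq.
  - move=> T t /kill[t' [a b]].
    have [|w hw] := @ker_lift _ hP _ _ _ _ _ hn T t'.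
      by apply: (bracket_mono hkX); rewrite cmp_assoc hp a zm_l.
    by exists w; rewrite /m -cmp_assoc hw.
have ep : E p by apply: (bracket_E h0 hk hkX).
have hq : E q.
  apply: (ext_exact hE (k := m)) => //; last exact: (Eob_ker hN hE ep hn).
  by split=> //; apply: (ne_coker hN).
have fm : f ∘ m = zm hP _ _.
  by rewrite /m !cmp_assoc -(proj1 pb) -!cmp_assoc (cmp_assoc p0) p0n zm_l.
have [g hg] := coker_lift (ne_coker hN rq hm) fm.
have eg : E g by apply: (ext_cancel hE (f := q)); [rewrite hg | exact: E_cod hq].
exists Q, q, g, N, m; split=> //; last first.
  split=> // VX' kX' p' hkX' hp'; exists n => //.
  have eqk T (t : hom T V) : p ∘ t = zm hP _ _ <-> p' ∘ t = zm hP _ _.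
    split=> z.
    - by apply: (bracket_mono hkX'); rewrite cmp_assoc hp' -hp -cmp_assoc z !zm_l.
    - by apply: (bracket_mono hkX); rewrite cmp_assoc hp -hp' -cmp_assoc z !zm_l.
  apply: mk_ker; [exact/eqk/(ker0 hP hn) | exact: (ker_mono hP hn) |].
  by move=> T t /eqk/(ker_lift hn).
apply/centralP; split=> // T W l u v hT hl guv.
have [T1 [x [e1' pb1]]] := hpb q u.
have [T2 [y [e2 pb2]]] := hpb q (v ∘ e1').
have he1 : E e1' by apply: (E_pb' hE pb1).
have he2 : E e2 by apply: (E_pb' hE pb2) => //; exact: E_dom he1.
have he12 := ext_cmp hE he2 he1.
have [W2 [l2 hl2]] := bracket_ex (E_dom he2).
have [c hc] := bracket_map (e1' ∘ e2) hl2 hl.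
apply: (E_epi hE (bracket_E he12 hl2 hl hc)).
have [r [r0 r1]] : exists r, p0 ∘ r = x ∘ e2 /\ p1 ∘ r = y.
  apply: (pb_lift pb); rewrite -hg; nf.
  by rewrite (post (proj1 pb1)) (proj1 pb2); nf; rewrite !(cmp_assoc g) guv.
have [s hs] := bracket_map r hl2 hk.
have := congr1 (fun z => z ∘ s) same.
rewrite -!cmp_assoc hs !(cmp_assoc _ r) r0 r1 !cmp_assoc (proj1 pb1) (proj1 pb2).
by move=> e2l; rewrite -!cmp_assoc hc !cmp_assoc.
Qed.

End Centralization.

Lemma kernel_pair_ex X Y (f : hom X Y) : E f -> exists R (p0 p1 : hom R X) V (k : hom V R),
  [/\ IsKernelPair f p0 p1, Eob E R & IsBracket B k].
Proof.
move=> hf; have [R [p0 [p1 pb]]] := hpb f f.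
have [h0 h1] := kernel_pair_E hf pb.
have [V [k hk]] := bracket_ex (E_dom h0).
by exists R, p0, p1, V, k; split=> //; apply: E_dom h0.
Qed.

End Birkhoff.

(** * The category of arrows *)

Definition arrow_hom (C : Category) (a b : Arr C) (f1 : hom (adom a) (adom b))
  (f0 : hom (acod a) (acod b)) (e : arr b ∘ f1 = f0 ∘ arr a) : hom a b :=
  @Build_ArrowHom C a b f1 f0 e.
Arguments arrow_hom {C} a b {f1 f0} e.

Section ArrowExactness.
Variable C : Category.
Implicit Types T : C.
Implicit Types a b : Arr C.

Lemma arrow_eq a b (f g : hom a b) : ahom1 f = ahom1 g -> ahom0 f = ahom0 g -> f = g.
Proof. exact: arrow_hom_eq. Qed.

Lemma hom1_eq a b (f g : hom a b) : f = g -> ahom1 f = ahom1 g.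
Proof. by move->. Qed.

Lemma hom0_eq a b (f g : hom a b) : f = g -> ahom0 f = ahom0 g.
Proof. by move->. Qed.

Lemma arrow_iso1 a b (f : hom a b) : IsIso f -> IsIso (ahom1 f).
Proof. by case=> g [e1 e2]; exists (ahom1 g); split; [exact: (hom1_eq e1) | exact: (hom1_eq e2)]. Qed.

Lemma arrow_iso0 a b (f : hom a b) : IsIso f -> IsIso (ahom0 f).
Proof.
case=> g [e1 e2]; exists (ahom0 g).
by split; [exact: (hom0_eq e1) | exact: (hom0_eq e2)].
Qed.

Lemma arrow_iso a b (f : hom a b) : IsIso (ahom1 f) -> IsIso (ahom0 f) -> IsIso f.
Proof.
case=> g1 [a1 b1] [g0 [a0 b0]].
have e : arr a ∘ g1 = g0 ∘ arr b.
  have := congr1 (fun z => g0 ∘ z ∘ g1) (ahom_comm f); rewrite /= -!cmp_assoc b1 cmp_idr.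
  by rewrite !cmp_assoc a0 cmp_idl.
by exists (arrow_hom b a e); split; apply: arrow_eq.
Qed.

Hypothesis hN : NormalExact C.
Let hP : Pointed C := ne_pointed hN.
Let hpb := ne_pb hN.
Notation "0" := (zm hP _ _).

(** Maps out of these two objects are elements of the domain and of the codomain, so
    universal properties in the arrow category can be read off pointwise. *)
Definition dom_test T : Arr C := Build_ArrowOb (idc T).
Definition cod_test Z T : Arr C := Build_ArrowOb (zm hP Z T).

Lemma dom_elt_comm T a (x : hom T (adom a)) : arr a ∘ x = (arr a ∘ x) ∘ arr (dom_test T).
Proof. by rewrite /=; nf. Qed.
Definition dom_elt T a (x : hom T (adom a)) : hom (dom_test T) a := arrow_hom (dom_test T) a (dom_elt_comm x).

Lemma cod_elt_comm Z T a (x : hom T (acod a)) :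
  arr a ∘ zm hP Z (adom a) = x ∘ arr (cod_test Z T).
Proof. by rewrite /= !zm_l. Qed.
Definition cod_elt Z T a (x : hom T (acod a)) : hom (cod_test Z T) a :=
  arrow_hom (cod_test Z T) a (cod_elt_comm Z x).

Lemma arr_pbP (a b c p : Arr C) (f : hom a c) (g : hom b c) (u : hom p a) (v : hom p b) :
  IsPullback f g u v <->
  IsPullback (ahom1 f) (ahom1 g) (ahom1 u) (ahom1 v) /\
  IsPullback (ahom0 f) (ahom0 g) (ahom0 u) (ahom0 v).
Proof.
have [Z hZ] := hP.
split=> [h | [h1 h0]].
- split; apply: mk_pb.
  + exact: (hom1_eq (proj1 h)).
  + move=> T x y e1 e2.
    suff e : dom_elt x = dom_elt y by exact: (hom1_eq e).
    apply: (pb_mono h); apply: arrow_eq => //=.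
    * by rewrite !cmp_assoc -(ahom_comm u) -!cmp_assoc e1.
    * by rewrite !cmp_assoc -(ahom_comm v) -!cmp_assoc e2.
  + move=> T x y e.
    have [|w [w1 w2]] := @pb_lift _ _ _ _ _ _ _ _ _ h _ (dom_elt x) (dom_elt y).
      apply: arrow_eq => //=.
      by rewrite !cmp_assoc -(ahom_comm f) -(ahom_comm g) -!cmp_assoc e.
    by exists (ahom1 w); rewrite -[x]/(ahom1 (dom_elt x)) -[y]/(ahom1 (dom_elt y)) -w1 -w2.
  + exact: (hom0_eq (proj1 h)).
  + move=> T x y e1 e2.
    suff e : cod_elt Z x = cod_elt Z y by exact: (hom0_eq e).
    by apply: (pb_mono h); apply: arrow_eq => //=; apply: from_zero.
  + move=> T x y e.
    have [|w [w1 w2]] := @pb_lift _ _ _ _ _ _ _ _ _ h _ (cod_elt Z x) (cod_elt Z y).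
      by apply: arrow_eq => //=; apply: from_zero.
    by exists (ahom0 w); rewrite -[x]/(ahom0 (cod_elt Z x)) -[y]/(ahom0 (cod_elt Z y)) -w1 -w2.
- apply: mk_pb.
  + by apply: arrow_eq; [exact: (proj1 h1) | exact: (proj1 h0)].
  + move=> t x y e1 e2; apply: arrow_eq.
    * by apply: (pb_mono h1); [exact: (hom1_eq e1) | exact: (hom1_eq e2)].
    * by apply: (pb_mono h0); [exact: (hom0_eq e1) | exact: (hom0_eq e2)].
  + move=> t x y e.
    have [w1 [a1 b1]] := pb_lift h1 (hom1_eq e).
    have [w0 [a0 b0]] := pb_lift h0 (hom0_eq e).
    have comm : arr p ∘ w1 = w0 ∘ arr t.
      apply: (pb_mono h0); rewrite !cmp_assoc ?a0 ?b0 -?(ahom_comm u) -?(ahom_comm v).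
        by rewrite -cmp_assoc a1 (ahom_comm x).
      by rewrite -cmp_assoc b1 (ahom_comm y).
    by exists (arrow_hom t p comm); split; apply: arrow_eq.
Qed.

Lemma arr_zeroP a : IsZeroOb a <-> IsZeroOb (adom a) /\ IsZeroOb (acod a).
Proof.
split=> [h | [h1 h0] b].
- have comm : arr a ∘ zm hP (adom a) (adom a) = zm hP (acod a) (acod a) ∘ arr a.
    by rewrite zm_l zm_r.
  have e : idc a = arrow_hom a a comm by apply: to_zero.
  by split; apply: (zero_obP (hP := hP)); [exact: (hom1_eq e) | exact: (hom0_eq e)].
- have c1 : arr a ∘ zm hP (adom b) (adom a) = zm hP (acod b) (acod a) ∘ arr b by apply: to_zero.
  have c2 : arr b ∘ zm hP (adom a) (adom b) = zm hP (acod a) (acod b) ∘ arr a by apply: from_zero.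
  split; [exists (arrow_hom b a c1) | exists (arrow_hom a b c2)]; split=> // f _; apply: arrow_eq;
    by [apply: to_zero | apply: from_zero].
Qed.

Lemma arr_pointed : Pointed (Arr C).
Proof. by have [Z hZ] := hP; exists (Build_ArrowOb (idc Z)); apply/arr_zeroP. Qed.

Lemma arr_zm1 a b : ahom1 (zm arr_pointed a b) = zm hP _ _.
Proof.
have [z [f [g [/arr_zeroP[h _] ->]]]] := zm_zero arr_pointed a b.
by apply/zmP; exists (adom z), (ahom1 f), (ahom1 g).
Qed.

Lemma arr_zm0 a b : ahom0 (zm arr_pointed a b) = zm hP _ _.
Proof.
have [z [f [g [/arr_zeroP[_ h] ->]]]] := zm_zero arr_pointed a b.
by apply/zmP; exists (acod z), (ahom0 f), (ahom0 g).
Qed.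

Lemma arr_kerP (a b n : Arr C) (f : hom a b) (k : hom n a) :
  IsKernel f k <-> IsKernel (ahom1 f) (ahom1 k) /\ IsKernel (ahom0 f) (ahom0 k).
Proof.
have [z hz] := arr_pointed; have [z1 z0] := (proj1 (arr_zeroP z)) hz.
split=> [h | [h1 h0]].
- have /arr_pbP[h1 h0] := ker_pb arr_pointed (zm arr_pointed z b) (zm arr_pointed n z) hz h.
  by split; [exact: (pb_ker hP z1 h1) | exact: (pb_ker hP z0 h0)].
- apply: (pb_ker arr_pointed (z := zm arr_pointed z b) (w := zm arr_pointed n z) hz).
  by apply/arr_pbP; split; apply: (ker_pb hP).
Qed.

Lemma arr_coker (a b n : Arr C) (k : hom n a) (f : hom a b) :
  IsCokernel (ahom1 k) (ahom1 f) -> IsCokernel (ahom0 k) (ahom0 f) -> IsCokernel k f.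
Proof.
move=> h1 h0; apply: (@mk_coker _ arr_pointed).
- by apply: arrow_eq; rewrite ?arr_zm1 ?arr_zm0 /= ?(coker0 hP h1) ?(coker0 hP h0).
- move=> c u v e; apply: arrow_eq.
  + by apply: (coker_epi hP h1); exact: (hom1_eq e).
  + by apply: (coker_epi hP h0); exact: (hom0_eq e).
- move=> c t e.
  have e1 : ahom1 t ∘ ahom1 k = zm hP _ _ by rewrite -(arr_zm1 n c) -e.
  have e0 : ahom0 t ∘ ahom0 k = zm hP _ _ by rewrite -(arr_zm0 n c) -e.
  have [u1 hu1] := coker_lift h1 e1; have [u0 hu0] := coker_lift h0 e0.
  have comm : arr c ∘ u1 = u0 ∘ arr b.
    apply: (coker_epi hP h1).
    by rewrite -!cmp_assoc hu1 (ahom_comm t) (ahom_comm f) cmp_assoc hu0.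
  by exists (arrow_hom b c comm); apply: arrow_eq.
Qed.

Section Cotests.
Variables (a : Arr C) (T Z : C).

Definition dom_cotest := Build_ArrowOb (zm hP T Z) : Arr C.

Lemma dom_coelt_comm (x : hom (adom a) T) : arr dom_cotest ∘ x = zm hP (acod a) Z ∘ arr a.
Proof. by rewrite /= !zm_r. Qed.
Definition dom_coelt x : hom a dom_cotest := arrow_hom a dom_cotest (dom_coelt_comm x).

Lemma cod_coelt_comm (x : hom (acod a) T) : arr (dom_test T) ∘ (x ∘ arr a) = x ∘ arr a.
Proof. by rewrite /= cmp_idl. Qed.
Definition cod_coelt x : hom a (dom_test T) := arrow_hom a (dom_test T) (cod_coelt_comm x).

End Cotests.

Lemma arr_coeq (a b c : Arr C) (u v : hom a b) (f : hom b c) : IsCoequalizer u v f ->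
  IsCoequalizer (ahom1 u) (ahom1 v) (ahom1 f) /\ IsCoequalizer (ahom0 u) (ahom0 v) (ahom0 f).
Proof.
have [Z hZ] := hP.
case=> e h; split; split.
- exact: (hom1_eq e).
- move=> T t ht.
  have [|w [hw uw]] := h _ (dom_coelt Z t); first by apply: arrow_eq => //=; apply: to_zero.
  exists (ahom1 w); split; first exact: (hom1_eq hw).
  move=> w' hw'; have -> // : w = dom_coelt Z w'.
  by apply: uw; apply: arrow_eq => //=; apply: to_zero.
- exact: (hom0_eq e).
- move=> T t ht.
  have [|w [hw uw]] := h _ (cod_coelt t).
    apply: arrow_eq => //=.
    by rewrite -!cmp_assoc (ahom_comm u) (ahom_comm v) !cmp_assoc ht.
  exists (ahom0 w); split; first exact: (hom0_eq hw).
  move=> w' hw'; have -> // : w = cod_coelt w'.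
  by apply: uw; apply: arrow_eq => //=; rewrite -cmp_assoc ahom_comm cmp_assoc hw'.
Qed.

Lemma arr_regular a b (f : hom a b) : RegularEpi f ->
  RegularEpi (ahom1 f) /\ RegularEpi (ahom0 f).
Proof.
by case=> w [u [v /arr_coeq[h1 h0]]]; split;
  [exists (adom w), (ahom1 u), (ahom1 v) | exists (acod w), (ahom0 u), (ahom0 v)].
Qed.

Lemma arr_coker_ker (a b n : Arr C) (f : hom a b) (k : hom n a) :
  RegularEpi (ahom1 f) -> RegularEpi (ahom0 f) -> IsKernel f k -> IsCokernel k f.
Proof. by move=> f1 f0 /arr_kerP[h1 h0]; apply: arr_coker; apply: (ne_coker hN). Qed.

Lemma arr_pb_ex (a b c : Arr C) (f : hom a c) (g : hom b c) :
  exists (p : Arr C) (u : hom p a) (v : hom p b), IsPullback f g u v.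
Proof.
have [P1 [u1 [v1 h1]]] := hpb (ahom1 f) (ahom1 g).
have [P0 [u0 [v0 h0]]] := hpb (ahom0 f) (ahom0 g).
have [|w [wu wv]] := @pb_lift _ _ _ _ _ _ _ _ _ h0 P1 (arr a ∘ u1) (arr b ∘ v1).
  by rewrite !cmp_assoc -!ahom_comm -!cmp_assoc (proj1 h1).
pose p : Arr C := Build_ArrowOb w.
have cu : arr a ∘ u1 = u0 ∘ arr p by [].
have cv : arr b ∘ v1 = v0 ∘ arr p by [].
by exists p, (arrow_hom p a cu), (arrow_hom p b cv); apply/arr_pbP.
Qed.

Lemma arr_normal_exact : NormalExact (Arr C).
Proof.
have [Z hZ] := hP.
split.
- exact: arr_pointed.
- exact: arr_pb_ex.
- by move=> a b f n k /arr_regular[f1 f0]; apply: arr_coker_ker.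
- move=> a r r0 r1 jm [d [d0 d1]].
  have [||X1 [f1 [rf1 pb1]]] := @ne_refl _ hN _ _ (ahom1 r0) (ahom1 r1).
  + move=> T u v e0 e1.
    suff e : dom_elt u = dom_elt v by exact: (hom1_eq e).
    by apply: jm; apply: arrow_eq => //=; rewrite !cmp_assoc -ahom_comm -!cmp_assoc ?e0 ?e1.
  + by exists (ahom1 d); split; [exact: (hom1_eq d0) | exact: (hom1_eq d1)].
  have [||X0 [f0 [rf0 pb0]]] := @ne_refl _ hN _ _ (ahom0 r0) (ahom0 r1).
  + move=> T u v e0 e1.
    suff e : cod_elt Z u = cod_elt Z v by exact: (hom0_eq e).
    by apply: jm; apply: arrow_eq => //=; apply: from_zero.
  + by exists (ahom0 d); split; [exact: (hom0_eq d0) | exact: (hom0_eq d1)].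
  have [K [k hk]] := ker_ex hP hpb f1.
  have [|x hx] := coker_lift (hP := hP) (ne_coker hN rf1 hk) (t := f0 ∘ arr a).
    have [|w [w0 w1]] := @pb_lift _ _ _ _ _ _ _ _ _ pb1 _ (zm hP K (adom a)) k.
      by rewrite zm_l (ker0 hP hk).
    rewrite -w1; nf; rewrite (cmp_assoc (arr a)) (ahom_comm r1) -cmp_assoc cmp_assoc -(proj1 pb0).
    by rewrite -cmp_assoc (cmp_assoc _ (arr r)) -(ahom_comm r0) -!cmp_assoc w0 !zm_l.
  pose y : Arr C := Build_ArrowOb x.
  have comm : arr y ∘ f1 = f0 ∘ arr a by [].
  exists y, (arrow_hom a y comm); split; last by apply/arr_pbP.
  have [L [l hl]] := ker_ex hP hpb f0.
  have [c hc] := ker_square hN comm hk hl.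
  have ck : arr a ∘ k = l ∘ arr (Build_ArrowOb c) by [].
  apply: (@coker_regular _ arr_pointed _ _ (arrow_hom (Build_ArrowOb c) a ck)).
  by apply: arr_coker_ker => //; apply/arr_kerP.
Qed.

End ArrowExactness.

(** * Double extensions form a class of extensions *)

Section ArrowExtensions.
Variables (C : Category) (E : ArrowClass C).
Hypotheses (hN : NormalExact C) (hE : ClassOfExtensions E).
Implicit Types T : C.
Implicit Types a b c : Arr C.
Let hP : Pointed C := ne_pointed hN.
Let hpb := ne_pb hN.
Notation "0" := (zm hP _ _).
Local Notation E1 := (DoubleExt E).

Lemma arr_EobP a : Eob E1 a <-> E (arr a).
Proof.
split=> [[b [c [f [[hb hc _ _ _] [-> | ->]]]]] // | h].
exists a, a, (idc a); split; last by left.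
have i1 := E_id hE (E_dom h); have i0 := E_id hE (E_cod h).
split=> //; split; first by rewrite /=; nf.
exists (adom a), (arr a), (idc _), (idc _); split=> //.
- exact: pb_sym (pb_id _).
- by nf.
Qed.

(** An element killed by [a] is killed by [f = g a], so it comes from [K], and its image
    under [k] vanishes. *)
Lemma ker_of_section (K A L D K' Y : C) (i : hom K A) (f : hom A Y) (j : hom L D) (g : hom D Y)
  (k : hom K L) (a : hom A D) (n : hom K' K) :
  IsKernel f i -> IsKernel g j -> a ∘ i = j ∘ k -> g ∘ a = f -> IsKernel k n ->
  IsKernel a (i ∘ n).
Proof.
move=> hi hj e1 e2 hn; apply: (@mk_ker _ hP).
- by rewrite cmp_assoc e1 -cmp_assoc (ker0 hP hn) zm_l.
- by move=> T u v; rewrite -!cmp_assoc => /(ker_mono hP hi) /(ker_mono hP hn).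
- move=> T t at0.
  have [|w hw] := @ker_lift _ hP _ _ _ _ _ hi T t; first by rewrite -e2 -cmp_assoc at0 zm_l.
  have [|x hx] := @ker_lift _ hP _ _ _ _ _ hn T w.
    by apply: (ker_mono hP hj); rewrite cmp_assoc -e1 -cmp_assoc hw at0 zm_l.
  by exists x; rewrite -cmp_assoc hx.
Qed.

(** Each axiom is checked on the edges and on the kernels of a pair of opposite edges. *)
Lemma double_extensions : ClassOfExtensions E1.
Proof.
split.
- move=> a b f [ha hb h1 h0 _].
  have [n [k hk]] := ker_ex (arr_pointed hN) (arr_pb_ex hN) f.
  exact: (coker_regular (arr_pointed hN) (arr_coker_ker hN (ext_regular hE h1) (ext_regular hE h0) hk)).
- have [Z hZ] := hP; exists (Build_ArrowOb (idc Z)); split; first exact/(arr_zeroP hN).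
  by apply/arr_EobP/(E_id hE)/(Eob_zero hN hE).
- move=> a b f /arr_EobP ha /arr_EobP hb [s e].
  have h1 : E (ahom1 f).
    by apply: (ext_split hE (E_dom ha) (E_dom hb)); exists (ahom1 s); exact: (hom1_eq e).
  have h0 : E (ahom0 f).
    by apply: (ext_split hE (E_cod ha) (E_cod hb)); exists (ahom0 s); exact: (hom0_eq e).
  apply: double_sym.
  apply: (@double_of_split _ _ hN hE _ _ _ _ _ _ _ _ (ahom1 s) (ahom0 s)) => //.
  + by rewrite ahom_comm.
  + exact: (hom1_eq e).
  + exact: (hom0_eq e).
  + exact: ahom_comm.
- move=> a b c f g df dg.
  have [ha hb f1 f0 _] := df; have [_ hc g1 g0 _] := dg.
  have [Ka [ka hka]] := ker_ex hP hpb (arr a); have [Kb [kb hkb]] := ker_ex hP hpb (arr b).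
  have [Kc [kc hkc]] := ker_ex hP hpb (arr c).
  have [u hu] := ker_square hN (esym (ahom_comm f)) hka hkb.
  have [v hv] := ker_square hN (esym (ahom_comm g)) hkb hkc.
  have eu := ker_of_double hN hE (double_sym df) hka hkb hu.
  have ev := ker_of_double hN hE (double_sym dg) hkb hkc hv.
  apply: double_sym.
  apply: (double_of_ker hN hE (c := v ∘ u) _ _ _ _ _ hka hkc) => //=.
  + by rewrite -!cmp_assoc -(ahom_comm f) !cmp_assoc (ahom_comm g).
  + exact: (ext_cmp hE).
  + exact: (ext_cmp hE).
  + by rewrite cmp_assoc hv -!cmp_assoc hu.
  + exact: (ext_cmp hE).
- move=> a b c f g dgf /arr_EobP hb.
  have [ha hc gf1 gf0 _] := dgf.
  have g1 : E (ahom1 g) by apply: (ext_cancel hE (f := ahom1 f)) => //; exact: E_dom hb.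
  have g0 : E (ahom0 g) by apply: (ext_cancel hE (f := ahom0 f)) => //; exact: E_cod hb.
  have [Ka [ka hka]] := ker_ex hP hpb (arr a); have [Kb [kb hkb]] := ker_ex hP hpb (arr b).
  have [Kc [kc hkc]] := ker_ex hP hpb (arr c).
  have [u hu] := ker_square hN (esym (ahom_comm f)) hka hkb.
  have [v hv] := ker_square hN (esym (ahom_comm g)) hkb hkc.
  have evu : E (v ∘ u).
    apply: (ker_of_double hN hE (double_sym dgf) hka hkc).
    by rewrite cmp_assoc hv -!cmp_assoc hu.
  apply: double_sym; apply: (double_of_ker hN hE _ _ _ _ _ hkb hkc hv) => //.
  + by rewrite ahom_comm.
  + by apply: (ext_cancel hE evu); apply: (Eob_ker hN hE hb hkb).
- move=> a b d p f g u v df /arr_EobP hd pb.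
  have [ha hb f1 f0 _] := df.
  have [pb1 pb0] := proj1 (arr_pbP hN _ _ _ _) pb.
  have u1 : E (ahom1 u) by apply: (E_pb hE pb1) => //; exact: E_dom hd.
  have u0 : E (ahom0 u) by apply: (E_pb hE pb0) => //; exact: E_cod hd.
  have [K1 [k1 hk1]] := ker_ex hP hpb (ahom1 u).
  have [K0 [k0 hk0]] := ker_ex hP hpb (ahom0 u).
  have [w hw] := ker_square hN (ahom_comm u) hk1 hk0.
  have ew : E w.
    apply: (ker_of_double hN hE df (ker_of_pb hP pb1 hk1) (ker_of_pb hP pb0 hk0)).
    by rewrite -cmp_assoc hw cmp_assoc -ahom_comm; nf.
  apply: (double_of_ker hN hE _ _ _ _ _ hk1 hk0 hw) => //; first exact: ahom_comm.
  by apply: (E_of_square hN hE (ahom_comm u) hd u1 u0 hk1 hk0 hw).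
- move=> n a b k f [hk hf] /arr_EobP ha /arr_EobP hn.
  have rf := arr_regular hN (coker_regular (arr_pointed hN) hf).
  have [hk1 hk0] := proj1 (arr_kerP hN _ _) hk.
  have f1 : E (ahom1 f).
    apply: (ext_exact hE (k := ahom1 k)); [|exact: E_dom ha | exact: E_dom hn].
    by split=> //; apply: (ne_coker hN) => //; case: rf.
  have f0 : E (ahom0 f).
    apply: (ext_exact hE (k := ahom0 k)); [|exact: E_cod ha | exact: E_cod hn].
    by split=> //; apply: (ne_coker hN) => //; case: rf.
  apply: (double_of_ker hN hE _ _ _ _ _ hk1 hk0 (esym (ahom_comm k))) => //.
  + exact: ahom_comm.
  + apply: (ext_cancel hE (f := ahom1 f)); last exact: E_cod f1.
    by rewrite ahom_comm; apply: (ext_cmp hE).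
- move=> k a b l d i f j g kk h [hi ci] [hj cj] e1 e2 df dk /arr_EobP hd.
  have [ha hb f1 f0 _] := df; have [ek el k1 k0 _] := dk.
  have rf := arr_regular hN (coker_regular (arr_pointed hN) ci).
  have rg := arr_regular hN (coker_regular (arr_pointed hN) cj).
  have [hi1 hi0] := proj1 (arr_kerP hN _ _) hi.
  have [hj1 hj0] := proj1 (arr_kerP hN _ _) hj.
  have h1 : E (ahom1 h).
    apply: (ext_five hE (E_short_exact hN hE f1 hi1) _ (hom1_eq e1) (hom1_eq e2) f1 k1 (E_dom hd)).
    by split=> //; apply: (ne_coker hN) => //; case: rg.
  have h0 : E (ahom0 h).
    apply: (ext_five hE (E_short_exact hN hE f0 hi0) _ (hom0_eq e1) (hom0_eq e2) f0 k0 (E_cod hd)).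
    by split=> //; apply: (ne_coker hN) => //; case: rg.
  have [N1 [n1 hn1]] := ker_ex hP hpb (ahom1 kk).
  have [N0 [n0 hn0]] := ker_ex hP hpb (ahom0 kk).
  have [w hw] := ker_square hN (ahom_comm kk) hn1 hn0.
  have ew := ker_of_double hN hE dk hn1 hn0 hw.
  apply: (double_of_ker hN hE (ahom_comm h) ha hd h1 h0
            (ker_of_section hi1 hj1 (hom1_eq e1) (hom1_eq e2) hn1)
            (ker_of_section hi0 hj0 (hom0_eq e1) (hom0_eq e2) hn0) _ ew).
  by rewrite -cmp_assoc hw cmp_assoc -ahom_comm; nf.
Qed.

(** The codomain is lifted first, the domain then lifts along the comparison to the
    pullback. *)
Lemma arr_projective a : Projective E (adom a) -> Projective E (acod a) -> Projective E1 a.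
Proof.
move=> p1 p0 x y u f [hx hy f1 f0 [sq [P [p [q [c [pb hp hq [pc qc] hc]]]]]]].
have [w0 hw0] := p0 _ _ (ahom0 u) _ f0.
have [v [v1 v2]] : exists v, p ∘ v = w0 ∘ arr a /\ q ∘ v = ahom1 u.
  by apply: (pb_lift pb); rewrite cmp_assoc hw0 ahom_comm.
have [w1 hw1] := p1 _ _ v _ hc.
have comm : arr x ∘ w1 = w0 ∘ arr a by rewrite -pc -cmp_assoc hw1.
by exists (arrow_hom a x comm); apply: arrow_eq => //=; rewrite -qc -cmp_assoc hw1.
Qed.

End ArrowExtensions.

(** * Central extensions form a strongly Birkhoff subcategory *)

Definition CentralOb (C : Category) (E : ArrowClass C) (B : C -> Prop) : Arr C -> Prop :=
  fun a => CentralExt E B (arr a).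

Section ArrowBirkhoff.
Variables (C : Category) (E : ArrowClass C) (B : C -> Prop).
Hypotheses (hN : NormalExact C) (hE : ClassOfExtensions E) (hB : StronglyBirkhoff E B).
Implicit Types T R V : C.
Implicit Types a b c : Arr C.
Let hP : Pointed C := ne_pointed hN.
Let hpb := ne_pb hN.
Let hN1 := arr_normal_exact hN.
Let hE1 := double_extensions hN hE.
Notation "0" := (zm hP _ _).
Local Notation E1 := (DoubleExt E).
Local Notation B1 := (CentralOb E B).

Section Unit.
Variables (a : Arr C) (R : C) (p0 p1 : hom R (adom a)) (V : C) (k : hom V R).
Hypotheses (ha : E (arr a)) (pb : IsKernelPair (arr a) p0 p1) (hk : IsBracket B k).

(** The third clause describes the elements of the kernel [[a]_1] of the unit; the fourth
    presents it as the kernel of a split extension of brackets. *)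
Definition UnitSpec c (eta : hom a c) : Prop :=
  [/\ E1 eta, IsIso (ahom0 eta),
    (forall T (t : hom T (adom a)), ahom1 eta ∘ t = zm hP _ _ <->
       exists t', p0 ∘ k ∘ t' = zm hP _ _ /\ p1 ∘ k ∘ t' = t) &
    exists N (m : hom N (adom a)), IsKernel (ahom1 eta) m /\
      forall VX (kX : hom VX (adom a)) (p : hom V VX), IsBracket B kX -> kX ∘ p = p0 ∘ k ->
        exists2 n : hom N V, IsKernel p n & m = p1 ∘ k ∘ n].

Lemma central_reflection_ex : exists c (eta : hom a c), IsReflection B1 eta /\ UnitSpec eta.
Proof.
have [Q [q [g [N [m [hq gq cg hm [kill info]]]]]]] := centralization_ex hN hE hB ha pb hk.
pose c : Arr C := Build_ArrowOb g.
have comm : arr c ∘ q = idc (acod a) ∘ arr a by rewrite cmp_idl.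
exists c, (arrow_hom a c comm); split; last first.
  split=> //=; [|exact: iso_id | by exists N, m].
  have iA := E_id hE (E_cod ha).
  have eg := proj1 cg.
  split=> //=; split; first by nf.
  exists Q, g, (idc Q); exists q; split=> //.
  + exact: pb_sym (pb_id _).
  + exact: (E_id hE (E_cod hq)).
  + by rewrite cmp_idl.
split=> // d s cd.
have [ed condd] := proj1 (centralP hN hE hB _) cd.
have hs : ahom1 s ∘ m = zm hP _ _.
  have [n [n0 n1]] := proj1 (kill _ m) (ker0 hP hm).
  rewrite -n1 !cmp_assoc -(condd R V k (ahom1 s ∘ p0) (ahom1 s ∘ p1)) //.
  + by rewrite -!cmp_assoc (cmp_assoc p0) n0 zm_l.
  + exact: E_dom (proj1 (kernel_pair_E hE ha pb)).
  + by rewrite !cmp_assoc (ahom_comm s) -!cmp_assoc (proj1 pb).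
have [w hw] := coker_lift (ne_coker hN (ext_regular hE hq) hm) hs.
have comm' : arr d ∘ w = ahom0 s ∘ arr c.
  by apply: (E_epi hE hq); rewrite -!cmp_assoc hw gq; apply: ahom_comm.
exists (arrow_hom c d comm'); split.
  by apply: arrow_eq => //=; rewrite cmp_idr.
move=> w' e; apply: arrow_eq => /=.
- by apply: (E_epi hE hq); rewrite hw -(hom1_eq e).
- by rewrite -(hom0_eq e) /= cmp_idr.
Qed.

Lemma central_reflectionP c (eta : hom a c) : IsReflection B1 eta -> UnitSpec eta.
Proof.
move=> h; have [d [eta' [h' [e1 i0 kill [N [m [hm info]]]]]]] := central_reflection_ex.
have [u iu <-] := reflection_iso h' h.
have m1 := iso_mono (arrow_iso1 iu).
split.
- by apply: (ext_cmp hE1 e1); apply: (E_iso hN1 hE1 iu); apply: E_cod e1.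
- by apply: iso_cmp i0 (arrow_iso0 iu).
- move=> T t; rewrite -kill /= -cmp_assoc; split=> [e | ->]; last by rewrite zm_l.
  by apply: m1; rewrite e zm_l.
- exists N, m; split=> //; apply: mk_ker.
  + by rewrite /= -cmp_assoc (ker0 hP hm) zm_l.
  + exact: (ker_mono hP hm).
  + move=> T t; rewrite /= -cmp_assoc => e.
    by apply: (ker_lift (hP := hP) hm); apply: m1; rewrite e zm_l.
Qed.

(** The unit is invertible on codomains, so its kernel is concentrated in the domain. *)
Lemma arr_bracketP n (kap : hom n a) : IsBracket B1 kap ->
  [/\ IsZeroOb (acod n), ahom0 kap = zm hP _ _ &
    forall T (t : hom T (adom a)), (exists t', ahom1 kap ∘ t' = t) <->
      exists t', p0 ∘ k ∘ t' = zm hP _ _ /\ p1 ∘ k ∘ t' = t].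
Proof.
case=> c [eta [/central_reflectionP[e1 i0 kill _] /(arr_kerP hN)[k1 k0]]].
have z0 : ahom0 kap = zm hP _ _.
  by apply: (iso_mono i0); rewrite (ker0 hP k0) zm_l.
split=> //.
- by apply: (zero_obP (hP := hP)); apply: (ker_mono hP k0); rewrite z0 !zm_r.
- move=> T t; rewrite -kill; split=> [[t' <-] | ].
    by rewrite cmp_assoc (ker0 hP k1) zm_r.
  exact: ker_lift.
Qed.

End Unit.

(** By the kernel criterion, applied to double extensions themselves, it suffices that
    [[a]_1 -> [b]_1] is an extension.  This is the map of kernels of the square formed by
    the brackets of the kernel pairs and of the domains, which is split by the diagonals. *)
Lemma central_birkhoff : StronglyBirkhoff E1 B1.
Proof.
split.
- by move=> a [h _]; apply/(arr_EobP hE).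
- move=> a b /(centralP hN hE hB)[ha ca] /(arr_EobP hE) hb [f [g [gf fg]]].
  apply/(centralP hN hE hB); split=> // T V k u v hT hk e.
  have h : (ahom1 g ∘ u) ∘ k = (ahom1 g ∘ v) ∘ k.
    apply: ca hT hk _.
    by rewrite !cmp_assoc (ahom_comm g) -!cmp_assoc e.
  have := congr1 (cmp (ahom1 f)) h.
  have fg1 : ahom1 f ∘ ahom1 g = idc _ := hom1_eq fg.
  by rewrite !cmp_assoc fg1 !cmp_idl.
- move=> a /(arr_EobP hE) ha.
  have [R [p0 [p1 [V [k [pb hR hk]]]]]] := kernel_pair_ex hN hE hB ha.
  have [c [eta [h _]]] := central_reflection_ex ha pb hk.
  by exists c, eta.
- move=> a b f ca cb eta th If df ra rb sq.
  have [ha hb f1 f0 _] := df.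
  have [R [p0 [p1 [V [k [pbR hR hk]]]]]] := kernel_pair_ex hN hE hB ha.
  have [S [q0 [q1 [W [l [pbS hS hl]]]]]] := kernel_pair_ex hN hE hB hb.
  have [e1 i0 kill [N [m [hm info]]]] := central_reflectionP ha pbR hk ra.
  have [t1 j0 kill' [N' [m' [hm' info']]]] := central_reflectionP hb pbS hl rb.
  have eIf : E1 If.
    by apply: (ext_cancel hE1 (f := eta)); [rewrite sq; apply: (ext_cmp hE1) | exact: E_cod e1].
  have [VX [kX hkX]] := bracket_ex hN hB (E_dom ha).
  have [VY [kY hkY]] := bracket_ex hN hB (E_dom hb).
  have [pX hpX] := bracket_map hN p0 hk hkX; have [pY hpY] := bracket_map hN q0 hl hkY.
  have [n hn em] := info _ _ _ hkX hpX; have [n' hn' em'] := info' _ _ _ hkY hpY.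
  have [ep0 ep1] := kernel_pair_E hE ha pbR; have [eq0 eq1] := kernel_pair_E hE hb pbS.
  have [r [r0 r1]] : exists r, q0 ∘ r = ahom1 f ∘ p0 /\ q1 ∘ r = ahom1 f ∘ p1.
    by apply: (pb_lift pbS); rewrite !cmp_assoc ahom_comm -!cmp_assoc (proj1 pbR).
  have er : E r.
    have [KX [kx hkx]] := ker_ex hP hpb p0; have [KY [ky hky]] := ker_ex hP hpb q0.
    have [w hw] := ker_square hN (esym r0) hkx hky.
    apply: (E_of_square hN hE (esym r0) f1 ep0 eq0 hkx hky hw).
    apply: (ker_of_double hN hE (double_sym df) (ker_of_pb hP pbR hkx) (ker_of_pb hP pbS hky)).
    by rewrite -cmp_assoc hw cmp_assoc r1; nf.
  have [gR hgR] := bracket_map hN r hk hl.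
  have [gX hgX] := bracket_map hN (ahom1 f) hkX hkY.
  have egR := bracket_E hN hE hB er hk hl hgR.
  have egX := bracket_E hN hE hB f1 hkX hkY hgX.
  have epX := bracket_E hN hE hB ep0 hk hkX hpX.
  have epY := bracket_E hN hE hB eq0 hl hkY hpY.
  have [d [d0 d1]] := pb_lift pbR (erefl (arr a ∘ idc _)).
  have [d' [d0' d1']] := pb_lift pbS (erefl (arr b ∘ idc _)).
  have [gd hgd] := bracket_map hN d hkX hk; have [gd' hgd'] := bracket_map hN d' hkY hl.
  have sqV : gX ∘ pX = pY ∘ gR.
    apply: (bracket_mono hN hkY); rewrite !cmp_assoc hgX hpY -!cmp_assoc hpX hgR.
    by rewrite !cmp_assoc r0.
  have dV : IsDoubleExtension E pX pY gR gX.
    apply: (double_of_split hN hE (sa := gd) (sb := gd')) => //.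
    + apply: (bracket_mono hN hkX).
      by rewrite cmp_assoc hpX -cmp_assoc hgd cmp_assoc d0 cmp_idl cmp_idr.
    + apply: (bracket_mono hN hkY).
      by rewrite cmp_assoc hpY -cmp_assoc hgd' cmp_assoc d0' cmp_idl cmp_idr.
    + apply: (bracket_mono hN hl).
      rewrite !cmp_assoc hgR hgd' -!cmp_assoc hgd hgX !cmp_assoc; congr (_ ∘ _).
      by apply: (pb_mono pbS); rewrite !cmp_assoc ?r0 ?r1 ?d0' ?d1' -!cmp_assoc ?d0 ?d1; nf.
  have [x hx] := ker_square hN sqV hn hn'.
  have ex := ker_of_double hN hE (double_sym dV) hn hn' hx.
  (* the kernels of the units live on domains, with zero codomain *)
  have [Z hZ] := hP.
  have EZ := Eob_zero hN hE hZ.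
  pose na : Arr C := Build_ArrowOb (zm hP N Z); pose nb : Arr C := Build_ArrowOb (zm hP N' Z).
  have ca' : arr a ∘ m = zm hP Z (acod a) ∘ arr na.
    rewrite zm_l; apply: (iso_mono i0).
    by rewrite cmp_assoc -ahom_comm -cmp_assoc (ker0 hP hm) !zm_l.
  have cb' : arr b ∘ m' = zm hP Z (acod b) ∘ arr nb.
    rewrite zm_l; apply: (iso_mono j0).
    by rewrite cmp_assoc -ahom_comm -cmp_assoc (ker0 hP hm') !zm_l.
  have cx : arr nb ∘ x = idc Z ∘ arr na by apply: to_zero.
  have kz (c c' : C) (y : hom c c') : IsIso y -> IsKernel y (zm hP Z c).
    move=> iy; apply: zero_mono_ker => // T t e.
    by apply: (iso_mono iy); rewrite e zm_l.
  have hka : IsKernel eta (arrow_hom na a ca') by apply/(arr_kerP hN); split=> //; apply: kz.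
  have hkb : IsKernel th (arrow_hom nb b cb') by apply/(arr_kerP hN); split=> //; apply: kz.
  have EN := Eob_ker hN hE epX hn; have EN' := Eob_ker hN hE epY hn'.
  have exE : E1 (arrow_hom na nb cx).
    have [L [y hy]] := ker_ex hP hpb x.
    have EL := Eob_ker hN hE ex hy.
    apply: (double_of_ker hN hE (c := zm hP L Z) _ _ _ _ _ hy (kz _ _ _ (iso_id Z))) => //=.
    + exact: E_to_zero.
    + exact: E_to_zero.
    + exact: E_id.
    + exact: to_zero.
    + exact: E_to_zero.
  apply: double_sym.
  apply: (double_of_ker hN1 hE1 sq df eIf e1 t1 hka hkb _ exE).
  apply: arrow_eq => /=.
  + by rewrite em em' -!cmp_assoc hx !cmp_assoc -(cmp_assoc q1) hgR !cmp_assoc r1.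
  + exact: from_zero.
Qed.

(** If [s] splits the arrow [a], then [x |-> (s a x, x)] maps the bracket of the domain to
    the bracket of the kernel pair, and it sends an element [t] of the kernel of [a] to
    [(0, t)]. *)
Lemma split_bracket a n (kap : hom n a) V (k : hom V (adom a)) T (t : hom T (adom a)) :
  E (arr a) -> SplitEpi (arr a) -> IsBracket B1 kap -> IsBracket B k ->
  arr a ∘ t = zm hP _ _ -> (exists t', k ∘ t' = t) -> exists t', ahom1 kap ∘ t' = t.
Proof.
move=> ha [s hs] hkap hk at0 [t' ht'].
have [R [p0 [p1 [W [l [pb hR hl]]]]]] := kernel_pair_ex hN hE hB ha.
have [_ _ ->] := arr_bracketP ha pb hl hkap.
have [d [d0 d1]] : exists d, p0 ∘ d = s ∘ arr a /\ p1 ∘ d = idc _.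
  by apply: (pb_lift pb); rewrite cmp_assoc hs; nf.
have [g hg] := bracket_map hN d hk hl.
exists (g ∘ t'); rewrite !cmp_assoc -!(cmp_assoc _ l) hg !cmp_assoc d0 d1; nf.
by rewrite ht' at0 zm_l.
Qed.

Lemma arr_bracket_sub a n (kap : hom n a) V (k : hom V (adom a)) :
  E (arr a) -> IsBracket B1 kap -> IsBracket B k -> exists u, k ∘ u = ahom1 kap.
Proof.
move=> ha hkap hk.
have [R [p0 [p1 [W [l [pb hR hl]]]]]] := kernel_pair_ex hN hE hB ha.
have [_ _ h] := arr_bracketP ha pb hl hkap.
have [t [_ <-]] := proj1 (h _ (ahom1 kap)) (ex_intro _ (idc _) (cmp_idr _)).
have [g hg] := bracket_map hN p1 hl hk.
by exists (g ∘ t); rewrite cmp_assoc hg.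
Qed.

End ArrowBirkhoff.

(** * Birkhoff data and their equivalences *)

Record BirkhoffData (C : Category) (E : ArrowClass C) (B : C -> Prop) : Prop := {
  bd_exact : NormalExact C;
  bd_ext : ClassOfExtensions E;
  bd_birk : StronglyBirkhoff E B
}.

Lemma arrow_data (C : Category) (E : ArrowClass C) (B : C -> Prop) :
  BirkhoffData E B -> BirkhoffData (DoubleExt E) (CentralOb E B).
Proof.
case=> hN hE hB; split.
- exact: arr_normal_exact.
- exact: double_extensions.
- exact: central_birkhoff.
Qed.

Lemma bd_B_iso (C : Category) (E : ArrowClass C) (B : C -> Prop) (h : BirkhoffData E B)
  (X Y : C) (f : hom X Y) : IsIso f -> B X -> B Y.
Proof.
move=> hf hX; apply: (birk_replete (bd_birk h) hX); last by exists f.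
exact: (Eob_iso (bd_exact h) (bd_ext h) hf (birk_sub (bd_birk h) hX)).
Qed.

Record Equivalence (D D' : Category) (F : Functor D D') : Prop := {
  eqv_full : forall (X Y : D) (g : hom (F X) (F Y)), exists f : hom X Y, fmap F f = g;
  eqv_faithful : forall (X Y : D) (f g : hom X Y), fmap F f = fmap F g -> f = g;
  eqv_surj : forall Y : D', exists (X : D) (u : hom (F X) Y), IsIso u
}.

Record DataEquivalence (D D' : Category) (E : ArrowClass D) (B : D -> Prop)
  (E' : ArrowClass D') (B' : D' -> Prop) (F : Functor D D') : Prop := {
  de_eqv : Equivalence F;
  de_E : forall (X Y : D) (f : hom X Y), E X Y f <-> E' (F X) (F Y) (fmap F f);
  de_B : forall X : D, B X <-> B' (F X)
}.

Section Equivalence.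
Variables (D D' : Category) (F : Functor D D').
Hypothesis hF : Equivalence F.
Implicit Types X Y Z T K P : D.

Lemma eqv_cover (T' : D') : exists T (w : hom (F T) T') (v : hom T' (F T)),
  v ∘ w = idc _ /\ w ∘ v = idc _.
Proof. by have [T [w [v [a b]]]] := eqv_surj hF T'; exists T, w, v. Qed.

Lemma eqv_iso X Y (f : hom X Y) : IsIso f <-> IsIso (fmap F f).
Proof.
split=> [[g [a b]] | [g' [a b]]].
  by exists (fmap F g); rewrite -!fmap_cmp a b !fmap_id.
have [g hg] := eqv_full hF g'; exists g.
by split; apply: (eqv_faithful hF); rewrite fmap_cmp fmap_id hg.
Qed.

Lemma eqv_zeroP X : IsZeroOb X <-> IsZeroOb (F X).
Proof.
split=> h.
- move=> T'; have [T [w [v [vw wv]]]] := eqv_cover T'.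
  have [[a [_ ua]] [b [_ ub]]] := h T; split.
  + exists (fmap F a ∘ v); split=> // f _.
    have [g hg] := eqv_full hF (f ∘ w).
    by rewrite (ua g) // hg -cmp_assoc wv cmp_idr.
  + exists (w ∘ fmap F b); split=> // f _.
    have [g hg] := eqv_full hF (v ∘ f).
    by rewrite (ub g) // hg cmp_assoc wv cmp_idl.
- move=> T; split.
  + have [f hf] : exists f : hom T X, True.
      by have [[f' _] _] := h (F T); have [f _] := eqv_full hF f'; exists f.
    by exists f; split=> // g _; apply: (eqv_faithful hF); apply: to_zero.
  + have [f hf] : exists f : hom X T, True.
      by have [_ [f' _]] := h (F T); have [f _] := eqv_full hF f'; exists f.
    by exists f; split=> // g _; apply: (eqv_faithful hF); apply: from_zero.
Qed.

Lemma eqv_zero_mor X Y (f : hom X Y) : IsZeroMor f <-> IsZeroMor (fmap F f).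
Proof.
split=> [[Z [a [b [hZ ->]]]] | [Z' [a' [b' [hZ' e]]]]].
  by exists (F Z), (fmap F a), (fmap F b); rewrite fmap_cmp; split=> //; apply/eqv_zeroP.
have [Z [w [v [vw wv]]]] := eqv_cover Z'.
have [a ha] := eqv_full hF (v ∘ a'); have [b hb] := eqv_full hF (b' ∘ w).
exists Z, a, b; split; last first.
  apply: (eqv_faithful hF); rewrite fmap_cmp ha hb e -!cmp_assoc (cmp_assoc w).
  by rewrite wv cmp_idl.
apply/eqv_zeroP => S'; have [[x [_ ux]] [y [_ uy]]] := hZ' S'; split.
- exists (v ∘ x); split=> // g _.
  by rewrite (ux (w ∘ g)) // cmp_assoc vw cmp_idl.
- exists (y ∘ w); split=> // g _.
  by rewrite (uy (g ∘ v)) // -cmp_assoc vw cmp_idr.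
Qed.

Lemma eqv_pbP X Y Z (f : hom X Z) (g : hom Y Z) P (p : hom P X) (q : hom P Y) :
  IsPullback f g p q <-> IsPullback (fmap F f) (fmap F g) (fmap F p) (fmap F q).
Proof.
split=> h; apply: mk_pb.
- by rewrite -!fmap_cmp (proj1 h).
- move=> T' u v e1 e2; have [T [w [w' [_ ww']]]] := eqv_cover T'.
  have [u0 hu] := eqv_full hF (u ∘ w); have [v0 hv] := eqv_full hF (v ∘ w).
  have e : u0 = v0.
    by apply: (pb_mono h); apply: (eqv_faithful hF); rewrite !fmap_cmp hu hv !cmp_assoc ?e1 ?e2.
  have e' : u ∘ w = v ∘ w by rewrite -hu -hv e.
  by rewrite -(cmp_idr u) -(cmp_idr v) -ww' !cmp_assoc e'.
- move=> T' x y e; have [T [w [w' [_ ww']]]] := eqv_cover T'.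
  have [x0 hx] := eqv_full hF (x ∘ w); have [y0 hy] := eqv_full hF (y ∘ w).
  have [|u [u1 u2]] := @pb_lift _ _ _ _ _ _ _ _ _ h T x0 y0.
    by apply: (eqv_faithful hF); rewrite !fmap_cmp hx hy !cmp_assoc e.
  exists (fmap F u ∘ w'); rewrite !cmp_assoc -!fmap_cmp u1 u2 hx hy -!cmp_assoc ww'.
  by rewrite !cmp_idr.
- by apply: (eqv_faithful hF); rewrite !fmap_cmp (proj1 h).
- move=> T u v e1 e2; apply: (eqv_faithful hF); apply: (pb_mono h).
    by rewrite -!fmap_cmp e1.
  by rewrite -!fmap_cmp e2.
- move=> T x y e.
  have [|u' [u1 u2]] := @pb_lift _ _ _ _ _ _ _ _ _ h (F T) (fmap F x) (fmap F y).
    by rewrite -!fmap_cmp e.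
  have [u hu] := eqv_full hF u'; exists u.
  by split; apply: (eqv_faithful hF); rewrite fmap_cmp hu.
Qed.

Lemma eqv_kerP X Y (f : hom X Y) K (k : hom K X) : Pointed D ->
  IsKernel f k <-> IsKernel (fmap F f) (fmap F k).
Proof.
move=> hP; have [Z hZ] := hP; have hFZ := proj1 (eqv_zeroP Z) hZ.
have hP' : Pointed D' by exists (F Z).
split=> h.
- apply: (pb_ker hP' hFZ (z := fmap F (zm hP Z Y)) (w := fmap F (zm hP K Z))).
  by apply/eqv_pbP/(ker_pb hP).
- apply: (pb_ker hP hZ (z := zm hP Z Y) (w := zm hP K Z)).
  by apply/eqv_pbP/(ker_pb hP').
Qed.

Lemma eqv_coeq W X Y (u v : hom W X) (f : hom X Y) :
  IsCoequalizer u v f -> IsCoequalizer (fmap F u) (fmap F v) (fmap F f).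
Proof.
case=> e h; split; first by rewrite -!fmap_cmp e.
move=> T' t ht; have [T [w [w' [w'w ww']]]] := eqv_cover T'.
have [t0 ht0] := eqv_full hF (w' ∘ t).
have [|g [hg ug]] := h T t0.
  by apply: (eqv_faithful hF); rewrite !fmap_cmp ht0 -!cmp_assoc ht.
exists (w ∘ fmap F g); split.
  by rewrite -cmp_assoc -fmap_cmp hg ht0 cmp_assoc ww' cmp_idl.
move=> s hs; have [s0 hs0] := eqv_full hF (w' ∘ s).
have -> : g = s0.
  by apply: ug; apply: (eqv_faithful hF); rewrite fmap_cmp hs0 ht0 -cmp_assoc hs.
by rewrite hs0 cmp_assoc ww' cmp_idl.
Qed.

Lemma eqv_coker_reflect X Y (f : hom X Y) Q (q : hom Y Q) :
  IsCokernel (fmap F f) (fmap F q) -> IsCokernel f q.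
Proof.
case=> e h; split; first by apply/eqv_zero_mor; rewrite fmap_cmp.
move=> T t ht; have [|g' [hg ug]] := h _ (fmap F t).
  by rewrite -fmap_cmp; apply/eqv_zero_mor.
have [g eg] := eqv_full hF g'; subst g'.
exists g; split; first by apply: (eqv_faithful hF); rewrite fmap_cmp.
by move=> s hs; apply: (eqv_faithful hF); apply: ug; rewrite -fmap_cmp hs.
Qed.

Lemma eqv_regular X Y (f : hom X Y) : RegularEpi f -> RegularEpi (fmap F f).
Proof. by case=> W [u [v /eqv_coeq h]]; exists (F W), (fmap F u), (fmap F v). Qed.

Hypothesis hN' : NormalExact D'.

Lemma eqv_pointed : Pointed D.
Proof.
have [Z' hZ'] := ne_pointed hN'; have [Z [w [v [vw wv]]]] := eqv_cover Z'.
exists Z; apply/eqv_zeroP; apply: (zero_obP (hP := ne_pointed hN')).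
by rewrite -vw (to_zero hZ' w (zm (ne_pointed hN') _ _)) zm_l.
Qed.

Lemma eqv_pb_ex X Y Z (f : hom X Z) (g : hom Y Z) :
  exists P (p : hom P X) (q : hom P Y), IsPullback f g p q.
Proof.
have [P' [p' [q' h]]] := ne_pb hN' (fmap F f) (fmap F g).
have [P [w [w' [w'w ww']]]] := eqv_cover P'.
have [p hp] := eqv_full hF (p' ∘ w); have [q hq] := eqv_full hF (q' ∘ w).
exists P, p, q; apply/eqv_pbP; rewrite hp hq; apply: mk_pb.
- by rewrite !cmp_assoc (proj1 h).
- move=> T u v; rewrite -!cmp_assoc => e1 e2.
  have e : w ∘ u = w ∘ v by apply: (pb_mono h).
  by rewrite -(cmp_idl u) -(cmp_idl v) -w'w -!cmp_assoc e.
- move=> T x y /(pb_lift h)[u [u1 u2]]; exists (w' ∘ u).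
  by rewrite -!cmp_assoc !(cmp_assoc w) ww' !cmp_idl.
Qed.

Lemma eqv_regular_reflect X Y (f : hom X Y) : RegularEpi (fmap F f) -> RegularEpi f.
Proof.
move=> h; have [K [k hk]] := ker_ex eqv_pointed eqv_pb_ex f.
apply: (coker_regular eqv_pointed (f := k)); apply: eqv_coker_reflect.
by apply: (ne_coker hN' h); apply/eqv_kerP => //; exact: eqv_pointed.
Qed.

Lemma eqv_normal_exact : NormalExact D.
Proof.
split; [exact: eqv_pointed | exact: eqv_pb_ex | |].
- move=> X Y f K k /eqv_regular rf hk; apply: eqv_coker_reflect.
  by apply: (ne_coker hN' rf); apply/eqv_kerP => //; exact: eqv_pointed.
- move=> X R r0 r1 jm [e [e0 e1]].
  have [||Y' [f' [rf pbf]]] := @ne_refl _ hN' _ _ (fmap F r0) (fmap F r1).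
  + move=> T' u v a b; have [T [w [w' [_ ww']]]] := eqv_cover T'.
    have [u0 hu] := eqv_full hF (u ∘ w); have [v0 hv] := eqv_full hF (v ∘ w).
    have euv : u0 = v0.
      by apply: jm; apply: (eqv_faithful hF); rewrite !fmap_cmp hu hv !cmp_assoc ?a ?b.
    have e' : u ∘ w = v ∘ w by rewrite -hu -hv euv.
    by rewrite -(cmp_idr u) -(cmp_idr v) -ww' !cmp_assoc e'.
  + by exists (fmap F e); rewrite -!fmap_cmp e0 e1 !fmap_id.
  have [Y [w [w' [w'w ww']]]] := eqv_cover Y'.
  have [f hf] := eqv_full hF (w' ∘ f').
  exists Y, f; split.
  + apply: eqv_regular_reflect; rewrite hf; apply: regular_epi_iso_cmp => //.
    by exists w.
  + apply/eqv_pbP; rewrite hf; apply: mk_pb.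
    * by rewrite -!cmp_assoc (proj1 pbf).
    * exact: (pb_mono pbf).
    * move=> T x y; rewrite -!cmp_assoc => e2; apply: (pb_lift pbf).
      by rewrite -(cmp_idl f') -ww' -!cmp_assoc e2.
Qed.

End Equivalence.

(** All the notions involved are preserved and reflected by [F], so a Birkhoff situation
    can be pulled back along [F]. *)
Section Transfer.
Variables (D D' : Category) (E : ArrowClass D) (B : D -> Prop).
Variables (E' : ArrowClass D') (B' : D' -> Prop) (F : Functor D D').
Hypotheses (hF : DataEquivalence E B E' B' F) (h' : BirkhoffData E' B').
Implicit Types X Y Z T K P R V : D.
Let eF := de_eqv hF.
Let hN' := bd_exact h'.
Let hE' := bd_ext h'.
Let hB' := bd_birk h'.
Let hN := eqv_normal_exact eF hN'.

Lemma de_E_iff X Y (f : hom X Y) : E f <-> E' (fmap F f).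
Proof. exact: (de_E hF). Qed.

Lemma de_EobP X : Eob E X <-> Eob E' (F X).
Proof.
split=> [[Y [Z [f [hf [-> | ->]]]]] | h].
- by apply: (@E_dom _ _ _ _ (fmap F f)); apply/de_E_iff.
- by apply: (@E_cod _ _ _ _ (fmap F f)); apply/de_E_iff.
- apply: (@E_dom _ _ _ _ (idc X)); apply/de_E_iff; rewrite fmap_id.
  exact: E_id.
Qed.

Lemma de_short_exact K X Y (k : hom K X) (f : hom X Y) :
  ShortExact k f -> ShortExact (fmap F k) (fmap F f).
Proof.
case=> hk hc; have hk' := proj1 (eqv_kerP eF _ _ (ne_pointed hN)) hk.
split=> //; apply: (ne_coker hN') => //; apply: (eqv_regular eF).
exact: coker_regular (ne_pointed hN) _ _ _ _ _ hc.
Qed.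

Lemma de_ext : ClassOfExtensions E.
Proof.
split.
- move=> X Y f /de_E_iff/(ext_regular hE'); exact: eqv_regular_reflect.
- have [Z hZ] := ne_pointed hN; exists Z; split=> //.
  by apply/de_EobP/(Eob_zero hN' hE')/(eqv_zeroP eF).
- move=> X Y f /de_EobP hX /de_EobP hY [s e]; apply/de_E_iff.
  by apply: (ext_split hE') => //; exists (fmap F s); rewrite -fmap_cmp e fmap_id.
- move=> X Y Z f g /de_E_iff hf /de_E_iff hg; apply/de_E_iff; rewrite fmap_cmp.
  exact: (ext_cmp hE').
- move=> X Y Z f g /de_E_iff; rewrite fmap_cmp => hgf /de_EobP hY; apply/de_E_iff.
  exact: (ext_cancel hE' hgf).
- move=> X Y Z P f g p q /de_E_iff hf /de_EobP hZ /(eqv_pbP eF) pb; apply/de_E_iff.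
  exact: (ext_pullback hE' hf hZ pb).
- move=> K X Y k f /de_short_exact se /de_EobP hX /de_EobP hK; apply/de_E_iff.
  exact: (ext_exact hE' se).
- move=> K X Y L Z i f j g k a /de_short_exact s1 /de_short_exact s2 e1 e2
    /de_E_iff hf /de_E_iff hk /de_EobP hZ; apply/de_E_iff.
  apply: (ext_five hE' s1 s2 _ _ hf hk hZ); by rewrite -!fmap_cmp ?e1 ?e2.
Qed.

Lemma de_reflectionP X R (eta : hom X R) : IsReflection B eta <-> IsReflection B' (fmap F eta).
Proof.
split=> [[bR h] | [bR h]].
- split; first exact/(de_B hF).
  move=> Y' f hY'; have [Y [w [w' [w'w ww']]]] := eqv_cover eF Y'.
  have hY : B Y.
    by apply/(de_B hF); apply: (bd_B_iso h' (f := w')) hY'; exists w.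
  have [f0 hf0] := eqv_full eF (w' ∘ f).
  have [g [hg ug]] := h Y f0 hY.
  exists (w ∘ fmap F g); split.
    by rewrite -cmp_assoc -fmap_cmp hg hf0 cmp_assoc ww' cmp_idl.
  move=> s hs; have [s0 hs0] := eqv_full eF (w' ∘ s).
  have -> : g = s0.
    by apply: ug; apply: (eqv_faithful eF); rewrite fmap_cmp hs0 hf0 -cmp_assoc hs.
  by rewrite hs0 cmp_assoc ww' cmp_idl.
- split; first exact/(de_B hF).
  move=> Y f /(de_B hF) hY; have [g' [hg ug]] := h _ (fmap F f) hY.
  have [g eg] := eqv_full eF g'; subst g'; exists g; split.
    by apply: (eqv_faithful eF); rewrite fmap_cmp.
  by move=> s hs; apply: (eqv_faithful eF); apply: ug; rewrite -fmap_cmp hs.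
Qed.

Lemma de_bracket X V (k : hom V X) : IsBracket B k -> IsBracket B' (fmap F k).
Proof.
case=> R [eta [he hk]]; exists (F R), (fmap F eta); split; first exact/de_reflectionP.
by apply/(eqv_kerP eF) => //; exact: ne_pointed hN.
Qed.

Lemma de_doubleP A1 A0 B1 B0 (a : hom A1 A0) (b : hom B1 B0) (f1 : hom A1 B1) (f0 : hom A0 B0) :
  IsDoubleExtension E a b f1 f0 <->
  IsDoubleExtension E' (fmap F a) (fmap F b) (fmap F f1) (fmap F f0).
Proof.
split=> h.
- case: h => /de_E_iff ha /de_E_iff hb /de_E_iff h1 /de_E_iff h0.
  case=> sq [P [p [q [u [pb /de_E_iff hp /de_E_iff hq [pu qu] /de_E_iff hu]]]]].
  split=> //; split; first by rewrite -!fmap_cmp sq.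
  exists (F P), (fmap F p), (fmap F q), (fmap F u); split=> //.
  + exact/(eqv_pbP eF).
  + by rewrite -!fmap_cmp pu qu.
- have [/de_E_iff ha /de_E_iff hb /de_E_iff h1 /de_E_iff h0 [sq' _]] := h.
  have sq : b ∘ f1 = f0 ∘ a by apply: (eqv_faithful eF); rewrite !fmap_cmp.
  split=> //; split=> //.
  have [P [p [q pb]]] := ne_pb hN f0 b.
  have [u [pu qu]] := pb_lift pb (esym sq).
  have hE := de_ext.
  exists P, p, q, u; split=> //.
  + exact: (E_pb hE pb hb (E_cod ha)).
  + exact: (E_pb' hE pb h0 (E_cod h1)).
  + apply/de_E_iff; apply: (double_any hN' hE' h (proj1 (eqv_pbP eF _ _ _ _) pb)).
      by rewrite -fmap_cmp pu.
    by rewrite -fmap_cmp qu.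
Qed.

Lemma de_birk : StronglyBirkhoff E B.
Proof.
split.
- by move=> X /(de_B hF)/(birk_sub hB')/de_EobP.
- move=> X Y /(de_B hF) hX _ [f /(eqv_iso eF) hf]; apply/(de_B hF).
  exact: (bd_B_iso h' hf).
- move=> X /de_EobP/(birk_reflective hB')[R' [eta' hr]].
  have [R [w [w' [w'w ww']]]] := eqv_cover eF R'.
  have [eta he] := eqv_full eF (w' ∘ eta').
  exists R, eta; apply/de_reflectionP; rewrite he; case: hr => bR h; split.
    by apply: (bd_B_iso h' (f := w')) bR; exists w.
  move=> Y f hY; have [g [hg ug]] := h Y f hY; exists (g ∘ w); split.
    by rewrite -!cmp_assoc (cmp_assoc w) ww' cmp_idl.
  move=> s hs; rewrite (ug (s ∘ w')) -?cmp_assoc ?w'w ?cmp_idr //.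
- move=> X Y f IX IY etaX etaY If /de_E_iff hf /de_reflectionP rX /de_reflectionP rY sq.
  apply/de_doubleP; apply: (birk_square hB' hf rX rY).
  by rewrite -!fmap_cmp sq.
Qed.

Lemma de_data : BirkhoffData E B.
Proof. split; [exact: hN | exact: de_ext | exact: de_birk]. Qed.

(** The criterion on elements is invariant, since every object of [D'] is covered by one
    from [D]. *)
Lemma de_centralP X Y (f : hom X Y) : CentralExt E B f <-> CentralExt E' B' (fmap F f).
Proof.
split=> [/(centralP hN de_ext de_birk)[/de_E_iff hf cf] |
         /(centralP hN' hE' hB')[/de_E_iff hf cf]].
- apply/(centralP hN' hE' hB'); split=> // T' V' k' u' v' hT hk' e.
  have [T [w [w' [w'w ww']]]] := eqv_cover eF T'.
  have hT1 : Eob E T.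
    apply/de_EobP; apply: (Eob_iso hN' hE' _ hT (f := w')); by exists w.
  have [V [k hk]] := bracket_ex hN de_birk hT1.
  have [g hg] := bracket_map hN' w' hk' (de_bracket hk).
  have [u hu] := eqv_full eF (u' ∘ w); have [v hv] := eqv_full eF (v' ∘ w).
  have euv : u ∘ k = v ∘ k.
    apply: cf hT1 hk _; apply: (eqv_faithful eF); rewrite !fmap_cmp hu hv.
    by rewrite !cmp_assoc e.
  have ek : k' = w ∘ fmap F k ∘ g by rewrite -cmp_assoc hg cmp_assoc ww' cmp_idl.
  by rewrite ek !cmp_assoc -hu -hv -!fmap_cmp euv.
- apply/(centralP hN de_ext de_birk); split=> // T V k u v hT hk e.
  apply: (eqv_faithful eF); rewrite !fmap_cmp.
  apply: cf; [exact/de_EobP | exact: de_bracket |].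
  by rewrite -!fmap_cmp e.
Qed.

End Transfer.

Definition functor_cmp (C D D' : Category) (G : Functor D D') (F : Functor C D) : Functor C D'.
Proof.
exists (fun X => G (F X)) (fun X Y f => fmap G (fmap F f)).
- by move=> X; rewrite !fmap_id.
- by move=> X Y Z g f; rewrite !fmap_cmp.
Defined.

Definition arrow_functor (C D : Category) (F : Functor C D) : Functor (Arr C) (Arr D).
Proof.
refine (@Build_Functor (Arr C) (Arr D) (fun a => Build_ArrowOb (fmap F (arr a)))
  (fun a b f => arrow_hom (Build_ArrowOb (fmap F (arr a))) (Build_ArrowOb (fmap F (arr b)))
     (f1 := fmap F (ahom1 f)) (f0 := fmap F (ahom0 f)) _) _ _).
- by move=> a; apply: arrow_eq => /=; rewrite fmap_id.
- by move=> a b c g f; apply: arrow_eq => /=; rewrite fmap_cmp.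
Unshelve.
by rewrite /= -!fmap_cmp ahom_comm.
Defined.

Lemma arrow_data_equivalence (D D' : Category) (E : ArrowClass D) (B : D -> Prop)
  (E' : ArrowClass D') (B' : D' -> Prop) (F : Functor D D') :
  DataEquivalence E B E' B' F -> BirkhoffData E' B' ->
  DataEquivalence (DoubleExt E) (CentralOb E B) (DoubleExt E') (CentralOb E' B') (arrow_functor F).
Proof.
move=> hF h'; have eF := de_eqv hF; split.
- split.
  + move=> a b g.
    have [f1 h1] := eqv_full eF (ahom1 g); have [f0 h0] := eqv_full eF (ahom0 g).
    have comm : arr b ∘ f1 = f0 ∘ arr a.
      by apply: (eqv_faithful eF); rewrite !fmap_cmp h1 h0; apply: (ahom_comm g).
    by exists (arrow_hom a b comm); apply: arrow_eq.
  + by move=> a b f g e; apply: arrow_eq; apply: (eqv_faithful eF);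
      [exact: (hom1_eq e) | exact: (hom0_eq e)].
  + move=> b; have [X1 [w1 [v1 [vw1 wv1]]]] := eqv_cover eF (adom b).
    have [X0 [w0 [v0 [vw0 wv0]]]] := eqv_cover eF (acod b).
    have [x hx] := eqv_full eF (v0 ∘ arr b ∘ w1).
    pose a : Arr D := Build_ArrowOb x.
    have comm : arr b ∘ w1 = w0 ∘ arr (arrow_functor F a).
      by rewrite /= hx !cmp_assoc wv0 cmp_idl.
    exists a, (arrow_hom (arrow_functor F a) b comm).
    by apply: arrow_iso; [exists v1 | exists v0].
- by move=> a b f; apply: (de_doubleP hF h').
- by move=> a; apply: (de_centralP hF h').
Qed.

Lemma data_equivalence_cmp (C D D' : Category) (E : ArrowClass C) (B : C -> Prop)
  (E1 : ArrowClass D) (B1 : D -> Prop) (E2 : ArrowClass D') (B2 : D' -> Prop)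
  (G : Functor D D') (F : Functor C D) :
  DataEquivalence E B E1 B1 F -> DataEquivalence E1 B1 E2 B2 G ->
  DataEquivalence E B E2 B2 (functor_cmp G F).
Proof.
move=> hF hG; have eF := de_eqv hF; have eG := de_eqv hG; split.
- split.
  + move=> X Y g; have [g1 h1] := eqv_full eG g; have [g2 h2] := eqv_full eF g1.
    by exists g2; rewrite /= h2.
  + by move=> X Y f g /(eqv_faithful eG)/(eqv_faithful eF).
  + move=> Y; have [X [u iu]] := eqv_surj eG Y; have [W [v iv]] := eqv_surj eF X.
    by exists W, (u ∘ fmap G v); apply: iso_cmp => //; apply/(eqv_iso eG).
- by move=> X Y f; rewrite (de_E hF) (de_E hG).
- by move=> X; rewrite (de_B hF) (de_B hG).
Qed.

(** If [F G] is isomorphic to [H], and [F] and [H] are equivalences of data, so is [G].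
    The functors on cubes treated below commute up to isomorphism with splitting off the
    last direction, so they are reached from smaller cubes in this way. *)
Lemma data_equivalence_cancel (C D D' : Category) (E : ArrowClass C) (B : C -> Prop)
  (E1 : ArrowClass D) (B1 : D -> Prop) (E2 : ArrowClass D') (B2 : D' -> Prop)
  (F : Functor D D') (G : Functor C D) (H : Functor C D')
  (th : forall X : C, hom (F (G X)) (H X)) :
  BirkhoffData E2 B2 ->
  DataEquivalence E1 B1 E2 B2 F -> DataEquivalence E B E2 B2 H ->
  (forall X, IsIso (th X)) ->
  (forall X Y (f : hom X Y), th Y ∘ fmap F (fmap G f) = fmap H f ∘ th X) ->
  DataEquivalence E B E1 B1 G.
Proof.
move=> h2 hF hH ith nat; have eF := de_eqv hF; have eH := de_eqv hH.
have hN2 := bd_exact h2; have hE2 := bd_ext h2.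
split.
- split.
  + move=> X Y g; have [v iv vt] := iso_inv (ith X).
    have tv : th X ∘ v = idc _ by apply: (iso_mono iv); rewrite cmp_assoc vt cmp_idl cmp_idr.
    have [f hf] := eqv_full eH (th Y ∘ fmap F g ∘ v).
    exists f; apply: (eqv_faithful eF); apply: (iso_mono (ith Y)).
    by rewrite nat hf -cmp_assoc vt cmp_idr.
  + move=> X Y f g e; apply: (eqv_faithful eH); apply: (iso_epi (ith X)).
    by rewrite -!nat e.
  + move=> Y; have [X [u iu]] := eqv_surj eH (F Y).
    have [g hg] := eqv_full eF (u ∘ th X); exists X, g.
    by apply/(eqv_iso eF); rewrite hg; apply: iso_cmp.
- move=> X Y f; rewrite (de_E hH) (de_E hF); split.
  + have [v iv vt] := iso_inv (ith X); have [w iw wt] := iso_inv (ith Y).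
    apply: (E_arrow_iso hN2 hE2 iv iw); apply: (iso_epi (ith X)).
    by rewrite -!cmp_assoc vt -nat cmp_idr cmp_assoc wt cmp_idl.
  + exact: (E_arrow_iso hN2 hE2 (ith X) (ith Y)).
- move=> X; rewrite (de_B hH) (de_B hF); split.
  + by have [v iv _] := iso_inv (ith X); apply: (bd_B_iso h2 iv).
  + exact: (bd_B_iso h2 (ith X)).
Qed.

(** * Symmetry of double extensions and of double central extensions *)

Section Transpose.
Variable C : Category.

Definition transpose_arr (a : Arr (Arr C)) :
  hom (Build_ArrowOb (ahom1 (arr a)) : Arr C) (Build_ArrowOb (ahom0 (arr a)) : Arr C) :=
  arrow_hom (Build_ArrowOb (ahom1 (arr a)) : Arr C) (Build_ArrowOb (ahom0 (arr a)) : Arr C)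
    (esym (ahom_comm (arr a))).

Definition transpose_ob (a : Arr (Arr C)) : Arr (Arr C) := Build_ArrowOb (transpose_arr a).

Section TransposeHom.
Variables (a b : Arr (Arr C)) (f : hom a b).

Definition transpose_hom1 : hom (adom (transpose_ob a)) (adom (transpose_ob b)) :=
  arrow_hom (adom (transpose_ob a)) (adom (transpose_ob b))
    (f1 := ahom1 (ahom1 f)) (f0 := ahom1 (ahom0 f)) (hom1_eq (ahom_comm f)).

Definition transpose_hom0 : hom (acod (transpose_ob a)) (acod (transpose_ob b)) :=
  arrow_hom (acod (transpose_ob a)) (acod (transpose_ob b))
    (f1 := ahom0 (ahom1 f)) (f0 := ahom0 (ahom0 f)) (hom0_eq (ahom_comm f)).

Lemma transpose_hom_comm :
  arr (transpose_ob b) ∘ transpose_hom1 = transpose_hom0 ∘ arr (transpose_ob a).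
Proof.
by apply: arrow_eq; [apply: (ahom_comm (ahom1 f)) | apply: (ahom_comm (ahom0 f))].
Qed.

Definition transpose_hom : hom (transpose_ob a) (transpose_ob b) :=
  arrow_hom (transpose_ob a) (transpose_ob b) transpose_hom_comm.

End TransposeHom.

Definition transpose : Functor (Arr (Arr C)) (Arr (Arr C)).
Proof.
refine (@Build_Functor (Arr (Arr C)) (Arr (Arr C)) transpose_ob transpose_hom _ _).
- by move=> a; apply: arrow_eq; apply: arrow_eq.
- by move=> a b c g f; apply: arrow_eq; apply: arrow_eq.
Defined.

Lemma transpose_invol_comm1 (a : Arr (Arr C)) :
  arr (adom a) ∘ idc _ = idc _ ∘ arr (adom (transpose (transpose a))).
Proof. by rewrite cmp_idl cmp_idr. Qed.
Lemma transpose_invol_comm0 (a : Arr (Arr C)) :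
  arr (acod a) ∘ idc _ = idc _ ∘ arr (acod (transpose (transpose a))).
Proof. by rewrite cmp_idl cmp_idr. Qed.

Definition transpose_invol (a : Arr (Arr C)) : hom (transpose (transpose a)) a.
Proof.
refine (@arrow_hom (Arr C) (transpose (transpose a)) a
  (arrow_hom (adom (transpose (transpose a))) (adom a) (transpose_invol_comm1 a))
  (arrow_hom (acod (transpose (transpose a))) (acod a) (transpose_invol_comm0 a)) _).
by apply: arrow_eq; rewrite /= cmp_idl cmp_idr.
Defined.

Lemma transpose_invol_iso a : IsIso (transpose_invol a).
Proof. by apply: arrow_iso; apply: arrow_iso; apply: iso_id. Qed.

Lemma transpose_invol_nat a b (f : hom a b) :
  transpose_invol b ∘ fmap transpose (fmap transpose f) = f ∘ transpose_invol a.
Proof. by apply: arrow_eq; apply: arrow_eq; rewrite /= cmp_idl cmp_idr. Qed.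

Lemma transpose_eqv : Equivalence transpose.
Proof.
have faith a b (f g : hom a b) : fmap transpose f = fmap transpose g -> f = g.
  move=> e; apply: (iso_epi (transpose_invol_iso a)).
  by rewrite -!transpose_invol_nat e.
split=> //.
- move=> a b g; have [v iv vt] := iso_inv (transpose_invol_iso a).
  have tv : transpose_invol a ∘ v = idc _.
    by apply: (iso_mono iv); rewrite cmp_assoc vt cmp_idl cmp_idr.
  exists (transpose_invol b ∘ fmap transpose g ∘ v); apply: faith.
  apply: (iso_mono (transpose_invol_iso b)).
  by rewrite transpose_invol_nat -!cmp_assoc vt cmp_idr.
- by move=> a; exists (transpose a), (transpose_invol a); apply: transpose_invol_iso.
Qed.

Variables (E : ArrowClass C) (B : C -> Prop).
Hypothesis h : BirkhoffData E B.
Let hN := bd_exact h.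
Let hE := bd_ext h.
Let hB := bd_birk h.
Let h1 := arrow_data h.
Let hN1 := bd_exact h1.
Let hE1 := bd_ext h1.
Let hB1 := bd_birk h1.
Let hP : Pointed C := ne_pointed hN.
Let hP1 : Pointed (Arr C) := ne_pointed hN1.
Let hpb := ne_pb hN.
Local Notation E1 := (DoubleExt E).
Local Notation B1 := (CentralOb E B).
Local Notation E2 := (DoubleExt E1).
Local Notation B2 := (CentralOb E1 B1).

(** The kernels of one pair of opposite faces of a cube form a square, and so do those of
    the other pair after transposition: it is the transposed square. *)
Lemma transpose_ext a b (f : hom a b) : E2 f -> E2 (fmap transpose f).
Proof.
move=> df; have [da db d1 d0 _] := df.
have [n1 [k1 hk1]] := ker_ex hP1 (ne_pb hN1) (ahom1 f).
have [n0 [k0 hk0]] := ker_ex hP1 (ne_pb hN1) (ahom0 f).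
have [c hc] := ker_square hN1 (ahom_comm f) hk1 hk0.
have dc := ker_of_double hN1 hE1 df hk1 hk0 hc.
have [ea1 ea0 ea'1 ea'0 _] := da; have [eb1 eb0 eb'1 eb'0 _] := db.
have [_ _ e11 e10 _] := d1; have [_ _ e01 e00 _] := d0.
have [ec1 ec0 ec'1 ec'0 _] := dc.
have [hk11 hk10] := proj1 (arr_kerP hN _ _) hk1.
have [hk01 hk00] := proj1 (arr_kerP hN _ _) hk0.
pose m1 : Arr C := Build_ArrowOb (ahom1 c); pose m0 : Arr C := Build_ArrowOb (ahom0 c).
have c1 : ahom1 (arr a) ∘ ahom1 k1 = ahom1 k0 ∘ arr m1 by exact: (esym (hom1_eq hc)).
have c0 : ahom0 (arr a) ∘ ahom0 k1 = ahom0 k0 ∘ arr m0 by exact: (esym (hom0_eq hc)).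
have cm : arr m0 ∘ arr n1 = arr n0 ∘ arr m1 by exact: (esym (ahom_comm c)).
apply: (@double_of_ker _ _ hN1 hE1 _ _ _ _ _ _ _ _ _ m1 m0
  (arrow_hom m1 (adom (transpose a)) c1) (arrow_hom m0 (acod (transpose a)) c0)
  (arrow_hom m1 m0 cm)).
- exact: ahom_comm (fmap transpose f).
- exact: (double_sym da).
- exact: (double_sym db).
- apply: (double_of_ker hN hE (hom1_eq (ahom_comm f)) _ _ _ _ hk11 hk01 (esym c1)) => //.
- apply: (double_of_ker hN hE (hom0_eq (ahom_comm f)) _ _ _ _ hk10 hk00 (esym c0)) => //.
- by apply/(arr_kerP hN).
- by apply/(arr_kerP hN).
- by apply: arrow_eq; [apply: (esym (ahom_comm k1)) | apply: (esym (ahom_comm k0))].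
- exact: (double_sym dc).
Qed.

Lemma split_regular X Y (f : @hom C X Y) (s : hom Y X) : f ∘ s = idc Y -> RegularEpi f.
Proof.
move=> fs; exists X, (idc X), (s ∘ f); split; first by nf; rewrite cmp_assoc fs cmp_idl.
move=> T t; nf => e; exists (t ∘ s); split; first by rewrite -cmp_assoc -e.
by move=> w <-; rewrite -cmp_assoc fs cmp_idr.
Qed.

(** Centrality of [a], applied to the projections of its kernel pair, says that a matrix
    of elements [w00 w01 / w10 w11] in the bracket whose first column vanishes has equal
    entries in its second column.  In particular such a matrix with three zero entries
    vanishes.  This last condition is symmetric in rows and columns, and it gives back the
    transposed statement, with the first row in place of the first column: subtract from
    the matrix the one with both columns equal to its first column. *)
Lemma central_matrix (a : Arr (Arr C)) : B2 a ->
  forall S W (k : hom W S) (w00 w01 w10 w11 : hom S (adom (adom a))) T (t : hom T W),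
  Eob E S -> IsBracket B k ->
  arr (adom a) ∘ w00 = arr (adom a) ∘ w01 -> arr (adom a) ∘ w10 = arr (adom a) ∘ w11 ->
  ahom1 (arr a) ∘ w00 = ahom1 (arr a) ∘ w10 -> ahom1 (arr a) ∘ w01 = ahom1 (arr a) ∘ w11 ->
  w00 ∘ k ∘ t = zm hP _ _ -> w01 ∘ k ∘ t = zm hP _ _ -> w10 ∘ k ∘ t = w11 ∘ k ∘ t.
Proof.
move=> /(centralP hN1 hE1 hB1)[ea ca].
have [K [p [p' pb]]] := ne_pb hN1 (arr a) (arr a).
have [pb1 pb0] := proj1 (arr_pbP hN _ _ _ _) pb.
have eK : Eob E1 K := E_dom (E_pb hE1 pb ea (E_dom ea)).
have eK' := proj1 (arr_EobP hE K) eK.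
have [R [q0 [q1 [V [l [pbR hR hl]]]]]] := kernel_pair_ex hN hE hB eK'.
have [n [kap hkap]] := bracket_ex hN1 hB1 eK.
have [_ _ mem] := arr_bracketP hN hE hB eK' pbR hl hkap.
(* [K] is the kernel pair of [a], and [R] the kernel pair of the arrow [K]: the elements
   of [R] are the matrices. *)
have univ S (w00 w01 w10 w11 : hom S (adom (adom a))) :
    arr (adom a) ∘ w00 = arr (adom a) ∘ w01 -> arr (adom a) ∘ w10 = arr (adom a) ∘ w11 ->
    ahom1 (arr a) ∘ w00 = ahom1 (arr a) ∘ w10 -> ahom1 (arr a) ∘ w01 = ahom1 (arr a) ∘ w11 ->
    exists r : hom S R, [/\ ahom1 p ∘ q0 ∘ r = w00, ahom1 p ∘ q1 ∘ r = w01,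
                            ahom1 p' ∘ q0 ∘ r = w10 & ahom1 p' ∘ q1 ∘ r = w11].
  move=> e0 e1 f0 f1.
  have [c0 [c00 c01]] := pb_lift pb1 f0; have [c1 [c10 c11]] := pb_lift pb1 f1.
  have [|r [r0 r1]] := @pb_lift _ _ _ _ _ _ _ _ _ pbR S c0 c1.
    apply: (pb_mono pb0); rewrite !cmp_assoc -ahom_comm -!cmp_assoc ?c00 ?c01 ?c10 ?c11 //.
  by exists r; rewrite -!cmp_assoc r0 r1.
have column T (s : hom T V) : q0 ∘ l ∘ s = zm hP _ _ ->
    ahom1 p ∘ q1 ∘ l ∘ s = ahom1 p' ∘ q1 ∘ l ∘ s.
  move=> z; have [s' hs'] : exists s', ahom1 kap ∘ s' = q1 ∘ l ∘ s by apply/mem; exists s.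
  have e := hom1_eq (ca _ _ kap p p' eK hkap (proj1 pb)).
  by move: (congr1 (fun z => z ∘ s') e); rewrite /= -!cmp_assoc hs'; nf.
(* [M]: matrices in the bracket with zero first row; [L]: columns in the bracket with zero
   first entry.  The first column [c : M -> L] has no kernel by the remark on three zero
   entries, and duplication of the column splits it; so it is invertible, and every matrix
   in [M] has equal columns. *)
have [d [d0 d1]] := pb_lift pbR (erefl (arr K ∘ idc _)).
have [VK [mu hmu]] := bracket_ex hN hB (E_dom eK').
have [g0 hg0] := bracket_map hN q0 hl hmu; have [gd hgd] := bracket_map hN d hmu hl.
have [M0 [m0 hm0]] := ker_ex hP hpb (ahom1 p ∘ q0 ∘ l).
have [M [m hm]] := ker_ex hP hpb (ahom1 p ∘ q1 ∘ l ∘ m0).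
have [L [n0 hn0]] := ker_ex hP hpb (ahom1 p ∘ mu).
have z0 : ahom1 p ∘ q0 ∘ l ∘ m0 ∘ m = zm hP _ _ by rewrite (ker0 hP hm0) zm_r.
have [c hc] : exists c, n0 ∘ c = g0 ∘ m0 ∘ m.
  apply: (ker_lift (hP := hP) hn0); rewrite -z0 -!cmp_assoc; congr (_ ∘ _).
  by rewrite !cmp_assoc hg0.
have [s0 hs0] : exists s0, m0 ∘ s0 = gd ∘ n0.
  apply: (ker_lift (hP := hP) hm0); rewrite -(ker0 hP hn0) -!cmp_assoc (cmp_assoc l) hgd.
  by rewrite -!cmp_assoc (cmp_assoc q0) d0 cmp_idl.
have [s hs] : exists s, m ∘ s = s0.
  apply: (ker_lift (hP := hP) hm); rewrite -(ker0 hP hn0) -!cmp_assoc hs0 (cmp_assoc l) hgd.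
  by rewrite -!cmp_assoc (cmp_assoc q1) d1 cmp_idl.
have cs : c ∘ s = idc _.
  apply: (ker_mono hP hn0); apply: (bracket_mono hN hmu).
  rewrite (cmp_assoc n0) hc -!cmp_assoc hs hs0 !cmp_assoc hg0 -!cmp_assoc (cmp_assoc l) hgd.
  by rewrite -!cmp_assoc (cmp_assoc q0) d0 cmp_idl cmp_idr.
have ic : IsIso c.
  apply: (regular_epi_iso (h := hN)); first exact: split_regular cs.
  move=> T t ct.
  have g0z : q0 ∘ l ∘ (m0 ∘ m ∘ t) = zm hP _ _.
    have e : g0 ∘ (m0 ∘ m ∘ t) = n0 ∘ (c ∘ t) by rewrite (cmp_assoc n0) hc -!cmp_assoc.
    by rewrite -hg0 -cmp_assoc e ct !zm_l.
  have col := column _ _ g0z.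
  have e01 : ahom1 p ∘ q1 ∘ l ∘ (m0 ∘ m ∘ t) = zm hP _ _.
    by rewrite !cmp_assoc (ker0 hP hm) zm_r.
  apply: (ker_mono hP hm); apply: (ker_mono hP hm0); apply: (bracket_mono hN hl).
  rewrite !zm_l; apply: (pb_mono pbR); rewrite zm_l; first by rewrite -g0z !cmp_assoc.
  apply: (pb_mono pb1); rewrite zm_l; first by rewrite -e01 !cmp_assoc.
  by rewrite -e01 col !cmp_assoc.
have sc : s ∘ c = idc _.
  by apply: (iso_mono ic); rewrite cmp_assoc cs cmp_idl cmp_idr.
have rows : ahom1 p' ∘ q0 ∘ l ∘ m0 ∘ m = ahom1 p' ∘ q1 ∘ l ∘ m0 ∘ m.
  have e : l ∘ m0 ∘ m = d ∘ mu ∘ n0 ∘ c.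
    by rewrite -[m]cmp_idr -sc !cmp_assoc -(cmp_assoc _ m s) hs -(cmp_assoc l) hs0 cmp_assoc hgd.
  rewrite -!cmp_assoc !(cmp_assoc l) e -!cmp_assoc !(cmp_assoc _ d) d0 d1 //.
move=> S W k w00 w01 w10 w11 T t hS hk e0 e1 f0 f1 t0 t1.
have [r [r00 r01 r10 r11]] := univ _ _ _ _ _ e0 e1 f0 f1.
have [g hg] := bracket_map hN r hk hl.
have [x0 hx0] : exists x0, m0 ∘ x0 = g ∘ t.
  apply: (ker_lift (hP := hP) hm0).
  by rewrite -t0 -r00 -!cmp_assoc (cmp_assoc l) hg -!cmp_assoc.
have [x hx] : exists x, m ∘ x = x0.
  apply: (ker_lift (hP := hP) hm).
  by rewrite -t1 -r01 -!cmp_assoc hx0 (cmp_assoc l) hg -!cmp_assoc.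
have := congr1 (fun z => z ∘ x) rows.
rewrite -!cmp_assoc hx hx0 (cmp_assoc l) hg -r10 -r11.
by rewrite -!cmp_assoc.
Qed.

(** Apply the matrix criterion to [u p0, v p0 / u p1, v p1], where [p0, p1] is the kernel
    pair of the test arrow. *)
Lemma transpose_central a : B2 a -> B2 (transpose a).
Proof.
move=> ba; have [ea _] := ba.
have mat := central_matrix ba.
apply/(centralP hN1 hE1 hB1); split; first exact: (double_sym ea).
move=> T n kap u v hT hkap e.
have hT' := proj1 (arr_EobP hE T) hT.
have [R [p0 [p1 [W [k [pb hR hk]]]]]] := kernel_pair_ex hN hE hB hT'.
have [_ z0 mem] := arr_bracketP hN hE hB hT' pb hk hkap.
apply: arrow_eq => /=; last by rewrite z0 !zm_l.
have [t [t0 t1]] := proj1 (mem _ (ahom1 kap)) (ex_intro _ (idc _) (cmp_idr _)).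
have cu := ahom_comm u; have cv := ahom_comm v.
rewrite /= in cu cv.
have eu : arr (adom a) ∘ ahom1 u = arr (adom a) ∘ ahom1 v := hom1_eq e.
have sq (f : hom T (adom (transpose a))) :
    ahom1 (arr a) ∘ (ahom1 f ∘ p0) = ahom1 (arr a) ∘ (ahom1 f ∘ p1).
  have cf := ahom_comm f; rewrite /= in cf.
  by rewrite !cmp_assoc cf -!cmp_assoc (proj1 pb).
have z X (f : hom (adom T) X) : f ∘ p0 ∘ k ∘ t = zm hP _ _.
  by rewrite -!cmp_assoc (cmp_assoc p0) t0 zm_l.
have o X (f : hom (adom T) X) : f ∘ p1 ∘ k ∘ t = f ∘ ahom1 kap.
  by rewrite -!cmp_assoc (cmp_assoc p1) t1.
rewrite -!o; apply: (mat R W k (ahom1 u ∘ p0) (ahom1 v ∘ p0)) => //.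
- by rewrite !cmp_assoc eu.
- by rewrite !cmp_assoc eu.
Qed.

Lemma transpose_data : DataEquivalence E2 B2 E2 B2 transpose.
Proof.
split; first exact: transpose_eqv.
- move=> a b f; split; first exact: transpose_ext.
  move/transpose_ext; apply: (E_arrow_iso (bd_exact (arrow_data h1)) (bd_ext (arrow_data h1))).
  + exact: (transpose_invol_iso a).
  + exact: (transpose_invol_iso b).
  + exact: transpose_invol_nat.
- move=> a; split; first exact: transpose_central.
  move/transpose_central; apply: (bd_B_iso (arrow_data h1)).
  exact: transpose_invol_iso.
Qed.

End Transpose.

(** * Cubes: the coordinates of an n-fold arrow *)

(** Membership of a natural number in a subset of [n]: all operations on subsets below act
    on this predicate by a formula that does not mention [n]. *)
Definition natmem n (S : {set 'I_n}) (k : nat) : bool :=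
  if insub k is Some i then i \in S else false.

Lemma natmem_ord n (S : {set 'I_n}) (i : 'I_n) : natmem S i = (i \in S).
Proof. by rewrite /natmem valK. Qed.

Lemma natmem_lt n (S : {set 'I_n}) k : natmem S k -> k < n.
Proof. by rewrite /natmem; case: insubP => // i hi <-. Qed.

Lemma natmemP n (P : pred nat) k : natmem [set i : 'I_n | P i] k = (k < n) && P k.
Proof.
rewrite /natmem; case: insubP => [i hi <- | /negbTE ->] //=.
by rewrite inE ltn_ord.
Qed.

Lemma natmem_eq n (S T : {set 'I_n}) : natmem S =1 natmem T -> S = T.
Proof. by move=> h; apply/setP => i; rewrite -!natmem_ord h. Qed.

Lemma natmem_sub n (S T : {set 'I_n}) :
  reflect (forall k, natmem S k -> natmem T k) (S \subset T).
Proof.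
apply: (iffP subsetP) => [h k hk | h i]; last by rewrite -!natmem_ord; apply: h.
by move: hk (natmem_lt hk) => + lt; rewrite -[k]/(val (Ordinal lt)) !natmem_ord; apply: h.
Qed.

Lemma natmem0 n k : natmem (set0 : {set 'I_n}) k = false.
Proof. by rewrite /natmem; case: insubP => // i _ _; rewrite inE. Qed.

Lemma natmemT n k : natmem [set: 'I_n] k = (k < n).
Proof. by rewrite /natmem; case: insubP => [i -> | /negbTE ->] //; rewrite inE. Qed.

Lemma natmem_wid n (S : {set 'I_n}) k : natmem (wid S) k = natmem S k.
Proof.
apply/idP/idP => h.
- have lt := natmem_lt h; move: h; rewrite -[k]/(val (Ordinal lt)) natmem_ord.
  by case/imsetP => i hi ->; rewrite /= natmem_ord.
- have lt := natmem_lt h; move: h; rewrite -[k]/(val (Ordinal lt)) natmem_ord => h.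
  have /= -> := natmem_ord (wid S) (widen_ord (leqnSn n) (Ordinal lt)).
  exact: imset_f.
Qed.

Lemma natmem_widU n (S : {set 'I_n}) k : natmem (widU S) k = (k == n) || natmem S k.
Proof.
rewrite -(natmem_wid S) /natmem; case: insubP => [i hi <- | ].
  by rewrite /widU in_setU1.
by rewrite -leqNgt => /gtn_eqF ->.
Qed.

(** The subsets [S + 1] and [{0} u (S + 1)] of [n + 1]. *)
Definition up n (S : {set 'I_n}) : {set 'I_n.+1} := [set i : 'I_n.+1 | (0 < i) && natmem S i.-1].
Definition up0 n (S : {set 'I_n}) : {set 'I_n.+1} := [set i : 'I_n.+1 | (i == 0 :> nat) || natmem S i.-1].

Lemma natmem_up n (S : {set 'I_n}) k : natmem (up S) k = (0 < k) && natmem S k.-1.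
Proof.
rewrite (natmemP _ (fun k => (0 < k) && natmem S k.-1)).
by case: k => //= k; apply: andb_idl => /natmem_lt.
Qed.

Lemma natmem_up0 n (S : {set 'I_n}) k : natmem (up0 S) k = (k == 0) || natmem S k.-1.
Proof.
rewrite (natmemP _ (fun k => (k == 0) || natmem S k.-1)).
by case: k => //= k; apply: andb_idl => /natmem_lt.
Qed.

Definition swap01 (k : nat) : nat := match k with 0 => 1 | 1 => 0 | _ => k end.
Definition sw n (S : {set 'I_n.+2}) : {set 'I_n.+2} := [set i : 'I_n.+2 | natmem S (swap01 i)].

Lemma natmem_sw n (S : {set 'I_n.+2}) k : natmem (sw S) k = natmem S (swap01 k).
Proof.
rewrite (natmemP _ (fun k => natmem S (swap01 k))).
by apply: andb_idl => /natmem_lt; case: k => [|[|k]].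
Qed.

Definition natmemE := (natmem_wid, natmem_widU, natmem_up, natmem_up0, natmem_sw, natmem0, natmemT).

Lemma up_sub n (S T : {set 'I_n}) : S \subset T -> up S \subset up T.
Proof.
by move/natmem_sub => h; apply/natmem_sub => k; rewrite !natmemE => /andP[-> /h].
Qed.

Lemma up0_sub n (S T : {set 'I_n}) : S \subset T -> up0 S \subset up0 T.
Proof.
by move/natmem_sub => h; apply/natmem_sub => k; rewrite !natmemE; case: eqP => //= _ /h.
Qed.

Lemma up_up0 n (S : {set 'I_n}) : up S \subset up0 S.
Proof. by apply/natmem_sub => k; rewrite !natmemE => /andP[_ ->]; rewrite orbT. Qed.

Lemma sw_sub n (S T : {set 'I_n.+2}) : S \subset T -> sw S \subset sw T.
Proof. by move/natmem_sub => h; apply/natmem_sub => k; rewrite !natmemE; apply: h. Qed.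

Lemma eq_sub n (S T : {set 'I_n}) : S = T -> S \subset T.
Proof. by move->. Qed.

Definition low n (S : {set 'I_n.+1}) : {set 'I_n} := [set i : 'I_n | natmem S i].

Lemma natmem_low n (S : {set 'I_n.+1}) k : natmem (low S) k = (k < n) && natmem S k.
Proof. exact: (natmemP _ (natmem S)). Qed.

Lemma low_sub n (S T : {set 'I_n.+1}) : S \subset T -> low S \subset low T.
Proof.
by move/natmem_sub => h; apply/natmem_sub => k; rewrite !natmem_low => /andP[-> /h].
Qed.

Lemma low_wid n (S : {set 'I_n}) : low (wid S) = S.
Proof.
apply: natmem_eq => k; rewrite natmem_low natmemE.
by apply: andb_idl => /natmem_lt.
Qed.

Lemma low_widU n (S : {set 'I_n}) : low (widU S) = S.
Proof.
apply: natmem_eq => k; rewrite natmem_low natmemE.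
case: eqP => [-> | _]; last by apply: andb_idl => /natmem_lt.
by rewrite ltnn; apply/esym/negbTE/negP => /natmem_lt; rewrite ltnn.
Qed.

Lemma max_wid n (S : {set 'I_n}) : natmem (wid S) n = false.
Proof. by rewrite natmemE; apply/negbTE/negP => /natmem_lt; rewrite ltnn. Qed.

Lemma max_widU n (S : {set 'I_n}) : natmem (widU S) n.
Proof. by rewrite natmemE eqxx. Qed.

Lemma wid_or_widU n (S : {set 'I_n.+1}) : S = wid (low S) \/ S = widU (low S).
Proof.
case e: (natmem S n); [right | left]; apply: natmem_eq => k; rewrite !natmemE natmem_low.
- case: eqP => [-> // | /eqP ne] /=.
  by apply/esym/andb_idl => /natmem_lt; rewrite ltnS leq_eqVlt (negbTE ne).
- apply/esym/andb_idl => h; have := natmem_lt h.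
  by rewrite ltnS leq_eqVlt => /orP[/eqP ek | //]; rewrite ek e in h.
Qed.

Lemma up_or_up0 n (S : {set 'I_n.+1}) : exists S', S = up S' \/ S = up0 S'.
Proof.
exists [set i : 'I_n | natmem S i.+1].
case e: (natmem S 0); [right | left]; apply: natmem_eq => k; rewrite natmemE;
  rewrite (natmemP _ (fun k => natmem S k.+1)); case: k => [|k] //=;
  by apply/esym/andb_idl => /natmem_lt.
Qed.

Section Faces.
Variables (C : Category) (n : nat).
Implicit Types A Y : NArr C n.

Lemma face_id A (S : {set 'I_n}) (h : S \subset S) : face A h = idc _.
Proof. by rewrite -(fmap_id A); congr (fmap A _); apply: bool_irrelevance. Qed.

Lemma face_cmp A (R S T : {set 'I_n}) (h1 : R \subset S) (h2 : S \subset T) (h3 : R \subset T) :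
  face A h1 ∘ face A h2 = face A h3.
Proof. by rewrite /face -(fmap_cmp A); congr (fmap A _); apply: bool_irrelevance. Qed.

Lemma face_sq A (R S S' T : {set 'I_n}) (h1 : R \subset S) (h2 : S \subset T)
  (h3 : R \subset S') (h4 : S' \subset T) : face A h1 ∘ face A h2 = face A h3 ∘ face A h4.
Proof. by rewrite !(face_cmp _ _ _ (subset_trans h1 h2)). Qed.

Lemma face_nat A Y (f : hom A Y) (S T : {set 'I_n}) (h : S \subset T) :
  component f S ∘ face A h = face Y h ∘ component f T.
Proof. exact: (naturality f (h : @hom (op (Pow n)) T S)). Qed.

Lemma face_iso A (S T : {set 'I_n}) (h : S \subset T) : S = T -> IsIso (face A h).
Proof. by move=> e; subst T; rewrite face_id; apply: iso_id. Qed.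

End Faces.

Lemma nat_iso (J C : Category) (A Y : FunCat J C) (f : hom A Y) :
  (forall S, IsIso (component f S)) -> IsIso f.
Proof.
move=> h; pose g S := proj1_sig (constructive_indefinite_description _ (h S)).
have [gf fg] : (forall S, g S ∘ component f S = idc _) /\ (forall S, component f S ∘ g S = idc _).
  by split=> S; rewrite /g; case: constructive_indefinite_description => ? [].
have nat S T (u : hom S T) : g T ∘ fmap Y u = fmap A u ∘ g S.
  by rewrite -(cmp_idr (fmap Y u)) -(fg S) !cmp_assoc -(cmp_assoc (g T)) -naturality
    !cmp_assoc gf cmp_idl.
exists (Build_NatTrans nat : @hom (FunCat J C) Y A).
by split; apply: nat_trans_eq => S /=.
Qed.

Lemma component_eq (J C : Category) (A Y : FunCat J C) (f g : hom A Y) :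
  f = g -> forall S, component f S = component g S.
Proof. by move->. Qed.

(** * [delta] is an equivalence *)

Section Delta.
Variables (C : Category) (n : nat).

Lemma delta_faithful (A Y : NArr C n.+1) (f g : hom A Y) :
  fmap (delta C n) f = fmap (delta C n) g -> f = g.
Proof.
move=> e; apply: nat_trans_eq => S.
case: (wid_or_widU S) => ->.
- exact: (component_eq (hom0_eq e) (low S)).
- exact: (component_eq (hom1_eq e) (low S)).
Qed.

Lemma sub_wid (S T : {set 'I_n}) : wid S \subset wid T -> S \subset T.
Proof. by move/low_sub; rewrite !low_wid. Qed.
Lemma sub_wid_widU (S T : {set 'I_n}) : wid S \subset widU T -> S \subset T.
Proof. by move/low_sub; rewrite low_wid low_widU. Qed.
Lemma sub_widU (S T : {set 'I_n}) : widU S \subset widU T -> S \subset T.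
Proof. by move/low_sub; rewrite !low_widU. Qed.
Lemma widU_wid_false (S T : {set 'I_n}) : ~ (widU S \subset wid T).
Proof. by move/natmem_sub => /(_ n (max_widU S)); rewrite max_wid. Qed.

(** The component at [S] is determined by its compatibility with all faces inside [S], a
    condition that avoids case distinctions on the type of the component. *)
Lemma delta_full (A Y : NArr C n.+1) (u : hom (delta C n A) (delta C n Y)) :
  exists f : hom A Y, fmap (delta C n) f = u.
Proof.
pose good S (m : hom (fob A S) (fob Y S)) :=
  (forall S' (h : wid S' \subset S), face Y h ∘ m = component (ahom0 u) S' ∘ face A h) /\
  (forall S' (h : widU S' \subset S), face Y h ∘ m = component (ahom1 u) S' ∘ face A h).
have comm S : face Y (wid_widU S) ∘ component (ahom1 u) S = component (ahom0 u) S ∘ face A (wid_widU S).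
  exact: (component_eq (ahom_comm u) S).
have nat0 (S T : {set 'I_n}) (h : S \subset T) (k : wid S \subset wid T) :
    component (ahom0 u) S ∘ face A k = face Y k ∘ component (ahom0 u) T.
  rewrite (bool_irrelevance k (wid_sub h)).
  exact: (naturality (ahom0 u) (h : @hom (op (Pow n)) T S)).
have nat1 (S T : {set 'I_n}) (h : S \subset T) (k : widU S \subset widU T) :
    component (ahom1 u) S ∘ face A k = face Y k ∘ component (ahom1 u) T.
  rewrite (bool_irrelevance k (widU_sub h)).
  exact: (naturality (ahom1 u) (h : @hom (op (Pow n)) T S)).
have ex (S : {set 'I_n.+1}) : exists m, good S m.
  case: (wid_or_widU S) => ->; move: (low S) => {}S.
  - exists (component (ahom0 u) S); split=> S' h; last by case: (widU_wid_false h).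
    by rewrite nat0 //; apply: sub_wid.
  - exists (component (ahom1 u) S); split=> S' h; last by rewrite nat1 //; apply: sub_widU.
    have h' := sub_wid_widU h.
    rewrite -(face_cmp Y (wid_sub h') (wid_widU S)) -(face_cmp A (wid_sub h') (wid_widU S)).
    by rewrite -cmp_assoc comm !cmp_assoc (nat0 _ _ h').
pose m S := proj1_sig (constructive_indefinite_description _ (ex S)).
have hm S : good S (m S) by apply: (proj2_sig (constructive_indefinite_description _ (ex S))).
have m0 S : m (wid S) = component (ahom0 u) S.
  by have := proj1 (hm (wid S)) S (subxx _); rewrite !face_id cmp_idl cmp_idr.
have m1 S : m (widU S) = component (ahom1 u) S.
  by have := proj2 (hm (widU S)) S (subxx _); rewrite !face_id cmp_idl cmp_idr.
have nat (T S : {set 'I_n.+1}) (h : S \subset T) : m S ∘ face A h = face Y h ∘ m T.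
  move: h; case: (wid_or_widU S) => ->; move: (low S) => {}S h.
  - by rewrite m0 (proj1 (hm T)).
  - by rewrite m1 (proj2 (hm T)).
exists (@Build_NatTrans (op (Pow n.+1)) C A Y m nat).
by apply: arrow_eq; apply: nat_trans_eq => S /=; rewrite ?m0 ?m1.
Qed.

(** The cube with two given opposite faces, selected by membership of the last
    coordinate. *)
Section Glue.
Variable y : Arr (NArr C n).

Definition glue_face (b : bool) : NArr C n := if b then adom y else acod y.

Definition glue_tr (b c : bool) : (c ==> b) -> hom (glue_face b) (glue_face c) :=
  match b, c return (c ==> b) -> hom (glue_face b) (glue_face c) with
  | true, true => fun _ => idc _
  | true, false => fun _ => arr y
  | false, false => fun _ => idc _
  | false, true => fun h => False_rect _ (notF h)
  end.

Lemma glue_tr_cmp b c d (h1 : d ==> c) (h2 : c ==> b) (h3 : d ==> b) :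
  glue_tr h1 ∘ glue_tr h2 = glue_tr h3.
Proof.
by case: b h2 h3 => h2 h3; case: c h1 h2 => h1 h2; case: d h1 h3 => h1 h3 //;
  first [exact: cmp_idl | exact: cmp_idr].
Qed.

Lemma glue_tr_id b (h : b ==> b) : glue_tr h = idc _.
Proof. by case: b h. Qed.

Definition glue_map b c (S T : {set 'I_n}) (hb : c ==> b) (h : S \subset T) :
  hom (fob (glue_face b) T) (fob (glue_face c) S) :=
  component (glue_tr hb) S ∘ face (glue_face b) h.

Lemma glue_map_cmp b c d (R S T : {set 'I_n}) (h1 : d ==> c) (h2 : c ==> b) (h3 : d ==> b)
  (k1 : R \subset S) (k2 : S \subset T) (k3 : R \subset T) :
  glue_map h1 k1 ∘ glue_map h2 k2 = glue_map h3 k3.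
Proof.
rewrite /glue_map -(glue_tr_cmp h1 h2 h3) -(face_cmp _ k1 k2 k3) /= -!cmp_assoc.
by congr (_ ∘ _); rewrite !cmp_assoc face_nat.
Qed.

Lemma glue_map_sq b c c' d (R S S' T : {set 'I_n}) (h1 : d ==> c) (h2 : c ==> b)
  (h3 : d ==> c') (h4 : c' ==> b) (k1 : R \subset S) (k2 : S \subset T)
  (k3 : R \subset S') (k4 : S' \subset T) :
  glue_map h1 k1 ∘ glue_map h2 k2 = glue_map h3 k3 ∘ glue_map h4 k4.
Proof.
have h : d ==> b by apply/implyP => hd; apply: (implyP h2); apply: (implyP h1).
by rewrite !(glue_map_cmp _ _ h _ _ (subset_trans k1 k2)).
Qed.

Lemma glue_map_id b (S : {set 'I_n}) (hb : b ==> b) (h : S \subset S) :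
  glue_map hb h = idc _.
Proof. by rewrite /glue_map glue_tr_id face_id cmp_idr. Qed.

Lemma glue_map_iso b c (S T : {set 'I_n}) (hb : c ==> b) (h : S \subset T) :
  b = c -> S = T -> IsIso (glue_map hb h).
Proof. by move=> e1 e2; subst c T; rewrite glue_map_id; apply: iso_id. Qed.

Lemma max_mono (S T : {set 'I_n.+1}) : S \subset T -> natmem S n ==> natmem T n.
Proof. by move/natmem_sub => h; apply/implyP/h. Qed.

Definition glue : NArr C n.+1.
Proof.
refine (@Build_Functor (op (Pow n.+1)) C
  (fun S => fob (glue_face (natmem S n)) (low S))
  (fun T S (h : S \subset T) => glue_map (max_mono h) (low_sub h)) _ _).
- by move=> S; apply: glue_map_id.
- by move=> T S R h1 h2; apply/esym/glue_map_cmp.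
Defined.

Lemma widU_glue (S : {set 'I_n}) : S \subset low (widU S). Proof. by rewrite low_widU. Qed.
Lemma wid_glue (S : {set 'I_n}) : S \subset low (wid S). Proof. by rewrite low_wid. Qed.
Lemma maxU_glue (S : {set 'I_n}) : true ==> natmem (widU S) n. Proof. by rewrite max_widU. Qed.

Lemma glue_nat1 (T S : {set 'I_n}) (h : S \subset T) :
  glue_map (maxU_glue S) (widU_glue S) ∘
    @fmap _ _ (restrict (@widU_sub n) glue) T S h =
  face (adom y) h ∘ glue_map (maxU_glue T) (widU_glue T).
Proof.
have -> : face (adom y) h = glue_map (isT : true ==> true) h by rewrite /glue_map /= cmp_idl.
exact: (glue_map_sq (maxU_glue S) (max_mono (widU_sub h)) (isT : true ==> true)
  (maxU_glue T) (widU_glue S) (low_sub (widU_sub h)) h (widU_glue T)).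
Qed.

Lemma glue_nat0 (T S : {set 'I_n}) (h : S \subset T) :
  glue_map (isT : false ==> natmem (wid S) n) (wid_glue S) ∘
    @fmap _ _ (restrict (@wid_sub n) glue) T S h =
  face (acod y) h ∘ glue_map (isT : false ==> natmem (wid T) n) (wid_glue T).
Proof.
have -> : face (acod y) h = glue_map (isT : false ==> false) h by rewrite /glue_map /= cmp_idl.
exact: (glue_map_sq (isT : false ==> natmem (wid S) n) (max_mono (wid_sub h))
  (isT : false ==> false) (isT : false ==> natmem (wid T) n) (wid_glue S)
  (low_sub (wid_sub h)) h (wid_glue T)).
Qed.

Definition glue_iso1 : hom (adom (delta C n glue)) (adom y) :=
  @Build_NatTrans (op (Pow n)) C (restrict (@widU_sub n) glue) (adom y)
    (fun S => glue_map (maxU_glue S) (widU_glue S)) glue_nat1.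
Definition glue_iso0 : hom (acod (delta C n glue)) (acod y) :=
  @Build_NatTrans (op (Pow n)) C (restrict (@wid_sub n) glue) (acod y)
    (fun S => glue_map (isT : false ==> natmem (wid S) n) (wid_glue S)) glue_nat0.

Lemma glue_iso_comm : arr y ∘ glue_iso1 = glue_iso0 ∘ arr (delta C n glue).
Proof.
apply: nat_trans_eq => S /=.
have -> : component (arr y) S = glue_map (isT : false ==> true) (subxx S).
  by rewrite /glue_map /= face_id cmp_idr.
exact: (glue_map_sq (isT : false ==> true) (maxU_glue S)
  (isT : false ==> natmem (wid S) n) (max_mono (wid_widU S)) (subxx S) (widU_glue S)
  (wid_glue S) (low_sub (wid_widU S))).
Qed.

Lemma delta_surj : exists (A : NArr C n.+1) (u : hom (delta C n A) y), IsIso u.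
Proof.
exists glue, (arrow_hom (delta C n glue) y glue_iso_comm).
apply: arrow_iso; apply: nat_iso => S.
- apply: (glue_map_iso (maxU_glue S) (widU_glue S)); first exact: max_widU.
  by rewrite low_widU.
- apply: (glue_map_iso (isT : false ==> natmem (wid S) n) (wid_glue S)); first exact: max_wid.
  by rewrite low_wid.
Qed.

End Glue.

Lemma delta_eqv : Equivalence (delta C n).
Proof. split; [exact: delta_full | exact: delta_faithful | exact: delta_surj]. Qed.

Variables (E : ArrowClass C) (B : C -> Prop).

Lemma delta_data : DataEquivalence (Epow E n.+1) (Bpow E B n.+1)
  (DoubleExt (Epow E n)) (CentralOb (Epow E n) (Bpow E B n)) (delta C n).
Proof. by split; first exact: delta_eqv. Qed.

End Delta.

Lemma set_ord0 (S : {set 'I_0}) : S = set0.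
Proof. by apply: natmem_eq => k; rewrite natmem0; apply/negbTE/negP => /natmem_lt. Qed.

Section Evaluation.
Variable C : Category.

Definition ev0 : Functor (NArr C 0) C.
Proof.
by exists (fun A : NArr C 0 => fob A set0) (fun (A Y : NArr C 0) (f : hom A Y) => component f set0).
Defined.

Definition const_cube (X : C) : NArr C 0.
Proof.
exists (fun _ => X) (fun _ _ _ => idc X) => //.
by move=> *; rewrite cmp_idl.
Defined.

Lemma ev0_eqv : Equivalence ev0.
Proof.
split.
- move=> A Y g.
  have h0 (S : {set 'I_0}) : S \subset set0 by rewrite (set_ord0 S).
  have nat (T S : {set 'I_0}) (h : S \subset T) :
      (face Y (h0 S) ∘ g ∘ face A (sub0set S)) ∘ face A h =
      face Y h ∘ (face Y (h0 T) ∘ g ∘ face A (sub0set T)).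
    rewrite !cmp_assoc (face_cmp Y h (h0 T) (h0 S)) -!cmp_assoc.
    by rewrite (face_cmp A (sub0set S) h (sub0set T)).
  exists (@Build_NatTrans (op (Pow 0)) C A Y _ nat).
  by rewrite /= !face_id cmp_idl cmp_idr.
- by move=> A Y f g e; apply: nat_trans_eq => S; rewrite (set_ord0 S).
- by move=> X; exists (const_cube X), (idc X); apply: iso_id.
Qed.

Lemma ev0_data (E : ArrowClass C) (B : C -> Prop) :
  DataEquivalence (Epow E 0) (Bpow E B 0) E B ev0.
Proof. by split; first exact: ev0_eqv. Qed.

End Evaluation.

Lemma cube_data (C : Category) (E : ArrowClass C) (B : C -> Prop) (h : BirkhoffData E B) n :
  BirkhoffData (Epow E n) (Bpow E B n).
Proof.
elim: n => [|n IHn]; first exact: (de_data (ev0_data E B) h).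
exact: (de_data (delta_data n E B) (arrow_data IHn)).
Qed.

(** * Peeling off the first coordinate *)

Section Peel.
Variable C : Category.

Section PeelDef.
Variable n : nat.

Definition peel_ob (A : NArr C n.+1) : NArr (Arr C) n.
Proof.
refine (@Build_Functor (op (Pow n)) (Arr C)
  (fun S => Build_ArrowOb (face A (up_up0 S)) : Arr C)
  (fun T S (h : S \subset T) =>
     arrow_hom (Build_ArrowOb (face A (up_up0 T))) (Build_ArrowOb (face A (up_up0 S)))
       (face_sq A (up_up0 S) (up0_sub h) (up_sub h) (up_up0 T))) _ _).
- by move=> S; apply: arrow_eq; apply: face_id.
- by move=> T S R h1 h2; apply: arrow_eq; apply/esym/face_cmp.
Defined.

Lemma peel_comm (A Y : NArr C n.+1) (f : hom A Y) (S : {set 'I_n}) :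
  arr (fob (peel_ob Y) S) ∘ component f (up0 S) = component f (up S) ∘ arr (fob (peel_ob A) S).
Proof. exact/esym/face_nat. Qed.

Lemma peel_nat (A Y : NArr C n.+1) (f : hom A Y) (T S : {set 'I_n}) (h : S \subset T) :
  arrow_hom (fob (peel_ob A) S) (fob (peel_ob Y) S) (peel_comm f S) ∘ face (peel_ob A) h =
  face (peel_ob Y) h ∘ arrow_hom (fob (peel_ob A) T) (fob (peel_ob Y) T) (peel_comm f T).
Proof. by apply: arrow_eq; apply: face_nat. Qed.

Definition peel_hom (A Y : NArr C n.+1) (f : hom A Y) : hom (peel_ob A) (peel_ob Y) :=
  @Build_NatTrans (op (Pow n)) (Arr C) (peel_ob A) (peel_ob Y)
    (fun S => arrow_hom (fob (peel_ob A) S) (fob (peel_ob Y) S) (peel_comm f S))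
    (peel_nat f).

Definition peel : Functor (NArr C n.+1) (NArr (Arr C) n).
Proof.
refine (@Build_Functor (NArr C n.+1) (NArr (Arr C) n) peel_ob peel_hom _ _).
- by move=> A; apply: nat_trans_eq => S; apply: arrow_eq.
- by move=> A Y Z g f; apply: nat_trans_eq => S; apply: arrow_eq.
Defined.

End PeelDef.

Variables (E : ArrowClass C) (B : C -> Prop).
Hypothesis h : BirkhoffData E B.

Lemma up_wid0 : up (set0 : {set 'I_0}) = wid set0.
Proof. by apply: natmem_eq => k; rewrite !natmemE andbF. Qed.
Lemma up0_widU0 : up0 (set0 : {set 'I_0}) = widU set0.
Proof. by apply: natmem_eq => k; rewrite !natmemE. Qed.
Lemma up_wid n (S : {set 'I_n}) : up (wid S) = wid (up S).
Proof. by apply: natmem_eq => k; rewrite !natmemE. Qed.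
Lemma up0_wid n (S : {set 'I_n}) : up0 (wid S) = wid (up0 S).
Proof. by apply: natmem_eq => k; rewrite !natmemE. Qed.
Lemma up_widU n (S : {set 'I_n}) : up (widU S) = widU (up S).
Proof.
apply: natmem_eq => k; rewrite !natmemE; case: k => //= k.
Qed.
Lemma up0_widU n (S : {set 'I_n}) : up0 (widU S) = widU (up0 S).
Proof. by apply: natmem_eq => k; rewrite !natmemE; case: k. Qed.

Section Base.
Variable A : NArr C 1.

Definition peel0_iso : hom (ev0 (Arr C) (peel 0 A)) (arrow_functor (ev0 C) (delta C 0 A)) :=
  arrow_hom (ev0 (Arr C) (peel 0 A)) (arrow_functor (ev0 C) (delta C 0 A))
    (face_sq A (wid_widU set0) (eq_sub (esym up0_widU0)) (eq_sub (esym up_wid0)) (up_up0 set0)).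

End Base.

Section Step.
Variables (n : nat) (A : NArr C n.+2).

Let PA := delta (Arr C) n (peel n.+1 A).
Let QA := arrow_functor (peel n) (delta C n.+1 A).

Definition peel_iso1_at (S : {set 'I_n}) : hom (fob (adom PA) S) (fob (adom QA) S) :=
  arrow_hom (fob (adom PA) S) (fob (adom QA) S)
    (face_sq A (widU_sub (up_up0 S)) (eq_sub (esym (up0_widU S)))
               (eq_sub (esym (up_widU S))) (up_up0 (widU S))).

Definition peel_iso0_at (S : {set 'I_n}) : hom (fob (acod PA) S) (fob (acod QA) S) :=
  arrow_hom (fob (acod PA) S) (fob (acod QA) S)
    (face_sq A (wid_sub (up_up0 S)) (eq_sub (esym (up0_wid S)))
               (eq_sub (esym (up_wid S))) (up_up0 (wid S))).

Lemma peel_iso1_nat (T S : {set 'I_n}) (k : S \subset T) :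
  peel_iso1_at S ∘ face (adom PA) k = face (adom QA) k ∘ peel_iso1_at T.
Proof. by apply: arrow_eq; apply: face_sq. Qed.

Lemma peel_iso0_nat (T S : {set 'I_n}) (k : S \subset T) :
  peel_iso0_at S ∘ face (acod PA) k = face (acod QA) k ∘ peel_iso0_at T.
Proof. by apply: arrow_eq; apply: face_sq. Qed.

Definition peel_iso1 : hom (adom PA) (adom QA) :=
  @Build_NatTrans (op (Pow n)) (Arr C) (adom PA) (adom QA) peel_iso1_at peel_iso1_nat.
Definition peel_iso0 : hom (acod PA) (acod QA) :=
  @Build_NatTrans (op (Pow n)) (Arr C) (acod PA) (acod QA) peel_iso0_at peel_iso0_nat.

Lemma peel_iso_comm : arr QA ∘ peel_iso1 = peel_iso0 ∘ arr PA.
Proof. by apply: nat_trans_eq => S; apply: arrow_eq; apply: face_sq. Qed.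

Definition peel_iso : hom PA QA := arrow_hom PA QA peel_iso_comm.

Lemma peel_iso_iso : IsIso peel_iso.
Proof.
apply: arrow_iso; apply: nat_iso => S; apply: arrow_iso; apply: face_iso;
  rewrite ?up_wid ?up0_wid ?up_widU ?up0_widU //.
Qed.

End Step.

Lemma peel_data n : DataEquivalence (Epow E n.+1) (Bpow E B n.+1)
  (Epow (DoubleExt E) n) (Bpow (DoubleExt E) (CentralOb E B) n) (peel n).
Proof.
have h1 := arrow_data h.
elim: n => [|n IHn].
- have t := data_equivalence_cancel (F := ev0 (Arr C)) (G := peel 0)
    (H := functor_cmp (arrow_functor (ev0 C)) (delta C 0)) (th := peel0_iso) h1
    (ev0_data _ _)
    (data_equivalence_cmp (delta_data 0 E B) (arrow_data_equivalence (ev0_data E B) h)).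
  apply: t.
  + by move=> A; apply: arrow_iso; apply: face_iso; rewrite ?up_wid0 ?up0_widU0.
  + by move=> A Y f; apply: arrow_eq; apply/esym/face_nat.
- have hn := cube_data h1 n.
  have t := data_equivalence_cancel (F := delta (Arr C) n) (G := peel n.+1)
    (H := functor_cmp (arrow_functor (peel n)) (delta C n.+1)) (th := @peel_iso n)
    (arrow_data hn) (delta_data n (DoubleExt E) (CentralOb E B))
    (data_equivalence_cmp (delta_data n.+1 E B) (arrow_data_equivalence IHn hn)).
  apply: t.
  + exact: peel_iso_iso.
  + by move=> A Y f; apply: arrow_eq; apply: nat_trans_eq => S; apply: arrow_eq;
      apply/esym/face_nat.
Qed.

End Peel.

(** * Exchanging the first two coordinates *)

Section Swap.
Variable C : Category.

Definition swap n : Functor (NArr C n.+2) (NArr C n.+2).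
Proof.
refine (@Build_Functor (NArr C n.+2) (NArr C n.+2) (restrict (@sw_sub n))
  (fun A Y f => restrict_map (@sw_sub n) f) _ _).
- by move=> A; apply: nat_trans_eq.
- by move=> A Y Z g f; apply: nat_trans_eq.
Defined.

Lemma sw_wid n (S : {set 'I_n.+2}) : sw (wid S) = wid (sw S).
Proof. by apply: natmem_eq => k; rewrite !natmemE. Qed.
Lemma sw_widU n (S : {set 'I_n.+2}) : sw (widU S) = widU (sw S).
Proof. by apply: natmem_eq => k; rewrite !natmemE; case: k => [|[|k]]. Qed.

Let O : {set 'I_0} := set0.
Lemma sw_11 : sw (widU (widU O)) = widU (widU O).
Proof. by apply: natmem_eq => k; rewrite !natmemE; case: k => [|[|k]]. Qed.
Lemma sw_10 : sw (widU (wid O)) = wid (widU O).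
Proof. by apply: natmem_eq => k; rewrite !natmemE; case: k => [|[|k]]. Qed.
Lemma sw_01 : sw (wid (widU O)) = widU (wid O).
Proof. by apply: natmem_eq => k; rewrite !natmemE; case: k => [|[|k]]. Qed.
Lemma sw_00 : sw (wid (wid O)) = wid (wid O).
Proof. by apply: natmem_eq => k; rewrite !natmemE; case: k => [|[|k]]. Qed.

Variables (E : ArrowClass C) (B : C -> Prop).
Hypothesis h : BirkhoffData E B.

Definition square : Functor (NArr C 2) (Arr (Arr C)) :=
  functor_cmp (arrow_functor (functor_cmp (arrow_functor (ev0 C)) (delta C 0))) (delta C 1).

Lemma square_data : DataEquivalence (Epow E 2) (Bpow E B 2)
  (DoubleExt (DoubleExt E)) (CentralOb (DoubleExt E) (CentralOb E B)) square.
Proof.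
apply: (data_equivalence_cmp (delta_data 1 E B)); apply: arrow_data_equivalence.
- apply: (data_equivalence_cmp (delta_data 0 E B)); apply: arrow_data_equivalence => //.
  exact: ev0_data.
- exact: arrow_data.
Qed.

Section SwapBase.
Variable A : NArr C 2.
Let PA := square (swap 0 A).
Let QA := transpose C (square A).

Definition swap_iso1 : hom (adom PA) (adom QA) :=
  arrow_hom (adom PA) (adom QA)
    (face_sq A (wid_widU (widU O)) (eq_sub (esym sw_11)) (eq_sub (esym sw_10))
       (sw_sub (widU_sub (wid_widU O)))).
Definition swap_iso0 : hom (acod PA) (acod QA) :=
  arrow_hom (acod PA) (acod QA)
    (face_sq A (wid_widU (wid O)) (eq_sub (esym sw_01)) (eq_sub (esym sw_00))
       (sw_sub (wid_sub (wid_widU O)))).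
Lemma swap_iso_comm : arr QA ∘ swap_iso1 = swap_iso0 ∘ arr PA.
Proof.
apply: arrow_eq.
- exact: (face_sq A (widU_sub (wid_widU O)) (eq_sub (esym sw_11)) (eq_sub (esym sw_01))
            (sw_sub (wid_widU (widU O)))).
- exact: (face_sq A (wid_sub (wid_widU O)) (eq_sub (esym sw_10)) (eq_sub (esym sw_00))
            (sw_sub (wid_widU (wid O)))).
Qed.

Definition swap_iso : hom PA QA := arrow_hom PA QA swap_iso_comm.

Lemma swap_iso_iso : IsIso swap_iso.
Proof.
apply: arrow_iso; apply: arrow_iso.
- exact: (face_iso A (eq_sub (esym sw_11)) (esym sw_11)).
- exact: (face_iso A (eq_sub (esym sw_10)) (esym sw_10)).
- exact: (face_iso A (eq_sub (esym sw_01)) (esym sw_01)).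
- exact: (face_iso A (eq_sub (esym sw_00)) (esym sw_00)).
Qed.

End SwapBase.

Section SwapStep.
Variables (n : nat) (A : NArr C n.+3).
Let PA := delta C n.+2 (swap n.+1 A).
Let QA := arrow_functor (swap n) (delta C n.+2 A).

Definition swapS_iso1_at (S : {set 'I_n.+2}) : hom (fob (adom PA) S) (fob (adom QA) S) :=
  face A (eq_sub (esym (sw_widU S))).
Definition swapS_iso0_at (S : {set 'I_n.+2}) : hom (fob (acod PA) S) (fob (acod QA) S) :=
  face A (eq_sub (esym (sw_wid S))).

Lemma swapS_iso1_nat (T S : {set 'I_n.+2}) (k : S \subset T) :
  swapS_iso1_at S ∘ face (adom PA) k = face (adom QA) k ∘ swapS_iso1_at T.
Proof.
exact: (face_sq A (eq_sub (esym (sw_widU S))) (sw_sub (widU_sub k)) (widU_sub (sw_sub k))).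
Qed.

Lemma swapS_iso0_nat (T S : {set 'I_n.+2}) (k : S \subset T) :
  swapS_iso0_at S ∘ face (acod PA) k = face (acod QA) k ∘ swapS_iso0_at T.
Proof.
exact: (face_sq A (eq_sub (esym (sw_wid S))) (sw_sub (wid_sub k)) (wid_sub (sw_sub k))).
Qed.

Definition swapS_iso1 : hom (adom PA) (adom QA) :=
  @Build_NatTrans (op (Pow n.+2)) C (adom PA) (adom QA) swapS_iso1_at swapS_iso1_nat.
Definition swapS_iso0 : hom (acod PA) (acod QA) :=
  @Build_NatTrans (op (Pow n.+2)) C (acod PA) (acod QA) swapS_iso0_at swapS_iso0_nat.

Lemma swapS_iso_comm : arr QA ∘ swapS_iso1 = swapS_iso0 ∘ arr PA.
Proof.
apply: nat_trans_eq => S.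
exact: (face_sq A (wid_widU (sw S)) (eq_sub (esym (sw_widU S))) (eq_sub (esym (sw_wid S)))
          (sw_sub (wid_widU S))).
Qed.

Definition swapS_iso : hom PA QA := arrow_hom PA QA swapS_iso_comm.

Lemma swapS_iso_iso : IsIso swapS_iso.
Proof.
apply: arrow_iso; apply: nat_iso => S.
- exact: (face_iso A (eq_sub (esym (sw_widU S))) (esym (sw_widU S))).
- exact: (face_iso A (eq_sub (esym (sw_wid S))) (esym (sw_wid S))).
Qed.

End SwapStep.

Lemma swap_data n : DataEquivalence (Epow E n.+2) (Bpow E B n.+2) (Epow E n.+2) (Bpow E B n.+2)
  (swap n).
Proof.
elim: n => [|n IHn].
- have t := data_equivalence_cancel (F := square) (G := swap 0)
    (H := functor_cmp (transpose C) square) (th := swap_iso) (arrow_data (arrow_data h))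
    square_data (data_equivalence_cmp square_data (transpose_data h)).
  apply: t.
  + exact: swap_iso_iso.
  + move=> A Y f; apply: arrow_eq; apply: arrow_eq.
    * exact: (esym (face_nat f (eq_sub (esym sw_11)))).
    * exact: (esym (face_nat f (eq_sub (esym sw_10)))).
    * exact: (esym (face_nat f (eq_sub (esym sw_01)))).
    * exact: (esym (face_nat f (eq_sub (esym sw_00)))).
- have hn := cube_data h n.+2.
  have t := data_equivalence_cancel (F := delta C n.+2) (G := swap n.+1)
    (H := functor_cmp (arrow_functor (swap n)) (delta C n.+2)) (th := @swapS_iso n)
    (arrow_data hn) (delta_data n.+2 E B)
    (data_equivalence_cmp (delta_data n.+2 E B) (arrow_data_equivalence IHn hn)).
  apply: t.
  + exact: swapS_iso_iso.
  + move=> A Y f; apply: arrow_eq; apply: nat_trans_eq => S.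
    * exact: (esym (face_nat f (eq_sub (esym (sw_widU S))))).
    * exact: (esym (face_nat f (eq_sub (esym (sw_wid S))))).
Qed.

End Swap.

(** * Higher extensions, componentwise *)

Lemma up_set0 n : up (set0 : {set 'I_n}) = set0.
Proof. by apply: natmem_eq => k; rewrite !natmemE andbF. Qed.

Lemma up0_setT n : up0 [set: 'I_n] = setT.
Proof. by apply: natmem_eq => k; rewrite !natmemE; case: k. Qed.

Lemma up_inj n : injective (@up n).
Proof.
move=> S T e; apply: natmem_eq => k; have := congr1 (fun U => natmem U k.+1) e.
by rewrite !natmem_up.
Qed.

Lemma up0_inj n : injective (@up0 n).
Proof.
move=> S T e; apply: natmem_eq => k; have := congr1 (fun U => natmem U k.+1) e.
by rewrite !natmem_up0.
Qed.

Lemma up_neq_up0 n (S T : {set 'I_n}) : up S != up0 T.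
Proof.
by apply/eqP => e; have := congr1 (fun U => natmem U 0) e; rewrite natmem_up natmem_up0.
Qed.

Lemma up_neq_setT n (S : {set 'I_n}) : up S != setT.
Proof. by rewrite -up0_setT up_neq_up0. Qed.

Lemma up0_neq0 n (S : {set 'I_n}) : up0 S != set0.
Proof. by rewrite -up_set0 eq_sym up_neq_up0. Qed.

Lemma up_neq0 n (S : {set 'I_n}) : S != set0 -> up S != set0.
Proof. by apply: contra => /eqP e; apply/eqP/up_inj; rewrite e up_set0. Qed.

Lemma setT_neq0 n : [set: 'I_n.+1] != set0.
Proof.
by apply/eqP => e; have := congr1 (fun U => natmem U 0) e; rewrite natmemT natmem0.
Qed.

Lemma component_transport (C : Category) n (P X : NArr C n) (f g : hom P X) (S T : {set 'I_n}) :
  S = T -> component f S = component g S -> component f T = component g T.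
Proof. by move=> ->. Qed.

Lemma extension_Eob (C : Category) (E : ArrowClass C) (B : C -> Prop) (h : BirkhoffData E B) n
  (A : NArr C n) : NExtension E A <-> Eob (Epow E n) A.
Proof.
case: n A => [|n] A; first by rewrite (de_EobP (ev0_data E B) h).
rewrite (de_EobP (delta_data n E B) (arrow_data (cube_data h n))).
by rewrite (arr_EobP (bd_ext (cube_data h n))).
Qed.

Lemma extension_component n : forall (C : Category) (E : ArrowClass C) (B : C -> Prop)
  (h : BirkhoffData E B) (A : NArr C n) (S : {set 'I_n}),
  Eob (Epow E n) A -> Eob E (fob A S).
Proof.
elim: n => [|n IHn] C E B h A S hA.
  by rewrite (set_ord0 S); apply/(de_EobP (ev0_data E B) h).
have h1 := arrow_data h.
have hp := proj1 (de_EobP (peel_data h n) (cube_data h1 n) A) hA.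
have [S' eS] := up_or_up0 S.
have /(arr_EobP (bd_ext h)) e := IHn _ _ _ h1 _ S' hp.
by case: eS => ->; [exact: E_cod e | exact: E_dom e].
Qed.

Lemma cube_ker n : forall (C : Category) (E : ArrowClass C) (B : C -> Prop)
  (h : BirkhoffData E B) (N A Y : NArr C n) (f : hom A Y) (k : hom N A) (S : {set 'I_n}),
  IsKernel f k -> IsKernel (component f S) (component k S).
Proof.
elim: n => [|n IHn] C E B h N A Y f k S hk.
  rewrite (set_ord0 S).
  exact: (proj1 (eqv_kerP (ev0_eqv C) _ _ (ne_pointed (bd_exact (cube_data h 0)))) hk).
have hk' := proj1 (eqv_kerP (de_eqv (peel_data h n)) _ _
                     (ne_pointed (bd_exact (cube_data h n.+1)))) hk.
have [S' eS] := up_or_up0 S.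
have [k1 k0] := proj1 (arr_kerP (bd_exact h) _ _) (IHn _ _ _ (arrow_data h) _ _ _ _ _ S' hk').
by case: eS => ->.
Qed.

(** By induction on [n], from the case of one arrow, whose bracket is concentrated in its
    domain and contained in the bracket of that domain. *)
Lemma cube_bracket n : forall (C : Category) (E : ArrowClass C) (B : C -> Prop)
  (h : BirkhoffData E B) (N P : NArr C n) (kap : hom N P) (S : {set 'I_n}),
  Eob (Epow E n) P -> IsBracket (Bpow E B n) kap ->
  (S != setT -> IsZeroMor (component kap S)) /\
  (S = setT -> forall V (v : hom V (fob P S)), IsBracket B v ->
     exists u, v ∘ u = component kap S).
Proof.
elim: n => [|n IHn] C E B h N P kap S hP hk.
  have eS : setT = set0 :> {set 'I_0} by apply: set_ord0.
  rewrite (set_ord0 S); split=> [| _ V v hv]; first by rewrite eS eqxx.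
  have [u hu] := bracket_map (bd_exact h) (idc _) (de_bracket (ev0_data E B) h hk) hv.
  by exists u; rewrite hu cmp_idl.
have h1 := arrow_data h.
have hPp := proj1 (de_EobP (peel_data h n) (cube_data h1 n) P) hP.
have hkp := de_bracket (peel_data h n) (cube_data h1 n) hk.
have [S' eS] := up_or_up0 S.
have [zero full] := IHn _ _ _ h1 _ _ _ S' hPp hkp.
have ea := extension_component h1 S' hPp.
have ea' := proj1 (arr_EobP (bd_ext h) _) ea.
have [W [w hw]] := bracket_ex (bd_exact h1) (bd_birk h1) ea.
have hN := bd_exact h; pose hpt := ne_pointed hN.
have zero_comp : S' != setT ->
    IsZeroMor (component kap (up S')) /\ IsZeroMor (component kap (up0 S')).
  move/zero/(zmP (arr_pointed hN)) => z; split; apply/(zmP hpt).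
  - by have := hom0_eq z; rewrite arr_zm0.
  - by have := hom1_eq z; rewrite arr_zm1.
have [R [p0 [p1 [V' [k [pb hR hkR]]]]]] := kernel_pair_ex hN (bd_ext h) (bd_birk h) ea'.
have [_ w0 _] := arr_bracketP hN (bd_ext h) (bd_birk h) ea' pb hkR hw.
case: eS => ->; split.
- move=> _; have [/full/(_ _ _ hw)[u hu] | /zero_comp[] //] := eqVneq S' setT.
  apply/(zmP hpt).
  have e : ahom0 w ∘ ahom0 u = component kap (up S') := hom0_eq hu.
  by rewrite -e w0 zm_r.
- by move=> e; have := up_neq_setT S'; rewrite e eqxx.
- move=> ne; have [e | /zero_comp[] //] := eqVneq S' setT.
  by rewrite e up0_setT eqxx in ne.
- move=> e V v hv.
  have eS' : S' = setT by apply: up0_inj; rewrite e up0_setT.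
  have [u hu] := full eS' _ _ hw.
  have [x hx] := arr_bracket_sub hN (bd_ext h) (bd_birk h) ea' hw hv.
  exists (x ∘ ahom1 u); rewrite cmp_assoc hx; exact: (hom1_eq hu).
Qed.

Lemma peel_projective (C : Category) (E : ArrowClass C) n (P : NArr C n.+1) :
  (forall S : {set 'I_n.+1}, S != set0 -> Projective E (fob P S)) ->
  forall S : {set 'I_n}, S != set0 -> Projective (DoubleExt E) (fob (peel _ n P) S).
Proof.
by move=> pP S hS; apply: arr_projective; apply: pP; rewrite ?up0_neq0 ?up_neq0.
Qed.

(** The map on the edge in the first direction exists by projectivity; the rest is an
    extension problem for cubes of arrows, which are again projective. *)
Lemma cube_lift n : forall (C : Category) (E : ArrowClass C) (B : C -> Prop)
  (h : BirkhoffData E B) (P X : NArr C n) (S : {set 'I_n}) (phi : hom (fob P S) (fob X S)),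
  (forall S : {set 'I_n}, S != set0 -> Projective E (fob P S)) -> Eob (Epow E n) X ->
  S = set0 -> exists f : hom P X, component f S = phi.
Proof.
elim: n => [|n IHn] C E B h P X S phi pP eX eS.
  by subst S; exact: (eqv_full (ev0_eqv C)).
move: phi; rewrite {S}eS -(up_set0 n) => phi.
have h1 := arrow_data h.
have eXp := proj1 (de_EobP (peel_data h n) (cube_data h1 n) X) eX.
have ex := proj1 (arr_EobP (bd_ext h) _) (extension_component h1 set0 eXp).
have [w hw] := pP _ (up0_neq0 set0) _ _ (phi ∘ face P (up_up0 set0)) _ ex.
have [f' hf'] := IHn _ _ _ h1 (peel _ n P) (peel _ n X) set0
  (arrow_hom (fob (peel _ n P) set0) (fob (peel _ n X) set0) hw) (peel_projective pP) eXp erefl.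
have [f hf] := eqv_full (de_eqv (peel_data h n)) f'.
exists f; have := hom0_eq hf'; rewrite -hf; exact.
Qed.

(** * Maps of presentations agree on the numerator of the Hopf formula *)

(** The missing component lifts along the comparison to the pullback. *)
Lemma square_lift (C : Category) (E : ArrowClass C) (a b : Arr (Arr C))
  (c0 : hom (acod a) (acod b)) (r : hom (acod (adom a)) (acod (adom b))) :
  DoubleExt E (arr b) -> Projective E (adom (adom a)) ->
  ahom0 (arr b) ∘ r = ahom0 c0 ∘ ahom0 (arr a) ->
  exists phi : hom a b, ahom0 phi = c0 /\ ahom0 (ahom1 phi) = r.
Proof.
case=> _ _ _ _ [sq [P [p [q [u [pb _ _ [pu qu] hu]]]]]] pa er.
have [v [v1 v2]] : exists v, p ∘ v = r ∘ arr (adom a) /\ q ∘ v = ahom1 c0 ∘ ahom1 (arr a).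
  apply: (pb_lift pb).
  rewrite !cmp_assoc er (ahom_comm c0) -!cmp_assoc; congr (_ ∘ _).
  by rewrite (ahom_comm (arr a)).
have [w hw] := pa _ _ v _ hu.
have e1 : arr (adom b) ∘ w = r ∘ arr (adom a) by rewrite -pu -cmp_assoc hw v1.
have e2 : arr b ∘ arrow_hom (adom a) (adom b) e1 = c0 ∘ arr a.
  by apply: arrow_eq => //=; rewrite -qu -cmp_assoc hw v2.
by exists (arrow_hom a b e2).
Qed.

(** Generalised elements of the numerator of the Hopf formula.  Only the full set [S] is of
    interest, but it arises under several descriptions, whence the variable. *)
Definition Numerator (C : Category) (B : C -> Prop) n (P : NArr C n) (S : {set 'I_n})
  (T : C) (t : hom T (fob P S)) : Prop :=
  (exists V (v : hom V (fob P S)), IsBracket B v /\ exists t', v ∘ t' = t) /\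
  forall (R : {set 'I_n}) (k : R \subset S), R != S -> IsZeroMor (face P k ∘ t).

Definition AgreeOnNumerators (C : Category) (B : C -> Prop) n (P X : NArr C n) (f g : hom P X) :=
  forall (S : {set 'I_n}) T (t : hom T (fob P S)), S = setT -> Numerator B t ->
    component f S ∘ t = component g S ∘ t.

Definition Agreement n := forall (C : Category) (E : ArrowClass C) (B : C -> Prop)
  (h : BirkhoffData E B) (P X : NArr C n) (f g : hom P X),
  Eob (Epow E n) P -> Bpow E B n X ->
  (forall S : {set 'I_n}, S != set0 -> Projective E (fob P S)) ->
  component f set0 = component g set0 -> AgreeOnNumerators B f g.

Lemma agreement0 : Agreement 0.
Proof. by move=> C E B h P X f g _ _ _ e S T t _ _; rewrite (set_ord0 S) in t *; rewrite e. Qed.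

(** The criterion for centrality, applied to the values of [f] and [g] on the bracket. *)
Lemma agreement1 : Agreement 1.
Proof.
move=> C E B h P X f g eP bX pP e S T t eS.
have h1 := arrow_data h.
move: t; rewrite {S}eS -(up0_setT 0) (set_ord0 setT) => t [[V [v [hv [t' <-]]]] _].
have bXp := proj1 (de_B (peel_data h 0) X) bX.
have [_ cX] := proj1 (centralP (bd_exact h) (bd_ext h) (bd_birk h) _) bXp.
have e' : component f (up set0) = component g (up set0).
  by apply: component_transport e; rewrite up_set0.
rewrite !cmp_assoc; congr (_ ∘ _); apply: cX hv _; first exact: (extension_component h).
by rewrite -!face_nat e'.
Qed.

(** If two maps agree on the edge in the first direction, they agree as maps of cubes of
    arrows on the terminal vertex, and numerators are numerators of cubes of arrows: as the
    arrow at the initial vertex has a projective codomain it splits, so that its bracket is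
    the intersection of its kernel with the bracket of its domain. *)
Lemma agreement_edge n : Agreement n.+1 -> forall (C : Category) (E : ArrowClass C)
  (B : C -> Prop) (h : BirkhoffData E B) (P X : NArr C n.+2) (f g : hom P X),
  Eob (Epow E n.+2) P -> Bpow E B n.+2 X ->
  (forall S : {set 'I_n.+2}, S != set0 -> Projective E (fob P S)) ->
  component f set0 = component g set0 ->
  component f (up0 set0) = component g (up0 set0) -> AgreeOnNumerators B f g.
Proof.
move=> ag C E B h P X f g eP bX pP e0 e1 S T t eS.
have h1 := arrow_data h; have hN := bd_exact h; pose hpt := ne_pointed hN.
move: t; rewrite {S}eS -(up0_setT n.+1) => t [[V [v [hv ht]]] zt].
have ePp := proj1 (de_EobP (peel_data h n.+1) (cube_data h1 n.+1) P) eP.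
have bXp := proj1 (de_B (peel_data h n.+1) X) bX.
pose a := fob (peel _ n.+1 P) setT.
have ea : Eob (DoubleExt E) a := extension_component h1 setT ePp.
have ea' := proj1 (arr_EobP (bd_ext h) a) ea.
have at0 : arr a ∘ t = zm hpt _ _ by apply/zmP; apply: zt; apply: up_neq_up0.
have [Z hZ] := hpt.
have sa : SplitEpi (arr a).
  have [s hs] := pP _ (up_neq0 (setT_neq0 n)) _ _ (idc _) _ ea'.
  by exists s.
have [N [kap hkap]] := bracket_ex (bd_exact h1) (bd_birk h1) ea.
have [t' ht'] := split_bracket (bd_ext h) (bd_birk h) ea' sa hkap hv at0 ht.
pose TZ : Arr C := Build_ArrowOb (zm hpt T Z).
have ct : arr a ∘ t = zm hpt Z (acod a) ∘ arr TZ by rewrite zm_l.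
have [R [p0 [p1 [V' [k [pb hR hkR]]]]]] := kernel_pair_ex hN (bd_ext h) (bd_birk h) ea'.
have [zN kap0 _] := arr_bracketP hN (bd_ext h) (bd_birk h) ea' pb hkR hkap.
have ct' : arr N ∘ t' = zm hpt Z (acod N) ∘ arr TZ by apply: to_zero.
have num : Numerator (CentralOb E B) (arrow_hom TZ a ct).
  split.
    exists N, kap; split=> //; exists (arrow_hom TZ N ct').
    by apply: arrow_eq => //=; rewrite zm_l.
  move=> R' j ne; apply/(zmP (arr_pointed hN)); apply: arrow_eq.
  - rewrite arr_zm1; apply/zmP; apply: (zt _ (up0_sub j)).
    by apply: contra ne => /eqP/up0_inj ->.
  - by rewrite arr_zm0 /= zm_l.
have eq0 : component (fmap (peel _ n.+1) f) set0 = component (fmap (peel _ n.+1) g) set0.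
  apply: arrow_eq; first exact: e1.
  by apply: component_transport e0; rewrite up_set0.
have := ag _ _ _ h1 _ _ _ _ ePp bXp (peel_projective pP) eq0 setT TZ _ erefl num.
by move/hom1_eq.
Qed.

Lemma sw_set0 n : sw (set0 : {set 'I_n.+2}) = set0.
Proof. by apply: natmem_eq => k; rewrite !natmemE. Qed.

Lemma sw_setT n : sw [set: 'I_n.+2] = setT.
Proof. by apply: natmem_eq => k; rewrite !natmemE; case: k => [|[|k]]. Qed.

Lemma sw_invol n : involutive (@sw n).
Proof. by move=> S; apply: natmem_eq => k; rewrite !natmemE; case: k => [|[|k]]. Qed.

Lemma sw_edge n : sw (up0 (set0 : {set 'I_n.+1})) = up (up0 (set0 : {set 'I_n})).
Proof. by apply: natmem_eq => k; rewrite !natmemE; case: k => [|[|k]]. Qed.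

(** Two maps are compared through a third one agreeing with either of them on one of the
    first two edges at the terminal vertex. *)
Lemma agreement_step n : Agreement n.+1 -> Agreement n.+2.
Proof.
move=> ag C E B h P X f g eP bX pP e0.
have h1 := arrow_data h; have h2 := arrow_data h1.
have eX := birk_sub (bd_birk (cube_data h n.+2)) bX.
pose PP := peel _ n (peel _ n.+1 P); pose XX := peel _ n (peel _ n.+1 X).
have eXX : Eob (Epow (DoubleExt (DoubleExt E)) n) XX.
  apply: (proj1 (de_EobP (peel_data h1 n) (cube_data h2 n) _)).
  exact: (proj1 (de_EobP (peel_data h n.+1) (cube_data h1 n.+1) X) eX).
have db := proj1 (arr_EobP (bd_ext h1) _) (extension_component h2 set0 eXX).
have e0' : component f (up (up set0)) = component g (up (up set0)).
  by apply: component_transport e0; rewrite !up_set0.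
have er : face X (up_sub (up_up0 set0)) ∘ component g (up (up0 set0)) =
          component f (up (up set0)) ∘ face P (up_sub (up_up0 set0)).
  by rewrite e0' face_nat.
have [phi [phi0 phi1]] := @square_lift C E (fob PP set0) (fob XX set0)
  (component (fmap (peel _ n.+1) f) (up set0)) (component g (up (up0 set0)))
  db (pP _ (up0_neq0 _)) er.
have [k2 hk2] := cube_lift h2 phi (peel_projective (peel_projective pP)) eXX erefl.
have [k1 hk1] := eqv_full (de_eqv (peel_data h1 n)) k2.
have [k hk] := eqv_full (de_eqv (peel_data h n.+1)) k1.
rewrite -{k2}hk1 -{k1}hk in hk2.
have ek0 : component f set0 = component k set0.
  suff: component f (up (up set0)) = component k (up (up set0)).
    by apply: component_transport; rewrite !up_set0.
  exact: esym (etrans (hom0_eq (hom0_eq hk2)) (hom0_eq phi0)).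
have ekf : component f (up0 set0) = component k (up0 set0).
  suff: component f (up0 (up set0)) = component k (up0 (up set0)).
    by apply: component_transport; rewrite !up_set0.
  exact: esym (etrans (hom1_eq (hom0_eq hk2)) (hom1_eq phi0)).
have ekg : component g (up (up0 set0)) = component k (up (up0 set0)).
  exact: esym (etrans (hom0_eq (hom1_eq hk2)) phi1).
have fk := agreement_edge ag h eP bX pP ek0 ekf.
move=> S T t eS num; rewrite (fk S T t eS num).
move: t num; rewrite {S}eS -(sw_setT n) => t [br zt].
have hsw := swap_data h n; have hn := cube_data h n.+2.
have sk : AgreeOnNumerators B (fmap (swap _ n) k) (fmap (swap _ n) g).
  apply: (agreement_edge ag h).
  - exact: (proj1 (de_EobP hsw hn P) eP).
  - exact: (proj1 (de_B hsw X) bX).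
  - move=> S ne; apply: pP; apply: contra ne => /eqP e.
    by rewrite -(sw_invol S) e sw_set0.
  - apply: component_transport (_ : set0 = sw set0) _; first by rewrite sw_set0.
    by rewrite -ek0 e0.
  - apply: component_transport (esym (sw_edge n)) _.
    by rewrite ekg.
apply: (sk setT T t erefl); split=> // R j ne; apply: (zt _ (sw_sub j)).
by apply: contra ne => /eqP/(can_inj (@sw_invol n)) ->.
Qed.

Theorem agreement n : Agreement n.
Proof.
suff: Agreement n /\ Agreement n.+1 by case.
elim: n => [|n [a a1]]; first by split; [exact: agreement0 | exact: agreement1].
by split=> //; apply: agreement_step.
Qed.

(** * The Hopf formula *)

Section Hopf.
Variables (C : Category) (E : ArrowClass C) (B : C -> Prop).
Hypotheses (hC : SemiAbelian C) (h : BirkhoffData E B).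
Variable n : nat.
Implicit Types P Q X : NArr C n.
Let hN := bd_exact h.
Let hn := cube_data h n.
Let hP : Pointed C := ne_pointed hN.

Lemma joint_kernel (X : C) (I : Type) (Y : I -> C) (g : forall i, hom X (Y i)) (s : seq I) :
  exists L (l : hom L X), [/\ Mono l, forall i, List.In i s -> g i ∘ l = zm hP _ _ &
    forall T (t : hom T X), (forall i, List.In i s -> g i ∘ t = zm hP _ _) ->
      exists u, l ∘ u = t].
Proof.
elim: s => [|i s [L [l [ml zl ul]]]].
  exists X, (idc X); split=> //; first exact: (iso_mono (iso_id X)).
  by move=> T t _; exists t; rewrite cmp_idl.
have [K [k hk]] := ker_ex hP (ne_pb hN) (g i ∘ l).
exists K, (l ∘ k); split.
- by move=> T u v; rewrite -!cmp_assoc => /ml/(ker_mono hP hk).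
- move=> i' [<- | hi']; first by rewrite cmp_assoc (ker0 hP hk).
  by rewrite cmp_assoc zl // zm_r.
- move=> T t zt.
  have [u hu] : exists u, l ∘ u = t by apply: ul => i' hi'; apply: zt; right.
  have [w hw] : exists w, k ∘ w = u.
    by apply: (ker_lift (hP := hP) hk); rewrite -cmp_assoc hu; apply: zt; left.
  by exists w; rewrite -cmp_assoc hw.
Qed.

Lemma in_enum (i : 'I_n) : List.In i (enum 'I_n).
Proof.
have := mem_enum 'I_n i; rewrite inE; elim: (enum _) => //= j s IHs.
by rewrite inE => /orP[/eqP -> | /IHs]; [left | right].
Qed.

(** A face towards a proper subset factors through one that omits a single direction. *)
Lemma numeratorP P V (v : hom V (fob P setT)) T (t : hom T (fob P setT)) :
  IsBracket B v ->
  Numerator B t <-> (exists t', v ∘ t' = t) /\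
    forall i : 'I_n, face P (subsetT [set~ i]) ∘ t = zm hP _ _.
Proof.
move=> hv; split=> [[[W [w [hw [t' ht']]]] zt] | [ht zt]]; split.
- have [g hg] := bracket_map hN (idc _) hw hv.
  by exists (g ∘ t'); rewrite cmp_assoc hg cmp_idl.
- move=> i; apply/zmP; apply: zt; apply/eqP => e.
  by have := in_setT i; rewrite -e !inE eqxx.
- by exists V, v.
- move=> R k ne; have [i hi] : exists i, i \notin R.
    apply/existsP; rewrite -negb_forall; apply: contra ne => /forallP hR.
    by apply/eqP/setP => i; rewrite hR inE.
  have hR : R \subset [set~ i] by apply/subsetP => x hx; rewrite !inE; apply: contraNneq hi => <-.
  apply/(zmP hP); rewrite -(face_cmp P hR (subsetT _) k) -cmp_assoc zt.
  exact: zm_l.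
Qed.

(** What the argument needs to know about [Delta_n P]: it is the quotient of the object [M]
    of numerators by the bracket of [P], and it embeds into the quotient of the initial
    vertex by that bracket. *)
Definition DeltaSpec P (D : C) : Prop :=
  exists M (m : hom M (fob P setT)) (q : hom M D) (N : NArr C n) (kap : hom N P)
         (j : hom (fob N setT) M),
  [/\ Numerator B m /\ Mono m,
    forall T (t : hom T (fob P setT)), Numerator B t -> exists u, m ∘ u = t,
    IsBracket (Bpow E B n) kap /\ m ∘ j = component kap setT,
    IsCokernel j q &
    exists X (eta : hom P X), Bpow E B n X /\ forall T (u v : hom T M),
      component eta setT ∘ m ∘ u = component eta setT ∘ m ∘ v -> q ∘ u = q ∘ v].

(** [[P]_n] is the kernel of the unit at the initial vertex, and it lies in [M]. *)
Lemma delta_kernel P X N (eta : hom P X) (kap : hom N P) M (m : hom M (fob P setT))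
  (j : hom (fob N setT) M) : IsKernel eta kap -> Mono m -> m ∘ j = component kap setT ->
  IsKernel (component eta setT ∘ m) j.
Proof.
move=> hk mm mj; have hk' := cube_ker h setT hk; apply: (@mk_ker _ hP).
- by rewrite -cmp_assoc mj (ker0 hP hk').
- by move=> T u v e; apply: (ker_mono hP hk'); rewrite -mj -!cmp_assoc e.
- move=> T t; rewrite -cmp_assoc => /(ker_lift hk')[u hu].
  by exists u; apply: mm; rewrite cmp_assoc mj.
Qed.

Lemma delta_spec P D : Eob (Epow E n) P -> IsDelta E B P D -> DeltaSpec P D.
Proof.
move=> eP [V [v [K [k [L [l [M [mv [ml [N [kap [j [q spec]]]]]]]]]]]]].
case: spec => hv hk [[lk ul] pb] [X [eta [he hkap]]] [hj hq].
have ml' : Mono l.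
  move=> T x y e.
  have [w [_ uw]] : exists ! w, l ∘ w = l ∘ x.
    by apply: ul => i; have [u hu] := lk i; exists (u ∘ x); rewrite cmp_assoc hu.
  by rewrite -(uw x) // (uw y).
have mm : Mono (v ∘ mv).
  move=> T x y; rewrite -!cmp_assoc => /(bracket_mono hN hv) e.
  apply: (pb_mono pb) => //; apply: ml'; rewrite !cmp_assoc -(proj1 pb) -!cmp_assoc.
  by rewrite e.
have hj' : v ∘ mv ∘ j = component kap setT by rewrite -hj !cmp_assoc.
exists M, (v ∘ mv), q, N, kap, j; split=> //.
- split=> //; apply/(numeratorP _ hv); split; first by exists mv.
  move=> i; have [u hu] := lk i; rewrite (proj1 pb) -hu !cmp_assoc (ker0 hP (hk i)).
  by rewrite !zm_r.
- move=> T t /(numeratorP _ hv)[[t' ht'] zt].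
  have [w [hw _]] : exists ! w, l ∘ w = t.
    by apply: ul => i; apply: (ker_lift (hP := hP) (hk i)).
  have [|u [u1 u2]] := @pb_lift _ _ _ _ _ _ _ _ _ pb T t' w; first by rewrite ht' hw.
  by exists u; rewrite -cmp_assoc u1.
- by split=> //; exists X, eta.
- exists X, eta; split; first by case: he.
  have [Q [q' [e [cq eq me]]]] := image_factorization hC (delta_kernel hkap mm hj').
  have [w hw] := coker_lift cq (coker0 hP hq).
  move=> T x y; rewrite -eq -!cmp_assoc => /me exy.
  by rewrite -hw -!cmp_assoc exy.
Qed.

Lemma delta_ex P : Eob (Epow E n) P -> exists D, IsDelta E B P D.
Proof.
move=> eP; have eT := extension_component h setT eP.
have [V [v hv]] := bracket_ex hN (bd_birk h) eT.
have kex (i : 'I_n) : exists p : {K : C & hom K (fob P setT)},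
    IsKernel (face P (subsetT [set~ i])) (projT2 p).
  have [K [k hk]] := ker_ex hP (ne_pb hN) (face P (subsetT [set~ i])).
  by exists (existT _ K k).
pose kk i := constructive_indefinite_description _ (kex i).
pose k i := projT2 (proj1_sig (kk i)).
have hk i : IsKernel (face P (subsetT [set~ i])) (k i) by apply: (proj2_sig (kk i)).
have [L [l [ml zl ul]]] := joint_kernel (fun i : 'I_n => face P (subsetT [set~ i])) (enum 'I_n).
have [M [mv [mL pb]]] := ne_pb hN v l.
have [N [kap hkap]] := bracket_ex (bd_exact hn) (bd_birk hn) eP.
have [_ /(_ erefl _ _ hv)[u hu]] := cube_bracket h setT eP hkap.
have [w hw] : exists w, l ∘ w = component kap setT.
  apply: ul => i _; rewrite -face_nat.
  have [z _] := cube_bracket h [set~ i] eP hkap.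
  have -> : component kap [set~ i] = zm hP _ _.
    apply/zmP; apply: z; apply/eqP => e.
    by have := in_setT i; rewrite -e !inE eqxx.
  exact: zm_r.
have [|j [j1 j2]] := @pb_lift _ _ _ _ _ _ _ _ _ pb _ u w; first by rewrite hu hw.
have [X [eta [he hke]]] := hkap.
have mm : Mono (v ∘ mv).
  move=> T x y; rewrite -!cmp_assoc => /(bracket_mono hN hv) e.
  apply: (pb_mono pb) => //; apply: ml; rewrite !cmp_assoc -(proj1 pb) -!cmp_assoc.
  by rewrite e.
have hj : v ∘ mv ∘ j = component kap setT by rewrite -cmp_assoc j1.
have [D [q [e [cq _ _]]]] := image_factorization hC (delta_kernel hke mm hj).
exists D, V, v, _, k, L, l, M, mv, mL, N, kap, j, q; split=> //.
- split=> //; split.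
  + by move=> i; apply: (ker_lift (hP := hP) (hk i)); apply: zl; apply: in_enum.
  + move=> T t ht; have [x hx] : exists x, l ∘ x = t.
      by apply: ul => i _; have [y <-] := ht i; rewrite cmp_assoc (ker0 hP (hk i)) zm_r.
    by exists x; split=> // y hy; apply: ml; rewrite hx hy.
- by split=> //; rewrite cmp_assoc.
Qed.

(** Numerators and brackets are functorial in maps of cubes. *)
Lemma delta_functorial P Q (f : hom P Q) M (m : hom M (fob P setT)) D (q : hom M D)
  M' (m' : hom M' (fob Q setT)) D' (q' : hom M' D') N (kap : hom N P)
  N' (kap' : hom N' Q) (j : hom (fob N setT) M) (j' : hom (fob N' setT) M') :
  Eob (Epow E n) P -> Eob (Epow E n) Q -> Numerator B m -> Mono m' ->
  (forall T (t : hom T (fob Q setT)), Numerator B t -> exists u, m' ∘ u = t) ->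
  IsBracket (Bpow E B n) kap -> m ∘ j = component kap setT ->
  IsBracket (Bpow E B n) kap' -> m' ∘ j' = component kap' setT ->
  IsCokernel j q -> IsCokernel j' q' ->
  exists fM, m' ∘ fM = component f setT ∘ m /\ exists d, d ∘ q = q' ∘ fM.
Proof.
move=> eP eQ num mm' univ hk mj hk' mj' cq cq'.
have [V [v hv]] := bracket_ex hN (bd_birk h) (extension_component h setT eP).
have [W [w hw]] := bracket_ex hN (bd_birk h) (extension_component h setT eQ).
have [fM hfM] : exists fM, m' ∘ fM = component f setT ∘ m.
  apply: univ; apply/(numeratorP _ hw).
  have [[x hx] zm0] := proj1 (numeratorP m hv) num.
  have [g hg] := bracket_map hN (component f setT) hv hw.
  split; first by exists (g ∘ x); rewrite cmp_assoc hg -cmp_assoc hx.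
  by move=> i; rewrite cmp_assoc -face_nat -cmp_assoc zm0 zm_l.
exists fM; split=> //; apply: (coker_lift (hP := hP) cq).
have [g hg] := bracket_map (bd_exact hn) f hk hk'.
have e : fM ∘ j = j' ∘ component g setT.
  apply: mm'; rewrite cmp_assoc hfM -cmp_assoc mj cmp_assoc mj'.
  exact: (esym (component_eq hg setT)).
by rewrite -cmp_assoc e cmp_assoc (coker0 hP cq') zm_r.
Qed.

(** The composites of two lifts fix the terminal vertex, so they agree with the identity on
    numerators after the unit, that is, in the quotient. *)
Lemma delta_iso P Q D D' (a : hom (fob P set0) (fob Q set0)) (b : hom (fob Q set0) (fob P set0)) :
  Eob (Epow E n) P -> Eob (Epow E n) Q ->
  (forall S : {set 'I_n}, S != set0 -> Projective E (fob P S)) ->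
  (forall S : {set 'I_n}, S != set0 -> Projective E (fob Q S)) ->
  b ∘ a = idc _ -> a ∘ b = idc _ ->
  DeltaSpec P D -> DeltaSpec Q D' -> Isomorphic D D'.
Proof.
move=> eP eQ pP pQ ba ab.
case=> M [m [q [N [kap [j [[num mm] univ [hk mj] cq [X [eta [bX inj]]]]]]]]].
case=> M' [m' [q' [N' [kap' [j' [[num' mm'] univ' [hk' mj'] cq' [X' [eta' [bX' inj']]]]]]]]].
have [f f0] := cube_lift h a pP eQ erefl; have [g g0] := cube_lift h b pQ eP erefl.
have [fM [hfM [d hd]]] := delta_functorial f eP eQ num mm' univ' hk mj hk' mj' cq cq'.
have [gM [hgM [d' hd']]] := delta_functorial g eQ eP num' mm univ hk' mj' hk mj cq' cq.
have gf : component (eta ∘ (g ∘ f)) set0 = component eta set0.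
  by rewrite -[LHS]/(component eta set0 ∘ (component g set0 ∘ component f set0)) f0 g0 ba cmp_idr.
have fg : component (eta' ∘ (f ∘ g)) set0 = component eta' set0.
  by rewrite -[LHS]/(component eta' set0 ∘ (component f set0 ∘ component g set0)) f0 g0 ab cmp_idr.
exists d, d'; split.
- apply: (coker_epi hP cq); rewrite cmp_idl -cmp_assoc hd cmp_assoc hd' -cmp_assoc.
  rewrite -[RHS]cmp_idr; apply: inj; rewrite cmp_idr.
  rewrite -[RHS](agreement h eP bX pP gf erefl num) /=.
  by rewrite -!cmp_assoc; congr (_ ∘ _); rewrite cmp_assoc hgM -cmp_assoc hfM.
- apply: (coker_epi hP cq'); rewrite cmp_idl -cmp_assoc hd' cmp_assoc hd -cmp_assoc.
  rewrite -[RHS]cmp_idr; apply: inj'; rewrite cmp_idr.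
  rewrite -[RHS](agreement h eQ bX' pQ fg erefl num') /=.
  by rewrite -!cmp_assoc; congr (_ ∘ _); rewrite cmp_assoc hfM -cmp_assoc hgM.
Qed.

End Hopf.

Lemma eq_iso (C : Category) (X Y : C) : X = Y ->
  exists (a : hom X Y) (b : hom Y X), b ∘ a = idc X /\ a ∘ b = idc Y.
Proof. by move=> e; subst Y; exists (idc X), (idc X); rewrite cmp_idl. Qed.

Theorem theorem5p10 (C : Category) (hC : SemiAbelian C)
  (E : ArrowClass C) (hE : ClassOfExtensions E)
  (B : ob C -> Prop) (hB : StronglyBirkhoff E B)
  (hproj : EnoughProjectives E)
  (n : nat) (hn : 1 <= n) (A : ob C) (hA : Eob E A)
  (P Q : ob (NArr C n)) (hP : IsPresentation E A P) (hQ : IsPresentation E A Q) :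
  (exists D : ob C, IsDelta E B P D) /\
  (exists D' : ob C, IsDelta E B Q D') /\
  (forall D D' : ob C, IsDelta E B P D -> IsDelta E B Q D' -> Isomorphic D D').
Proof.
have h : BirkhoffData E B by split=> //; exact: semiabelian_normal_exact.
case: hP => xP P0 pP; case: hQ => xQ Q0 pQ.
have eP := proj1 (extension_Eob h P) xP; have eQ := proj1 (extension_Eob h Q) xQ.
split; first exact: (delta_ex hC h eP).
split; first exact: (delta_ex hC h eQ).
have [a [b [ba ab]]] := eq_iso (etrans P0 (esym Q0)).
move=> D D' /(delta_spec hC h eP) sP /(delta_spec hC h eQ) sQ.
exact: (delta_iso h eP eQ pP pQ ba ab sP sQ).
Qed.
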